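(* Let $f(\tau)=\prod_{n\mid N}\eta(n\tau)^{r_n}=\sum_n c_f(n)q^n$ be a weakly admissible eta-quotient of level $N$ and weight $k=\frac12\sum_n r_n$, and put $\mathbf r=(r_n)_{n\mid N}$, $x_N=\sum_{n\mid N}nr_n$, $\varpi=\prod_{n\mid N}(N/n)^{|r_n|}$. Then for every $l\in L_f$ there exists a unique $c_l\in\mathbb{C}$ such that $$l^{-\frac k2}\sum_{\substack{a\mid l,\ d=l/a\\(a,N)=1}}\Big(\frac a\varpi\Big)a^kc_f\Big(\frac{ln}{a^2}\Big)\sum_{\substack{0\le b<d\\(a,b,d)=1}}\Big(\frac{-Nb}{(a,d)}\Big)^{2k}e\Big(bd\Big(\frac nl-\frac{x_N}{24}\Big)\Big)\psi_{l,\mathbf r}(a,b)=c_l\cdot c_f(n)$$ for all $n\in\frac{x_N}{24}+\mathbb{Z}$ (with $c_f(\frac{ln}{a^2})=0$ if $\frac{ln}{a^2}\notin\frac{x_N}{24}+\mathbb{Z}$). Moreover, $c_l$ equals the left-hand side with $n=\frac{x_N}{24}$.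
   Context: $e(x)=\exp(2\pi ix)$, $q=e(\tau)$, $\eta(\tau)=q^{1/24}\prod(1-q^n)$, $r_n\in\mathbb{Z}$, level $N=\operatorname{lcm}\{n:r_n\ne0\}$. $\widetilde{\Gamma_0(N)}$: pairs $(\gamma,\varepsilon(c\tau+d)^{1/2})$, $\gamma=\begin{pmatrix}a&b\\c&d\end{pmatrix}\in\Gamma_0(N)$, $\varepsilon=\pm1$, principal square root, product $(\gamma_1,\phi_1)(\gamma_2,\phi_2)=(\gamma_1\gamma_2,\phi_1(\gamma_2\tau)\phi_2(\tau))$; $\widetilde\gamma=(\gamma,(c\tau+d)^{1/2})$; $(g|_k(\gamma,\phi))(\tau)=\phi(\tau)^{-2k}g(\gamma\tau)$. Character of $f$: $\chi(\gamma,\varepsilon(c\tau+d)^{1/2})=\varepsilon^{-2k}e(\frac1{24}\sum r_n\Psi\begin{pmatrix}a&bn\\c/n&d\end{pmatrix})$, $\Psi\begin{pmatrix}a&b\\c&d\end{pmatrix}=\frac{a+d}c+12s(-d,c)-3$ ($c>0$), $\frac{a+d}c+12s(d,-c)+3$ ($c<0$), $b$ ($c=0,a>0$), $-b-6$ ($c=0,a<0$); $s(h,c)=\sum_{r\bmod c}((r/c))((hr/c))$. $M_k$, $S_k$: holomorphic $g$ with $g|_k\gamma=\chi(\gamma)g$ on $\widetilde{\Gamma_0(N)}$, with all $g|_k\widetilde\gamma$ ($\gamma\in\mathrm{SL}_2(\mathbb{Z})$) having $q$-expansions $\sum_{n\in\frac1h\mathbb{Z}}c_nq^n$ with $c_n=0$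 for $n<0$ (resp. $n\le 0$). Weakly admissible: $f\in M_k(\Gamma_0(N),\chi)$ and either $\dim M_k(\Gamma_0(N),\chi)=1$, or $\dim M_k\ge2$, $\dim S_k(\Gamma_0(N),\chi)=1$ and $f$ is a cusp form. $m_f=24/\gcd(24,\sum(N/n)r_n,\sum nr_n)$; $L_f=\{l\ge1:l\equiv1\bmod m_f\}$ if $k\in\mathbb{Z}$, and additionally $l$ a perfect square if $k\in\frac12+\mathbb{Z}$. With $d=l/a$: $\psi_{l,\mathbf r}(a,b)=e(-\frac{k+\delta}4(d-1)+\frac{(k+\delta)(l-1)(N-1)}4)$ if $2\nmid l$; $e(-\frac{k+\delta}4(a-1)-\frac{N(k+\delta)(1+\delta_1)}4b)$ if $2\mid l,2\mid N$; $1$ if $2\mid l,2\nmid N$; $\delta=0$ (resp. $1$) if $\varpi=2^\alpha(4m+1)$ (resp. $2^\alpha(4m+3)$); $\delta_1=1$ if $2\mid l$, $4\mid N$, $k\in\frac12+\mathbb{Z}$, $v_2(\varpi)$ odd, else $0$. $(\frac mn)$: Kronecker–Jacobi symbol with $(\frac m0)=0$ for $m\ne\pm1$, $(\frac{\pm1}0)=1$. $c_f(n)$: coefficients of $f=\sum_{n\in\frac{x_N}{24}+\mathbb{Z}_{\ge0}}c_f(n)q^n$. *)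

(* Defs.v *)
From Stdlib Require Import Reals QArith ZArith List Bool.
From Coquelicot Require Import Coquelicot.

Definition Csum {A : Type} (l : list A) (F : A -> C) : C :=
  fold_right Cplus (RtoC 0) (map F l).
Definition Cprod {A : Type} (l : list A) (F : A -> C) : C :=
  fold_right Cmult (RtoC 1) (map F l).
Definition Zsum {A : Type} (l : list A) (F : A -> Z) : Z :=
  fold_right Z.add 0%Z (map F l).
Definition Zprod {A : Type} (l : list A) (F : A -> Z) : Z :=
  fold_right Z.mul 1%Z (map F l).
Definition Qsum {A : Type} (l : list A) (F : A -> Q) : Q :=
  fold_right Qplus 0%Q (map F l).

Definition divs (N : nat) : list nat :=
  filter (fun n => Nat.eqb (N mod n) 0) (seq 1 N).
Definition divsZ (l : Z) : list Z :=
  filter (fun a => Z.eqb (l mod a) 0) (map Z.of_nat (seq 1 (Z.to_nat l))).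

Definition Cpowz (z : C) (n : Z) : C :=
  match n with
  | Z0 => RtoC 1
  | Zpos p => Cpow z (Pos.to_nat p)
  | Zneg p => Cinv (Cpow z (Pos.to_nat p))
  end.

Definition cexp (z : C) : C :=
  (exp (Re z) * cos (Im z), exp (Re z) * sin (Im z))%R.
Definition e (x : R) : C := cexp (0%R, (2 * PI * x)%R).
Definition ec (z : C) : C := cexp (Cmult (RtoC (2 * PI)) (Cmult Ci z)).

(* principal square root (argument in (-pi/2, pi/2]) *)
Definition csqrt (z : C) : C :=
  (sqrt ((Cmod z + Re z) / 2),
   (if Rlt_dec (Im z) 0 then (-1)%R else 1%R) * sqrt ((Cmod z - Re z) / 2))%R.

Definition legendre (a p : Z) : Z :=
  if Z.eqb (a mod p) 0 then 0%Z
  else if existsb (fun x => Z.eqb ((x * x - a) mod p) 0)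
                  (map Z.of_nat (seq 0 (Z.to_nat p)))
       then 1%Z else (-1)%Z.

Definition kron2 (a : Z) : Z :=
  if Z.even a then 0%Z
  else if orb (Z.eqb (a mod 8) 1) (Z.eqb (a mod 8) 7) then 1%Z else (-1)%Z.

Definition kron_prime (a p : Z) : Z := if Z.eqb p 2 then kron2 a else legendre a p.

(* multiplicative extension over the prime factorisation of n >= 1,
   by trial division starting at p (every p dividing the current n is prime,
   since smaller primes have already been removed). *)
Fixpoint kron_aux (fuel : nat) (a n p : Z) : Z :=
  match fuel with
  | O => 1%Z
  | S f =>
      if Z.leb n 1 then 1%Z
      else if Z.eqb (n mod p) 0 then (kron_prime a p * kron_aux f a (n / p) p)%Z
      else kron_aux f a n (p + 1)
  end.

Definition kron (m n : Z) : Z :=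
  if Z.eqb n 0 then (if orb (Z.eqb m 1) (Z.eqb m (-1)) then 1%Z else 0%Z)
  else ((if Z.ltb n 0 then (if Z.ltb m 0 then (-1)%Z else 1%Z) else 1%Z)
        * kron_aux (2 * Z.to_nat (Z.abs n)) m (Z.abs n) 2)%Z.

Fixpoint v2_aux (fuel : nat) (n : Z) : nat :=
  match fuel with
  | O => O
  | S f => if Z.eqb n 0 then O else if Z.even n then S (v2_aux f (n / 2)) else O
  end.
Definition v2 (n : Z) : nat := v2_aux (Z.to_nat n) n.
Definition odd_part (n : Z) : Z := (n / 2 ^ Z.of_nat (v2 n))%Z.

(* An eta quotient is given by its level N and exponents r : nat -> Z,  *)
(* f(tau) = prod_{n | N} eta(n tau)^(r n).                              *)

Definition k2 (N : nat) (r : nat -> Z) : Z := Zsum (divs N) r.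
Definition wt (N : nat) (r : nat -> Z) : R := (IZR (k2 N r) / 2)%R.
Definition xN (N : nat) (r : nat -> Z) : Z :=
  Zsum (divs N) (fun n => (Z.of_nat n * r n)%Z).
Definition varpi (N : nat) (r : nat -> Z) : Z :=
  Zprod (divs N) (fun n => Z.pow (Z.of_nat (N / n)) (Z.abs (r n))).
Definition m_f (N : nat) (r : nat -> Z) : Z :=
  (24 / Z.gcd 24 (Z.gcd (Zsum (divs N) (fun n => (Z.of_nat (N / n) * r n)%Z))
                        (xN N r)))%Z.
Definition in_Lf (N : nat) (r : nat -> Z) (l : Z) : Prop :=
  (1 <= l)%Z /\ (m_f N r | l - 1)%Z /\
  (Z.odd (k2 N r) = true -> exists s : Z, l = (s * s)%Z).

Definition eta_partial (M : nat) (tau : C) : C :=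
  Cprod (seq 1 M) (fun m => Cminus (RtoC 1) (ec (Cmult (RtoC (INR m)) tau))).
Definition eta (tau : C) : C :=
  Cmult (ec (Cdiv tau (RtoC 24)))
        (real (Lim_seq (fun M => Re (eta_partial M tau))),
         real (Lim_seq (fun M => Im (eta_partial M tau)))).

Definition eta_quot (N : nat) (r : nat -> Z) (tau : C) : C :=
  Cprod (divs N) (fun n => Cpowz (eta (Cmult (RtoC (INR n)) tau)) (r n)).

(* q-expansion coefficients c_f, computed from the product formula
   f = q^(x_N/24) prod_{n|N} prod_{m>=1} (1 - q^(n m))^(r n).
   Formal power series are functions nat -> Z. *)
Definition ps_mul (p q : nat -> Z) (j : nat) : Z :=
  Zsum (seq 0 (S j)) (fun i => (p i * q (j - i)%nat)%Z).
Definition ps_one (j : nat) : Z := if Nat.eqb j 0 then 1%Z else 0%Z.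
Fixpoint ps_pow (p : nat -> Z) (n : nat) : nat -> Z :=
  match n with O => ps_one | S n' => ps_mul p (ps_pow p n') end.
(* 1 - q^s  and  (1 - q^s)^(-1) = sum_k q^(s k)   (s >= 1) *)
Definition ps_one_minus (s : nat) (j : nat) : Z :=
  if Nat.eqb j 0 then 1%Z else if Nat.eqb j s then (-1)%Z else 0%Z.
Definition ps_geom (s : nat) (j : nat) : Z :=
  if Nat.eqb (j mod s) 0 then 1%Z else 0%Z.
Definition ps_factor (s : nat) (e : Z) : nat -> Z :=
  if Z.leb 0 e then ps_pow (ps_one_minus s) (Z.to_nat e)
  else ps_pow (ps_geom s) (Z.to_nat (- e)).
(* coefficient of q^j in prod_{n|N} prod_{m>=1}(1-q^(nm))^(r n);
   factors with m > j do not affect this coefficient. *)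
Definition eta_coef (N : nat) (r : nat -> Z) (j : nat) : Z :=
  fold_right ps_mul ps_one
    (flat_map (fun n => map (fun m => ps_factor (n * m) (r n)) (seq 1 j)) (divs N)) j.

Definition cf (N : nat) (r : nat -> Z) (t : Q) : Z :=
  let u := Qred (t - inject_Z (xN N r) / inject_Z 24)%Q in
  if andb (Z.eqb (Zpos (Qden u)) 1) (Z.leb 0 (Qnum u))
  then eta_coef N r (Z.to_nat (Qnum u)) else 0%Z.

Definition saw (u c : Z) : Q :=
  if Z.eqb (u mod c) 0 then 0%Q
  else (inject_Z (u mod c) / inject_Z c - (1 # 2))%Q.
Definition dedekind (h c : Z) : Q :=
  Qsum (map Z.of_nat (seq 0 (Z.to_nat c))) (fun x => (saw x c * saw (h * x) c)%Q).

Definition Psi (a b c d : Z) : Q :=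
  if Z.ltb 0 c then (inject_Z (a + d) / inject_Z c + 12 * dedekind (- d) c - 3)%Q
  else if Z.ltb c 0 then (inject_Z (a + d) / inject_Z c + 12 * dedekind d (- c) + 3)%Q
  else if Z.ltb 0 a then inject_Z b
  else inject_Z (- b - 6).

(* chi((a b; c d), eps (c tau + d)^(1/2)) *)
Definition chi (N : nat) (r : nat -> Z) (a b c d eps : Z) : C :=
  Cmult (RtoC (powerRZ (IZR eps) (- k2 N r)))
        (e (Q2R ((1 # 24) * Qsum (divs N) (fun n =>
              inject_Z (r n) * Psi a (b * Z.of_nat n) (c / Z.of_nat n) d))%Q)).

Definition mob (a b c d : Z) (tau : C) : C :=
  Cdiv (Cplus (Cmult (RtoC (IZR a)) tau) (RtoC (IZR b)))
       (Cplus (Cmult (RtoC (IZR c)) tau) (RtoC (IZR d))).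
Definition slash (twok : Z) (g : C -> C) (a b c d : Z) (phi : C -> C) (tau : C) : C :=
  Cmult (Cpowz (phi tau) (- twok)) (g (mob a b c d tau)).

Definition upper (tau : C) : Prop := (0 < Im tau)%R.

Definition is_mod_form (N : nat) (twok : Z) (ch : Z -> Z -> Z -> Z -> Z -> C)
    (cusp : bool) (g : C -> C) : Prop :=
  (forall tau, upper tau -> @ex_derive C_AbsRing C_NormedModule g tau) /\
  (forall a b c d eps : Z, (a * d - b * c = 1)%Z -> (Z.of_nat N | c)%Z ->
     (eps = 1 \/ eps = -1)%Z ->
     forall tau, upper tau ->
       slash twok g a b c d
         (fun t => Cmult (RtoC (IZR eps))
                         (csqrt (Cplus (Cmult (RtoC (IZR c)) t) (RtoC (IZR d))))) tau
       = Cmult (ch a b c d eps) (g tau)) /\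
  (forall a b c d : Z, (a * d - b * c = 1)%Z ->
     exists h : nat, (0 < h)%nat /\
     exists cc : nat -> C, (cusp = true -> cc O = RtoC 0) /\
       forall tau, upper tau ->
         is_series (fun m => Cmult (cc m) (ec (Cdiv (Cmult (RtoC (INR m)) tau) (RtoC (INR h)))))
           (slash twok g a b c d
              (fun t => csqrt (Cplus (Cmult (RtoC (IZR c)) t) (RtoC (IZR d)))) tau)).

Definition dim_eq1 (P : (C -> C) -> Prop) : Prop :=
  exists g, P g /\ (exists tau, upper tau /\ g tau <> RtoC 0) /\
    forall h, P h -> exists c : C, forall tau, upper tau -> h tau = Cmult c (g tau).
Definition dim_ge2 (P : (C -> C) -> Prop) : Prop :=
  exists g1 g2, P g1 /\ P g2 /\
    forall c1 c2 : C, (forall tau, upper tau ->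
        Cplus (Cmult c1 (g1 tau)) (Cmult c2 (g2 tau)) = RtoC 0) ->
      c1 = RtoC 0 /\ c2 = RtoC 0.

Definition weakly_admissible (N : nat) (r : nat -> Z) : Prop :=
  let Mk := is_mod_form N (k2 N r) (chi N r) false in
  let Sk := is_mod_form N (k2 N r) (chi N r) true in
  Mk (eta_quot N r) /\
  (dim_eq1 Mk \/ (dim_ge2 Mk /\ dim_eq1 Sk /\ Sk (eta_quot N r))).

Definition delta (N : nat) (r : nat -> Z) : R :=
  if Z.eqb (odd_part (varpi N r) mod 4) 1 then 0%R else 1%R.
Definition delta1 (N : nat) (r : nat -> Z) (l : Z) : R :=
  if andb (andb (Z.even l) (Nat.eqb (N mod 4) 0))
          (andb (Z.odd (k2 N r)) (Nat.odd (v2 (varpi N r))))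
  then 1%R else 0%R.

Definition psi_lr (N : nat) (r : nat -> Z) (l a b : Z) : C :=
  let kd := (wt N r + delta N r)%R in
  let d := (l / a)%Z in
  if Z.odd l then
    e (- (kd / 4) * IZR (d - 1) + kd * IZR (l - 1) * (INR N - 1) / 4)%R
  else if Nat.even N then
    e (- (kd / 4) * IZR (a - 1) - INR N * kd * (1 + delta1 N r l) / 4 * IZR b)%R
  else RtoC 1.

Definition lhs (N : nat) (r : nat -> Z) (l : Z) (t : Q) : C :=
  let k := wt N r in
  Cmult (RtoC (Rpower (IZR l) (- (k / 2))))
   (Csum (filter (fun a => Z.eqb (Z.gcd a (Z.of_nat N)) 1) (divsZ l)) (fun a =>
      let d := (l / a)%Z in
      Cmult (RtoC (IZR (kron a (varpi N r)) * Rpower (IZR a) k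
                   * IZR (cf N r (inject_Z l * t / inject_Z (a * a))%Q))%R)
       (Csum (filter (fun b => Z.eqb (Z.gcd (Z.gcd a b) d) 1)
                     (map Z.of_nat (seq 0 (Z.to_nat d)))) (fun b =>
          Cmult (Cmult (RtoC (powerRZ (IZR (kron (- Z.of_nat N * b) (Z.gcd a d))) (k2 N r)))
                       (e (Q2R (inject_Z (b * d) *
                                (t / inject_Z l - inject_Z (xN N r) / inject_Z 24))%Q)))
                (psi_lr N r l a b))))).

(* Main.v *)
(** Put [f = eta_quot N r] and [h(tau) = f(tau/l) / f(tau)].  For [g = (a b; c d)] in
    [Gamma_0(N)] with [l | b], the character takes the same value at [g] and at
    [(a b/l; lc d)]: after shifting [d] to be positive and prime to 6, Dedekind reciprocity
    turns it into an explicit root of unity times Jacobi symbols [(c/d)], and the condition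
    [l = 1 mod m_f] (with [l] a square in half-integral weight) is what makes the two agree.
    So [h] is invariant under that subgroup, and since [f] has no zeros in the upper half
    plane, the sum of [h(g tau)] over its cosets in [Gamma_0(N)] is invariant under the full
    group, without any bookkeeping of square roots.  The cosets are indexed by the
    primitive matrices [(al be; 0 de)] of determinant [l] with [al] prime to [N]; multiplying
    back by [f], the coset contributes [f((al tau + be)/de)] times a ratio of two character
    values, which quadratic reciprocity evaluates to the weight occurring in [lhs].  The
    resulting form lies in [M_k] (in [S_k] if [f] does), hence equals [k f] for some constant
    [k], and comparing coefficients on the imaginary axis gives the identity. *)
Require Import Defs.
From Stdlib Require Import Reals QArith ZArith Lia Lra List Permutation Znumtheory Bool Qreals.
From Stdlib Require Qcanon.
From Coquelicot Require Import Coquelicot.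
Import ListNotations.

(** Every comparison of characters becomes a congruence of exponents modulo 24. The lower right
    entry is made prime to 6 because it then squares to 1 modulo 24: the eta exponent turns into an
    integer polynomial in the matrix entries plus a sign, and each comparison splits into one modulo
    8 and one modulo 3. The symbols have a single source. The Jacobi symbol is defined for every odd
    positive modulus as the product of signs in Gauss's lemma; that product is determined by
    [12 d s(c,d)] modulo 8, so Dedekind reciprocity yields quadratic reciprocity, its supplements
    and the eta multiplier together. Euler's criterion serves only to identify this symbol with the
    given Kronecker symbol. In the step from cosets to weights, diag(1, l) times a representative is
    factored so that the left factor has upper left entry 1; there the character is explicit
    although the lower right entry need not be prime to 6. *)

Open Scope Z_scope.

(** * Finite sums and products of integers *)

Definition upto (n : Z) : list Z := map Z.of_nat (seq 1 (Z.to_nat n)).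

Lemma in_upto n x : In x (upto n) <-> 1 <= x <= n.
Proof.
  unfold upto. rewrite in_map_iff. split.
  - intros [k [<- Hk]]. apply in_seq in Hk. lia.
  - intros H. exists (Z.to_nat x). split; [lia|]. apply in_seq. lia.
Qed.

Lemma NoDup_upto n : NoDup (upto n).
Proof.
  unfold upto. apply FinFun.Injective_map_NoDup; [|apply seq_NoDup].
  intros a b; lia.
Qed.

Lemma upto_succ n : 0 <= n -> upto (n + 1) = upto n ++ [n + 1].
Proof.
  intros Hn. unfold upto. replace (Z.to_nat (n + 1)) with (S (Z.to_nat n)) by lia.
  rewrite seq_S, map_app. simpl. f_equal. f_equal. lia.
Qed.

Lemma Zsum_cons {A} (a : A) l F : Zsum (a :: l) F = F a + Zsum l F.
Proof. reflexivity. Qed.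

Lemma Zsum_app {A} (l1 l2 : list A) F : Zsum (l1 ++ l2) F = Zsum l1 F + Zsum l2 F.
Proof.
  induction l1 as [|a l1 IH]; [reflexivity|].
  simpl app. rewrite !Zsum_cons, IH. lia.
Qed.

Lemma Zsum_ext {A} (l : list A) F F' :
  (forall a, In a l -> F a = F' a) -> Zsum l F = Zsum l F'.
Proof.
  induction l as [|a l IH]; intros H; [reflexivity|].
  rewrite !Zsum_cons, (H a), IH; auto with datatypes.
Qed.

Lemma Zsum_plus {A} (l : list A) F F' :
  Zsum l (fun a => F a + F' a) = Zsum l F + Zsum l F'.
Proof. induction l as [|a l IH]; [reflexivity|]. rewrite !Zsum_cons, IH. lia. Qed.

Lemma Zsum_scal {A} (l : list A) k F : Zsum l (fun a => k * F a) = k * Zsum l F.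
Proof.
  induction l as [|a l IH]; [unfold Zsum; simpl; lia|]. rewrite !Zsum_cons, IH. lia.
Qed.

Lemma Zsum_map {A B} (g : A -> B) l F : Zsum (map g l) F = Zsum l (fun a => F (g a)).
Proof. unfold Zsum. now rewrite map_map. Qed.

Lemma Zsum_perm {A} (l l' : list A) F : Permutation l l' -> Zsum l F = Zsum l' F.
Proof.
  induction 1; rewrite ?Zsum_cons; try lia; reflexivity.
Qed.

Lemma Zsum_swap {A B} (l : list A) (l' : list B) F :
  Zsum l (fun a => Zsum l' (fun b => F a b)) = Zsum l' (fun b => Zsum l (fun a => F a b)).
Proof.
  induction l as [|a l IH].
  - induction l' as [|b l' IH']; [reflexivity|]. rewrite Zsum_cons, <- IH'. reflexivity.
  - rewrite Zsum_cons, IH, <- Zsum_plus. apply Zsum_ext. reflexivity.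
Qed.

Lemma Zsum_upto_succ n F : 0 <= n -> Zsum (upto (n + 1)) F = Zsum (upto n) F + F (n + 1).
Proof.
  intros Hn. rewrite upto_succ by easy. rewrite Zsum_app. unfold Zsum at 2. simpl. lia.
Qed.

Lemma upto_ind (P : Z -> Prop) :
  P 0 -> (forall n, 0 <= n -> P n -> P (n + 1)) -> forall n, 0 <= n -> P n.
Proof. intros H0 HS n Hn. now apply (natlike_ind P). Qed.

Lemma Zsum_upto_rev n F : Zsum (upto n) F = Zsum (upto n) (fun r => F (n + 1 - r)).
Proof.
  rewrite <- (Zsum_map (fun r => n + 1 - r)). apply Zsum_perm, NoDup_Permutation.
  - apply NoDup_upto.
  - apply FinFun.Injective_map_NoDup; [intros a b; lia | apply NoDup_upto].
  - intros x. rewrite in_upto, in_map_iff. split.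
    + intros H. exists (n + 1 - x). rewrite in_upto. lia.
    + intros [y [<- Hy]]. rewrite in_upto in Hy. lia.
Qed.

Lemma Zsum_upto_const n k : 0 <= n -> Zsum (upto n) (fun _ => k) = n * k.
Proof.
  revert n. apply upto_ind; [reflexivity|]. intros n Hn IH.
  rewrite Zsum_upto_succ, IH by easy. lia.
Qed.

Lemma Zsum_upto_id n : 0 <= n -> 2 * Zsum (upto n) (fun r => r) = n * (n + 1).
Proof.
  revert n. apply upto_ind; [reflexivity|]. intros n Hn IH.
  rewrite Zsum_upto_succ by easy. lia.
Qed.

Lemma Zsum_upto_sq n : 0 <= n -> 6 * Zsum (upto n) (fun r => r * r) = n * (n + 1) * (2 * n + 1).
Proof.
  revert n. apply upto_ind; [reflexivity|]. intros n Hn IH.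
  rewrite Zsum_upto_succ by easy. lia.
Qed.

(** With [d = 2 h + 1] the odd indices are written [d - 2 r], the form to which [floor_reflect]
    applies in [flsum_parity]. *)
Lemma Zsum_upto_even_odd h F : 0 <= h ->
  Zsum (upto (2 * h)) F = Zsum (upto h) (fun r => F (2 * r) + F (2 * h + 1 - 2 * r)).
Proof.
  intros Hh. rewrite Zsum_plus.
  rewrite (Zsum_upto_rev h (fun r => F (2 * h + 1 - 2 * r))).
  rewrite (Zsum_ext _ (fun r => F (2 * h + 1 - 2 * (h + 1 - r))) (fun r => F (2 * r - 1)))
    by (intros; f_equal; lia).
  revert h Hh. apply upto_ind; [reflexivity|]. intros h Hh IH.
  replace (2 * (h + 1)) with (2 * h + 1 + 1) by lia.
  rewrite 2!Zsum_upto_succ, IH, 2!Zsum_upto_succ by lia.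
  replace (2 * (h + 1)) with (2 * h + 1 + 1) by lia.
  replace (2 * h + 1 + 1 - 1) with (2 * h + 1) by lia. lia.
Qed.

Lemma Zprod_cons {A} (a : A) l F : Zprod (a :: l) F = F a * Zprod l F.
Proof. reflexivity. Qed.

Lemma Zprod_ext {A} (l : list A) F F' :
  (forall a, In a l -> F a = F' a) -> Zprod l F = Zprod l F'.
Proof.
  induction l as [|a l IH]; intros H; [reflexivity|].
  rewrite !Zprod_cons, (H a), IH; auto with datatypes.
Qed.

Lemma Zprod_mult {A} (l : list A) F F' :
  Zprod l (fun a => F a * F' a) = Zprod l F * Zprod l F'.
Proof. induction l as [|a l IH]; [reflexivity|]. rewrite !Zprod_cons, IH. lia. Qed.

Lemma Zprod_map {A B} (g : A -> B) l F : Zprod (map g l) F = Zprod l (fun a => F (g a)).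
Proof. unfold Zprod. now rewrite map_map. Qed.

Lemma Zprod_perm {A} (l l' : list A) F : Permutation l l' -> Zprod l F = Zprod l' F.
Proof. induction 1; rewrite ?Zprod_cons; try lia; reflexivity. Qed.

Lemma odd_ex a : Z.odd a = true -> exists k, a = 2 * k + 1.
Proof. intros H. apply Zodd_ex_iff. now apply Zodd_bool_iff. Qed.

Lemma odd_intro a : (exists k, a = 2 * k + 1) -> Z.odd a = true.
Proof. intros H. apply Zodd_bool_iff. now apply Zodd_ex_iff. Qed.

Lemma even_ex a : Z.odd a = false -> exists k, a = 2 * k.
Proof. intros H. apply Z.even_spec. now rewrite <- Z.negb_odd, H. Qed.

(** * Signs in Gauss's lemma *)

(** [sgres] and [absres] are the sign and the absolute value of the residue of [m] closest to 0;
    multiples of [d] get sign 1. *)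
Definition sgres (d m : Z) : Z := if 2 * (m mod d) <? d then 1 else -1.
Definition absres (d m : Z) : Z := if 2 * (m mod d) <? d then m mod d else d - m mod d.

(* For odd [d > 0] prime to [c] this is the Jacobi symbol [(c/d)]. *)
Definition gauss (c d : Z) : Z :=
  Zprod (upto ((d - 1) / 2)) (fun r => sgres d (c * r)).

Lemma sgres_mod d m m' : m mod d = m' mod d -> sgres d m = sgres d m'.
Proof. unfold sgres. now intros ->. Qed.

Lemma sgres_pm d m : sgres d m = 1 \/ sgres d m = -1.
Proof. unfold sgres. destruct (_ <? _); auto. Qed.

Lemma sgres_absres d m : 0 < d -> (d | m - sgres d m * absres d m).
Proof.
  intros Hd. unfold sgres, absres. pose proof (Z.div_mod m d ltac:(lia)).
  destruct (_ <? _).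
  - exists (m / d). lia.
  - exists (m / d + 1). lia.
Qed.

Lemma sgres_opp d m : 0 < d -> Z.odd d = true -> ~ (d | m) -> sgres d (- m) = - sgres d m.
Proof.
  intros Hd Ho Hm. unfold sgres.
  assert (m mod d <> 0) by (intro E; apply Hm, Z.mod_divide; lia).
  rewrite Z.mod_opp_l_nz by lia.
  destruct (odd_ex _ Ho) as [k Hk].
  destruct (Z.ltb_spec (2 * (m mod d)) d), (Z.ltb_spec (2 * (d - m mod d)) d); lia.
Qed.

Lemma coprime_mul_divide c d r : Z.gcd c d = 1 -> (d | c * r) -> (d | r).
Proof. intros Hg H. apply (Z.gauss d c r); [easy|]. now rewrite Z.gcd_comm. Qed.

Lemma odd_half d : 0 < d -> Z.odd d = true -> d = 2 * ((d - 1) / 2) + 1 /\ 0 <= (d - 1) / 2.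
Proof.
  intros d_pos d_odd.
  destruct (odd_ex _ d_odd) as [k ->].
  replace (2 * k + 1 - 1) with (k * 2) by lia. rewrite Z.div_mul; lia.
Qed.

Section GaussPermutation.
Variables c d : Z.
Hypothesis d_pos : 0 < d.
Hypothesis d_odd : Z.odd d = true.
Hypothesis coprime_cd : Z.gcd c d = 1.

Lemma not_divide_half r : 1 <= r <= (d - 1) / 2 -> ~ (d | c * r).
Proof.
  intros Hr H. apply coprime_mul_divide in H; [|easy].
  apply Z.divide_pos_le in H; [|lia]. pose proof (odd_half d d_pos d_odd). lia.
Qed.

(** Equal absolute residues at [r] and [r'] make [d] divide [c (r - r')] or [c (r + r')]; the second
    is excluded by [0 < r + r' < d]. An injective self-map of a finite list permutes it. *)
Lemma absres_perm :
  Permutation (map (fun r => absres d (c * r)) (upto ((d - 1) / 2))) (upto ((d - 1) / 2)).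
Proof.
  destruct (odd_half d d_pos d_odd) as [Eh Hh]. set (h := (d - 1) / 2) in *.
  apply NoDup_Permutation_bis.
  - apply FinFun.Injective_map_NoDup_in; [|apply NoDup_upto].
    intros r r' Hr Hr' E. rewrite in_upto in Hr, Hr'.
    pose proof (sgres_absres d (c * r) d_pos) as H1.
    pose proof (sgres_absres d (c * r') d_pos) as H2. rewrite <- E in H2.
    assert (H : (d | c * (r - r')) \/ (d | c * (r + r'))).
    { destruct (sgres_pm d (c * r)) as [E1|E1], (sgres_pm d (c * r')) as [E2|E2];
        rewrite E1 in H1; rewrite E2 in H2.
      - left. replace (c * (r - r')) with (c * r - 1 * absres d (c * r) - (c * r' - 1 * absres d (c * r))) by ring.
        now apply Z.divide_sub_r.
      - right. replace (c * (r + r')) with (c * r - 1 * absres d (c * r) + (c * r' - -1 * absres d (c * r))) by ring.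
        now apply Z.divide_add_r.
      - right. replace (c * (r + r')) with (c * r - -1 * absres d (c * r) + (c * r' - 1 * absres d (c * r))) by ring.
        now apply Z.divide_add_r.
      - left. replace (c * (r - r')) with (c * r - -1 * absres d (c * r) - (c * r' - -1 * absres d (c * r))) by ring.
        now apply Z.divide_sub_r. }
    destruct H as [H|H]; apply coprime_mul_divide in H; try easy.
    + destruct H as [k Hk]. assert (k = 0) by nia. lia.
    + apply Z.divide_pos_le in H; lia.
  - rewrite length_map. lia.
  - intros x Hx. apply in_map_iff in Hx. destruct Hx as [r [<- Hr]].
    rewrite in_upto in *. unfold absres.
    pose proof (Z.mod_pos_bound (c * r) d d_pos).
    assert ((c * r) mod d <> 0).
    { intro E. apply (not_divide_half r Hr), Z.mod_divide; lia. }
    destruct (Z.ltb_spec (2 * ((c * r) mod d)) d); lia.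
Qed.

End GaussPermutation.

Lemma gauss_pm c d : gauss c d = 1 \/ gauss c d = -1.
Proof.
  unfold gauss. induction (upto ((d - 1) / 2)) as [|r l IH]; [now left|].
  rewrite Zprod_cons. destruct (sgres_pm d (c * r)), IH; lia.
Qed.

Lemma gauss_mod c c' d : c mod d = c' mod d -> gauss c d = gauss c' d.
Proof.
  intros H. apply Zprod_ext. intros r _. apply sgres_mod.
  now rewrite (Zmult_mod c), H, <- Zmult_mod.
Qed.

(** The absolute residues of the [c' r] run over the same range as [r], so the product for [c] may
    be taken over them; factor by factor the sign of [c c' r] is the sign of [c' r] times that of
    [c] times the absolute residue. *)
Lemma gauss_mul c c' d : 0 < d -> Z.odd d = true -> Z.gcd c d = 1 -> Z.gcd c' d = 1 ->
  gauss (c * c') d = gauss c d * gauss c' d.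
Proof.
  intros Hd Ho Hc Hc'. unfold gauss at 2.
  rewrite <- (Zprod_perm _ _ _ (absres_perm c' d Hd Ho Hc')), Zprod_map.
  unfold gauss. rewrite <- Zprod_mult. apply Zprod_ext.
  intros r Hr. rewrite in_upto in Hr.
  pose proof (not_divide_half c' d Hd Ho Hc' r Hr) as Hnd.
  pose proof (sgres_absres d (c' * r) Hd) as [k Hk].
  assert (Hnd' : ~ (d | c * absres d (c' * r))).
  { intro H. apply coprime_mul_divide in H; [|easy]. apply Hnd.
    replace (c' * r) with (k * d + sgres d (c' * r) * absres d (c' * r)) by lia.
    apply Z.divide_add_r; [now exists k|]. now apply Z.divide_mul_r. }
  transitivity (sgres d (sgres d (c' * r) * (c * absres d (c' * r)))).
  - apply sgres_mod.
    assert (L : forall u v w, w - u * v = k * d -> c * w = u * (c * v) + (c * k) * d)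
      by (intros u v w Hw; replace w with (u * v + k * d) by lia; ring).
    rewrite <- Z.mul_assoc, (L _ _ _ Hk). apply Z.mod_add. lia.
  - destruct (sgres_pm d (c' * r)) as [-> | ->].
    + rewrite Z.mul_1_l. lia.
    + replace (-1 * (c * absres d (c' * r))) with (- (c * absres d (c' * r))) by ring.
      rewrite sgres_opp by easy. lia.
Qed.

Lemma gauss_1_l d : 0 < d -> Z.odd d = true -> gauss 1 d = 1.
Proof.
  intros Hd Ho. pose proof (gauss_mul 1 1 d Hd Ho (Z.gcd_1_l d) (Z.gcd_1_l d)) as H.
  rewrite Z.mul_1_l in H. destruct (gauss_pm 1 d); lia.
Qed.

Lemma gauss_1_r c : gauss c 1 = 1.
Proof. reflexivity. Qed.

Lemma gauss_sq c d : 0 < d -> Z.odd d = true -> Z.gcd c d = 1 -> gauss (c * c) d = 1.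
Proof. intros. rewrite gauss_mul by easy. destruct (gauss_pm c d); nia. Qed.

(** * Dedekind sums as integers *)

Definition flsum (c d : Z) : Z := Zsum (upto (d - 1)) (fun r => r * (c * r / d)).

(* [12 d s(c,d)] *)
Definition dedZ (c d : Z) : Z :=
  2 * c * (d - 1) * (2 * d - 1) - 12 * flsum c d - 3 * d * (d - 1).

(** A product of signs is [1 - 2 V] modulo 4, [V] counting the negative ones. The multiple of 4 is
    spelled as an exact quotient instead of a second witness. *)
Lemma gauss_count l d (F : Z -> Z) :
  exists V, Zprod l (fun r => sgres d (F r)) = 1 - 2 * V + 4 * ((Zprod l (fun r => sgres d (F r)) - 1 + 2 * V) / 4)
   /\ V = Zsum l (fun r => if 2 * ((F r) mod d) <? d then 0 else 1).
Proof.
  exists (Zsum l (fun r => if 2 * ((F r) mod d) <? d then 0 else 1)). split; [|easy].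
  enough (exists t, Zprod l (fun r => sgres d (F r)) = 1 - 2 * Zsum l (fun r => if 2 * ((F r) mod d) <? d then 0 else 1) + t * 4) as [t Ht].
  { rewrite Ht at 2. match goal with |- context [?a / 4] => replace a with (t * 4) by lia end.
    rewrite Z.div_mul; lia. }
  induction l as [|a l [t IH]]; [now exists 0|].
  rewrite Zprod_cons, Zsum_cons, IH. unfold sgres. destruct (_ <? _).
  - exists t. lia.
  - set (S := Zsum _ _). exists (- t + S). lia.
Qed.

Lemma floor_reflect c d r : 0 < d -> ~ (d | c * r) -> c * (d - r) / d = c - 1 - c * r / d.
Proof.
  intros Hd Hn. assert ((c * r) mod d <> 0) by (intro E; apply Hn, Z.mod_divide; lia).
  pose proof (Z.mod_pos_bound (c * r) d Hd). pose proof (Z.div_mod (c * r) d ltac:(lia)).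
  symmetry. apply (Z.div_unique _ _ _ (d - (c * r) mod d)); lia.
Qed.

Lemma not_divide_lt c d r : Z.gcd c d = 1 -> 1 <= r < d -> ~ (d | c * r).
Proof.
  intros Hg Hr H. apply coprime_mul_divide in H; [|easy]. apply Z.divide_pos_le in H; lia.
Qed.

(** Modulo 2 only odd indices contribute. Writing them [d - 2 r] and reflecting gives [c - 1] minus
    the floor of [2 c r / d], and the parity of that floor tells whether [c r mod d] exceeds
    [d / 2], that is, whether Gauss's sign is negative. *)
Lemma flsum_parity c d : 0 < d -> Z.odd d = true -> Z.gcd c d = 1 ->
  exists t, flsum c d = (d - 1) / 2 * (c - 1) +
    Zsum (upto ((d - 1) / 2)) (fun r => if 2 * ((c * r) mod d) <? d then 0 else 1) + 2 * t.
Proof.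
  intros Hd Ho Hg. destruct (odd_half d Hd Ho) as [Eh Hh].
  unfold flsum. set (h := (d - 1) / 2) in *.
  replace (d - 1) with (2 * h) by lia. rewrite Zsum_upto_even_odd by easy.
  assert (H : forall l, (forall r, In r l -> 1 <= r <= h) -> exists t,
    Zsum l (fun r => 2 * r * (c * (2 * r) / d) + (2 * h + 1 - 2 * r) * (c * (2 * h + 1 - 2 * r) / d))
    = Zsum l (fun _ => c - 1) + Zsum l (fun r => if 2 * ((c * r) mod d) <? d then 0 else 1) + 2 * t).
  { intros l. induction l as [|r l IH]; intros Hl; [now exists 0|].
    destruct IH as [t IH]; [intros; apply Hl; now right|].
    rewrite !Zsum_cons, IH. specialize (Hl r (or_introl eq_refl)).
    rewrite <- Eh. rewrite floor_reflect by (first [easy | apply not_divide_lt; [easy|lia]]).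
    set (S1 := Zsum _ _). set (S2 := Zsum _ _).
    pose proof (Z.mod_pos_bound (c * r) d Hd). pose proof (Z.div_mod (c * r) d ltac:(lia)).
    destruct (Z.ltb_spec (2 * ((c * r) mod d)) d).
    - replace (c * (2 * r) / d) with (2 * (c * r / d))
        by (apply (Z.div_unique _ _ _ (2 * ((c * r) mod d))); lia).
      set (q := c * r / d) in *. rewrite Eh.
      exists (t + 2 * r * q + h * (c - 1 - 2 * q) - r * (c - 1 - 2 * q) - q). ring.
    - replace (c * (2 * r) / d) with (2 * (c * r / d) + 1)
        by (apply (Z.div_unique _ _ _ (2 * ((c * r) mod d) - d)); lia).
      set (q := c * r / d) in *. rewrite Eh.
      exists (t + r * (2 * q + 1) + h * (c - 1 - 2 * q - 1) - r * (c - 1 - 2 * q - 1) - q - 1). ring. }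
  destruct (H (upto h)) as [t Ht]; [intros r; now rewrite in_upto|].
  exists t. rewrite Ht, Zsum_upto_const by easy. reflexivity.
Qed.

(** The bridge from Dedekind sums to Jacobi symbols: in [12 * flsum] modulo 8 only the parity of
    [flsum] matters, and [flsum_parity] expresses it by the number of negative signs. *)
Lemma dedZ_mod8 c d : 0 < d -> Z.odd d = true -> Z.gcd c d = 1 ->
  (8 | dedZ c d - (d + 1 - 2 * gauss c d)).
Proof.
  intros Hd Ho Hg. destruct (odd_half d Hd Ho) as [Eh Hh].
  destruct (flsum_parity c d Hd Ho Hg) as [t Ht].
  destruct (gauss_count (upto ((d - 1) / 2)) d (fun r => c * r)) as [V [HV EV]].
  rewrite <- EV in Ht. unfold dedZ. rewrite Ht. clear Ht EV.
  change (Zprod (upto ((d - 1) / 2)) (fun r => sgres d (c * r))) with (gauss c d) in HV.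
  set (u := (gauss c d - 1 + 2 * V) / 4) in *. rewrite HV.
  set (h := (d - 1) / 2) in *. rewrite Eh.
  assert (exists w, h * (h + 1) = 2 * w) as [w Hw].
  { destruct (Z.Even_or_Odd h) as [[k ->]|[k ->]]; [exists (k * (2 * k + 1))|exists ((2 * k + 1) * (k + 1))]; ring. }
  exists (2 * c * h * h - h * c - 2 * V - 3 * t + u + 2 * h - 3 * w).
  assert (h * h = 2 * w - h) by lia.
  assert (c * h * h = c * (2 * w - h)) by nia.
  lia.
Qed.

Lemma residue_perm c d : 0 < d -> Z.gcd c d = 1 ->
  Permutation (map (fun r => (c * r) mod d) (upto (d - 1))) (upto (d - 1)).
Proof.
  intros Hd Hg. apply NoDup_Permutation_bis.
  - apply FinFun.Injective_map_NoDup_in; [|apply NoDup_upto].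
    intros r r' Hr Hr' E. rewrite in_upto in Hr, Hr'.
    assert (H : (d | c * (r - r'))).
    { apply Z.mod_divide; [lia|]. rewrite Z.mul_sub_distr_l, Zminus_mod, E, Z.sub_diag.
      apply Z.mod_0_l. lia. }
    apply coprime_mul_divide in H; [|easy]. destruct H as [k Hk]. assert (k = 0) by nia. lia.
  - rewrite length_map. lia.
  - intros x Hx. apply in_map_iff in Hx. destruct Hx as [r [<- Hr]].
    rewrite in_upto in *. pose proof (Z.mod_pos_bound (c * r) d Hd).
    assert ((c * r) mod d <> 0); [|lia].
    intro E. apply (not_divide_lt c d r); [easy|lia|]. apply Z.mod_divide; lia.
Qed.

(** Turns the square of a floor into a weighted count of lattice points, so that [floor_sq_sum] can
    exchange rows and columns. *)
Lemma sum_odd_le n q : 0 <= q <= n ->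
  Zsum (upto n) (fun m => if m <=? q then 2 * m - 1 else 0) = q * q.
Proof.
  intros Hq. assert (Hn : 0 <= n) by lia. revert n Hn q Hq.
  apply (upto_ind (fun n => forall q, 0 <= q <= n ->
    Zsum (upto n) (fun m => if m <=? q then 2 * m - 1 else 0) = q * q)).
  - intros q Hq. assert (q = 0) as -> by lia. reflexivity.
  - intros n Hn IH q Hq. rewrite Zsum_upto_succ by easy.
    destruct (Z.leb_spec (n + 1) q).
    + rewrite (Zsum_ext _ _ (fun m => if m <=? n then 2 * m - 1 else 0)).
      * rewrite IH by lia. nia.
      * intros m Hm. rewrite in_upto in Hm.
        destruct (Z.leb_spec m q), (Z.leb_spec m n); lia.
    + rewrite IH by lia. lia.
Qed.

Lemma sum_gt n t k : 0 <= t <= n ->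
  Zsum (upto n) (fun r => if t <? r then k else 0) = k * (n - t).
Proof.
  intros Ht. assert (Hn : 0 <= n) by lia. revert n Hn Ht.
  apply (upto_ind (fun n => 0 <= t <= n ->
    Zsum (upto n) (fun r => if t <? r then k else 0) = k * (n - t))).
  - intros H. assert (t = 0) as -> by lia. unfold Zsum; simpl. lia.
  - intros n Hn IH H. rewrite Zsum_upto_succ by easy.
    destruct (Z.ltb_spec t (n + 1)).
    + rewrite IH by lia. lia.
    + rewrite (Zsum_ext _ _ (fun _ => 0)).
      * rewrite Zsum_upto_const by easy. assert (t = n + 1) by lia. subst. lia.
      * intros r Hr. rewrite in_upto in Hr. destruct (Z.ltb_spec t r); lia.
Qed.

(** Pairing [r] with [d - r]: the two floors add up to [c - 1]. *)
Lemma floor_sum c d : 0 < c -> 0 < d -> Z.gcd c d = 1 ->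
  2 * Zsum (upto (d - 1)) (fun r => c * r / d) = (c - 1) * (d - 1).
Proof.
  intros Hc Hd Hg.
  replace (2 * Zsum (upto (d - 1)) (fun r => c * r / d)) with
    (Zsum (upto (d - 1)) (fun r => c * r / d) + Zsum (upto (d - 1)) (fun r => c * (d - 1 + 1 - r) / d)).
  2:{ rewrite <- (Zsum_upto_rev (d - 1) (fun r => c * r / d)). lia. }
  rewrite <- Zsum_plus, (Zsum_ext _ _ (fun _ => c - 1)).
  - rewrite Zsum_upto_const; lia.
  - intros r Hr. rewrite in_upto in Hr. replace (d - 1 + 1 - r) with (d - r) by lia.
    rewrite floor_reflect; [lia|easy|]. apply not_divide_lt; [easy|lia].
Qed.

(* Counts the lattice points [(r, m)] below the diagonal, weighted by [2m - 1], by rows and by columns. *)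
Lemma floor_sq_sum c d : 0 < c -> 0 < d -> Z.gcd c d = 1 ->
  2 * Zsum (upto (d - 1)) (fun r => (c * r / d) * (c * r / d))
  = 2 * (d - 1) * (c - 1) * (c - 1) - 4 * flsum d c + (c - 1) * (d - 1).
Proof.
  intros Hc Hd Hg.
  assert (Hg' : Z.gcd d c = 1) by now rewrite Z.gcd_comm.
  rewrite (Zsum_ext _ _ (fun r => Zsum (upto (c - 1)) (fun m => if d * m / c <? r then 2 * m - 1 else 0))).
  2:{ intros r Hr. rewrite in_upto in Hr.
      rewrite <- (sum_odd_le (c - 1)).
      - apply Zsum_ext. intros m Hm. rewrite in_upto in Hm.
        assert (d * m <> c * r).
        { intro E. apply (not_divide_lt c d r Hg); [lia|]. exists m. lia. }
        destruct (Z.leb_spec m (c * r / d)) as [H1|H1], (Z.ltb_spec (d * m / c) r) as [H2|H2]; try lia.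
        + exfalso. pose proof (Z.mul_div_le (c * r) d Hd). pose proof (Z.mul_div_le (d * m) c Hc). nia.
        + exfalso. pose proof (Z.mul_succ_div_gt (c * r) d Hd). pose proof (Z.mul_succ_div_gt (d * m) c Hc). nia.
      - split; [apply Z.div_pos; nia|].
        assert (c * r / d < c) by (apply Z.div_lt_upper_bound; nia). lia. }
  rewrite Zsum_swap.
  rewrite (Zsum_ext _ _ (fun m => (2 * (d - 1) * m - (d - 1)) + (-2 * (m * (d * m / c)) + (d * m / c)))).
  2:{ intros m Hm. rewrite in_upto in Hm. rewrite sum_gt; [ring|].
      split; [apply Z.div_pos; nia|].
      assert (d * m / c < d) by (apply Z.div_lt_upper_bound; nia). lia. }
  rewrite !Zsum_plus, Zsum_scal. fold (flsum d c).
  rewrite (Zsum_ext _ (fun m => 2 * (d - 1) * m - (d - 1)) (fun m => 2 * (d - 1) * m + - (d - 1))) by (intros; ring).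
  rewrite Zsum_plus, Zsum_scal, Zsum_upto_const by lia.
  pose proof (floor_sum d c Hd Hc Hg'). pose proof (Zsum_upto_id (c - 1) ltac:(lia)).
  nia.
Qed.

(** The residues [c r mod d] permute [1, ..., d - 1], so their squares have a known sum. Expanding
    [(c r - d floor(c r / d))^2] relates [flsum c d] to the sum of squared floors, which
    [floor_sq_sum] expresses by [flsum d c]. *)
Lemma dedZ_reciprocity c d : 0 < c -> 0 < d -> Z.gcd c d = 1 ->
  c * dedZ c d + d * dedZ d c = c * c + d * d + 1 - 3 * c * d.
Proof.
  intros Hc Hd Hg.
  pose proof (floor_sq_sum c d Hc Hd Hg) as H1.
  pose proof (Zsum_upto_sq (d - 1) ltac:(lia)) as H2.
  pose proof (Zsum_perm _ _ (fun x => x * x) (residue_perm c d Hd Hg)) as H3.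
  rewrite Zsum_map in H3.
  rewrite (Zsum_ext _ _ (fun r => c * c * (r * r) + (- (2 * c * d) * (r * (c * r / d)) + d * d * ((c * r / d) * (c * r / d))))) in H3.
  2:{ intros r _. rewrite Z.mod_eq by lia. ring. }
  rewrite !Zsum_plus, !Zsum_scal in H3. fold (flsum c d) in H3.
  unfold dedZ. set (Q := Zsum _ (fun r => c * r / d * (c * r / d))) in *.
  set (S := Zsum _ (fun x => x * x)) in *. set (A := flsum c d) in *. set (B := flsum d c) in *.
  apply (Z.mul_reg_l _ _ d); [lia|].
  assert (12 * c * d * A = (c * c - 1) * (6 * S) + 3 * d * d * (2 * Q)) by lia.
  rewrite H1, H2 in H. 
  replace (d - 1 + 1) with d in H by lia. replace (2 * (d - 1) + 1) with (2 * d - 1) in H by lia.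
  lia.
Qed.

Lemma dedZ_opp c d : 0 < d -> Z.gcd c d = 1 -> dedZ (- c) d = - dedZ c d.
Proof.
  intros Hd Hg. unfold dedZ, flsum.
  rewrite (Zsum_ext _ (fun r => r * (- c * r / d)) (fun r => -1 * (r * (c * r / d)) + -1 * r)).
  - rewrite Zsum_plus, !Zsum_scal. pose proof (Zsum_upto_id (d - 1) ltac:(lia)).
    set (S := Zsum _ (fun r => r)) in *. set (S' := Zsum _ _). lia.
  - intros r Hr. rewrite in_upto in Hr. rewrite Z.mul_opp_l, Z.div_opp_l_nz; [ring|lia|].
    intro E. apply (not_divide_lt c d r); [easy|lia|]. apply Z.mod_divide; lia.
Qed.

Lemma odd_mod8 d : Z.odd d = true -> d mod 8 = 1 \/ d mod 8 = 3 \/ d mod 8 = 5 \/ d mod 8 = 7.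
Proof.
  intros Ho. destruct (odd_ex _ Ho) as [k ->].
  pose proof (Z.mod_pos_bound (2 * k + 1) 8 ltac:(lia)). pose proof (Z.div_mod (2 * k + 1) 8 ltac:(lia)). lia.
Qed.

(** Inserting [dedZ_mod8] for both sums into Dedekind reciprocity leaves a congruence modulo 8; for
    each pair of odd residues modulo 8 only the right product of signs satisfies it. *)
Lemma gauss_reciprocity c d : 0 < c -> 0 < d -> Z.odd c = true -> Z.odd d = true -> Z.gcd c d = 1 ->
  gauss c d * gauss d c = if (c mod 4 =? 3) && (d mod 4 =? 3) then -1 else 1.
Proof.
  intros Hc Hd Oc Od Hg. assert (Hg' : Z.gcd d c = 1) by now rewrite Z.gcd_comm.
  pose proof (dedZ_reciprocity c d Hc Hd Hg) as R.
  destruct (dedZ_mod8 c d Hd Od Hg) as [u Hu]. destruct (dedZ_mod8 d c Hc Oc Hg') as [v Hv].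
  replace (dedZ c d) with (u * 8 + (d + 1 - 2 * gauss c d)) in R by lia.
  replace (dedZ d c) with (v * 8 + (c + 1 - 2 * gauss d c)) in R by lia.
  clear Hu Hv. pose proof (Z.div_mod c 8 ltac:(lia)) as Ec. pose proof (Z.div_mod d 8 ltac:(lia)) as Ed.
  set (c' := c / 8) in *. set (d' := d / 8) in *.
  assert (Mc : c mod 4 = (c mod 8) mod 4) by (rewrite Ec at 1; rewrite Z.add_comm; replace (8 * c') with ((2 * c') * 4) by ring; rewrite Z.mod_add; lia).
  assert (Md : d mod 4 = (d mod 8) mod 4) by (rewrite Ed at 1; rewrite Z.add_comm; replace (8 * d') with ((2 * d') * 4) by ring; rewrite Z.mod_add; lia).
  rewrite Mc, Md.
  destruct (odd_mod8 c Oc) as [E|[E|[E|E]]]; rewrite E in *;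
  destruct (odd_mod8 d Od) as [E'|[E'|[E'|E']]]; rewrite E' in *;
  destruct (gauss_pm c d) as [G1|G1]; rewrite G1 in *;
  destruct (gauss_pm d c) as [G2|G2]; rewrite G2 in *; simpl; try reflexivity; exfalso;
  rewrite Ec, Ed in R; ring_simplify in R; lia.
Qed.

(** [dedZ 1 d] is explicit, by reciprocity with the trivial sum modulo 1, and [dedZ] is odd in its
    first argument. *)
Lemma gauss_opp1 d : 0 < d -> Z.odd d = true -> gauss (-1) d = if d mod 4 =? 3 then -1 else 1.
Proof.
  intros Hd Od.
  assert (Hg : Z.gcd (-1) d = 1) by now destruct d.
  assert (E1 : dedZ 1 d = (d - 1) * (d - 2)).
  { pose proof (dedZ_reciprocity 1 d ltac:(lia) Hd ltac:(apply Z.gcd_1_l)) as R.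
    replace (dedZ d 1) with 0 in R by (unfold dedZ; change (flsum d 1) with 0; ring).
    ring_simplify in R. rewrite R. ring. }
  pose proof (dedZ_opp 1 d Hd ltac:(apply Z.gcd_1_l)) as E2. rewrite E1 in E2.
  destruct (dedZ_mod8 (-1) d Hd Od Hg) as [u Hu]. change (- (1)) with (-1) in E2. rewrite E2 in Hu.
  pose proof (Z.div_mod d 8 ltac:(lia)) as Ed. set (d' := d / 8) in *.
  assert (Md : d mod 4 = (d mod 8) mod 4) by (rewrite Ed at 1; rewrite Z.add_comm; replace (8 * d') with ((2 * d') * 4) by ring; rewrite Z.mod_add; lia).
  rewrite Md. destruct (odd_mod8 d Od) as [E'|[E'|[E'|E']]]; rewrite E' in *;
  destruct (gauss_pm (-1) d) as [G1|G1]; rewrite G1 in *; simpl; try reflexivity; exfalso;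
  rewrite Ed in Hu; ring_simplify in Hu; lia.
Qed.

(** The sum modulo 2 vanishes, so reciprocity evaluates [dedZ 2 d], whose residue modulo 8 decides
    the sign. *)
Lemma gauss_2 d : 0 < d -> Z.odd d = true ->
  gauss 2 d = if (d mod 8 =? 1) || (d mod 8 =? 7) then 1 else -1.
Proof.
  intros Hd Od. assert (Ho := Od). destruct (odd_ex _ Ho) as [k Hk].
  assert (Hg : Z.gcd 2 d = 1).
  { rewrite Hk. replace (2 * k + 1) with (1 + k * 2) by lia. rewrite Z.gcd_add_mult_diag_r. reflexivity. }
  pose proof (dedZ_reciprocity 2 d ltac:(lia) Hd Hg) as R.
  assert (E1 : dedZ d 2 = 0).
  { unfold dedZ. replace (flsum d 2) with k; [rewrite Hk; ring|].
    unfold flsum. change (upto (2 - 1)) with [1]. rewrite Zsum_cons.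
    replace (d * 1) with (1 + k * 2) by lia. rewrite Z.div_add by lia.
    change (1 / 2) with 0. unfold Zsum; cbn [fold_right map]. lia. }
  rewrite E1 in R. destruct (dedZ_mod8 2 d Hd Od Hg) as [u Hu].
  replace (dedZ 2 d) with (u * 8 + (d + 1 - 2 * gauss 2 d)) in R by lia.
  pose proof (Z.div_mod d 8 ltac:(lia)) as Ed. set (d' := d / 8) in *. clear Hu Hk Hg.
  destruct (odd_mod8 d Od) as [E'|[E'|[E'|E']]]; rewrite E' in *;
  destruct (gauss_pm 2 d) as [G1|G1]; rewrite G1 in *; simpl; try reflexivity; exfalso;
  rewrite Ed in R; ring_simplify in R; assert (exists w, d' * (d' + 1) = 2 * w) as [w Hw] by
  (destruct (Z.Even_or_Odd d') as [[m ->]|[m ->]]; [exists (m * (2 * m + 1))|exists ((2 * m + 1) * (m + 1))]; ring);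
  lia.
Qed.

(** * Further rules for the Jacobi symbol *)

Lemma odd_mul_true a b : Z.odd a = true -> Z.odd b = true -> Z.odd (a * b) = true.
Proof. intros Ha Hb. now rewrite Z.odd_mul, Ha, Hb. Qed.

Lemma gcd_mul_1 a b c : Z.gcd a c = 1 -> Z.gcd b c = 1 -> Z.gcd (a * b) c = 1.
Proof.
  intros Ha Hb. apply Zgcd_1_rel_prime. apply rel_prime_sym, rel_prime_mult;
  apply rel_prime_sym; now apply Zgcd_1_rel_prime.
Qed.

Lemma gcd_divide_1 a b c : Z.gcd a b = 1 -> (c | b) -> Z.gcd a c = 1.
Proof.
  intros H Hc. apply Z.bezout_1_gcd. destruct Hc as [k ->].
  destruct (Z.gcd_bezout a (k * c) 1 H) as [u [v E]]. exists u, (v * k). lia.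
Qed.

Lemma gcd_of_divide_pred m x : (m | x - 1) -> Z.gcd m x = 1.
Proof. intros [k Hk]. apply Z.bezout_1_gcd. exists (- k), 1. lia. Qed.

(** For odd [c] and [d] this is the reciprocity factor [(-1)^((c-1)/2 (d-1)/2)]. *)
Definition sign34 (c d : Z) : Z := if (c mod 4 =? 3) && (d mod 4 =? 3) then -1 else 1.

Lemma odd_mod4 c : Z.odd c = true -> c mod 4 = 1 \/ c mod 4 = 3.
Proof.
  intros Ho. destruct (odd_ex _ Ho) as [k ->].
  Z.div_mod_to_equations. lia.
Qed.

Lemma sign34_mul_r c d d' : Z.odd d = true -> Z.odd d' = true ->
  sign34 c (d * d') = sign34 c d * sign34 c d'.
Proof.
  intros Hd Hd'. unfold sign34. destruct (c mod 4 =? 3); [|reflexivity].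
  rewrite Zmult_mod.
  destruct (odd_mod4 d Hd) as [-> | ->], (odd_mod4 d' Hd') as [-> | ->]; reflexivity.
Qed.

Lemma gauss_flip c d : 0 < c -> 0 < d -> Z.odd c = true -> Z.odd d = true -> Z.gcd c d = 1 ->
  gauss c d = sign34 c d * gauss d c.
Proof.
  intros. pose proof (gauss_reciprocity c d). unfold sign34.
  destruct (gauss_pm c d) as [E|E], (gauss_pm d c) as [E'|E']; rewrite E, E' in *;
  destruct (_ && _); intuition lia.
Qed.

(** For positive odd [m], reciprocity moves the product to the upper argument. The general case
    follows by changing [m] modulo [d d']. *)
Lemma gauss_mul_r m d d' : 0 < d -> 0 < d' -> Z.odd d = true -> Z.odd d' = true ->
  Z.gcd m d = 1 -> Z.gcd m d' = 1 -> gauss m (d * d') = gauss m d * gauss m d'.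
Proof.
  intros Hd Hd' Od Od' Hg Hg'.
  assert (P : forall m, 0 < m -> Z.odd m = true -> Z.gcd m d = 1 -> Z.gcd m d' = 1 ->
    gauss m (d * d') = gauss m d * gauss m d').
  { clear m Hg Hg'. intros m Hm Om Hg Hg'.
    assert (Z.gcd d m = 1) by now rewrite Z.gcd_comm.
    assert (Z.gcd d' m = 1) by now rewrite Z.gcd_comm.
    rewrite (gauss_flip m (d * d')), (gauss_flip m d), (gauss_flip m d'); try easy.
    - rewrite gauss_mul, sign34_mul_r by easy. ring.
    - nia.
    - now apply odd_mul_true.
    - rewrite Z.gcd_comm. now apply gcd_mul_1. }
  (* An even multiple of the odd number [d d'] is added to an odd [m] and an odd multiple to an even
     one, so [m'] is odd; the size of the multiple makes it positive. *)
  set (m' := m + (if Z.odd m then 2 * Z.abs m else 2 * Z.abs m + 1) * (d * d')).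
  assert (Hm' : 0 < m').
  { assert (H1 : 1 <= d * d') by nia.
    pose proof (Z.mul_le_mono_nonneg_l 1 (d * d') (2 * Z.abs m) ltac:(lia) H1).
    unfold m'. destruct (Z.odd m) eqn:Em.
    - assert (m <> 0) by (intros ->; discriminate). lia.
    - lia. }
  assert (Om' : Z.odd m' = true).
  { unfold m'. rewrite Z.odd_add, !Z.odd_mul, Od, Od'. destruct (Z.odd m) eqn:Em.
    - rewrite Z.odd_mul. reflexivity.
    - rewrite Z.odd_add, Z.odd_mul. reflexivity. }
  assert (K : forall e, (e | d * d') -> e <> 0 -> m' mod e = m mod e).
  { intros e [k Hk] He. unfold m'. rewrite Hk, Z.mul_assoc. now apply Z.mod_add. }
  assert (K' : forall e, (e | d * d') -> Z.gcd m e = 1 -> Z.gcd m' e = 1).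
  { intros e [k Hk] He. unfold m'. rewrite Hk, Z.mul_assoc, Z.gcd_comm, Z.gcd_add_mult_diag_r.
    now rewrite Z.gcd_comm. }
  rewrite <- (gauss_mod m' m (d * d')), <- (gauss_mod m' m d), <- (gauss_mod m' m d').
  - apply P; try easy; apply K'; try easy; [exists d'|exists d]; ring.
  - apply K; [exists d; ring|lia].
  - apply K; [exists d'; ring|lia].
  - apply K; [exists 1; ring|nia].
Qed.

(** Modulo the odd part of [m], [s] is inverse to [a] and so has the same symbol; the reciprocity
    signs and the symbols of 2 and -1 depend only on the common residue modulo 8. Factors of 2 are
    split off by induction. *)
Lemma gauss_transfer m s a : m <> 0 -> 0 < s -> 0 < a -> Z.odd s = true -> Z.odd a = true ->
  s mod 8 = a mod 8 -> (m | a * s - 1) -> gauss m s = gauss m a.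
Proof.
  intros Hm Hs Ha Os Oa E8 Hd.
  assert (E4 : s mod 4 = a mod 4) by (clear - E8; Z.div_mod_to_equations; lia).
  assert (CP : forall m, (m | a * s - 1) -> Z.gcd m s = 1 /\ Z.gcd m a = 1).
  { intros n [k Hk]. split; apply Z.bezout_1_gcd; [exists (- k), a|exists (- k), s]; lia. }
  assert (P : forall n, 0 < n -> (n | a * s - 1) -> gauss n s = gauss n a).
  { intros n Hn. assert (Hn' : 0 <= n) by lia. revert n Hn' Hn.
    apply (Z_lt_induction (fun n => 0 < n -> (n | a * s - 1) -> gauss n s = gauss n a)).
    intros n IH Hn D. destruct (CP n D) as [C1 C2].
    destruct (Z.odd n) eqn:On.
    - rewrite (gauss_flip n s), (gauss_flip n a) by easy.
      unfold sign34. rewrite E4. f_equal.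
      assert (M : gauss (s * a) n = 1).
      { rewrite <- (gauss_1_l n) by easy. apply gauss_mod. destruct D as [k Hk].
        replace (s * a) with (1 + k * n) by lia. now rewrite Z.mod_add by lia. }
      rewrite gauss_mul in M by (try easy; now rewrite Z.gcd_comm).
      destruct (gauss_pm s n), (gauss_pm a n); lia.
    - assert (exists k, n = 2 * k) as [k ->].
      { rewrite <- Z.negb_even in On. apply negb_false_iff, Z.even_spec in On. exact On. }
      assert (D2 : (2 | a * s - 1)) by (eapply Z.divide_trans; [|exact D]; exists k; ring).
      assert (Dk : (k | a * s - 1)) by (eapply Z.divide_trans; [|exact D]; exists 2; ring).
      destruct (CP 2 D2). destruct (CP k Dk).
      rewrite !gauss_mul, (IH k), !gauss_2, E8 by (easy || lia). reflexivity. }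
  destruct (Z.lt_trichotomy m 0) as [Hm'|[Hm'|Hm']]; [|easy|now apply P].
  assert (D : (- m | a * s - 1)) by now apply Z.divide_opp_l.
  destruct (CP _ D). replace m with (-1 * - m) by lia.
  assert (C1 : forall n, Z.gcd (-1) n = 1) by now intros [].
  rewrite !gauss_mul, (P (- m)), !gauss_opp1, E4 by (easy || lia). reflexivity.
Qed.

(** * Euler's criterion *)

Lemma Zprod_app {A} (l1 l2 : list A) F : Zprod (l1 ++ l2) F = Zprod l1 F * Zprod l2 F.
Proof.
  induction l1 as [|a l1 IH]; [unfold Zprod at 2; cbn [map fold_right app]; ring|].
  simpl app. rewrite !Zprod_cons, IH. ring.
Qed.

Lemma Zprod_congr {A} p (l : list A) F F' :
  (forall a, In a l -> (p | F a - F' a)) -> (p | Zprod l F - Zprod l F').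
Proof.
  induction l as [|a l IH]; intros H; [exists 0; reflexivity|].
  rewrite !Zprod_cons.
  destruct IH as [u Hu]; [intros; apply H; now right|].
  destruct (H a (or_introl eq_refl)) as [v Hv].
  exists (v * Zprod l F + F' a * u).
  replace (F a) with (F' a + v * p) by lia. replace (Zprod l F) with (Zprod l F' + u * p) by lia. ring.
Qed.

Lemma Zprod_upto_scal c h : 0 <= h -> Zprod (upto h) (fun r => c * r) = c ^ h * Zprod (upto h) (fun r => r).
Proof.
  intros Hh. rewrite Zprod_mult. f_equal. revert h Hh. apply upto_ind; [reflexivity|].
  intros n Hn IH. rewrite upto_succ, Z.pow_add_r, Z.pow_1_r, <- IH, Zprod_app by lia.
  rewrite Zprod_cons. unfold Zprod at 2. cbn [map fold_right]. ring.
Qed.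

Lemma prime_not_divide_Zprod p (l : list Z) : prime p -> (forall r, In r l -> ~ (p | r)) ->
  ~ (p | Zprod l (fun r => r)).
Proof.
  intros Hp. induction l as [|a l IH]; intros H.
  - unfold Zprod; simpl. intros D. apply Z.divide_1_r_nonneg in D; [|apply prime_ge_2 in Hp; lia].
    subst. now apply not_prime_1.
  - rewrite Zprod_cons. intros D. apply prime_mult in D; [|easy]. destruct D as [D|D].
    + now apply (H a (or_introl eq_refl)).
    + apply IH; [|easy]. intros; apply H; now right.
Qed.

(** With [h = (p - 1) / 2], the product of the [c r] is [c^h h!], and modulo [p] also the product of
    the signs times [h!], since absolute residues permute the range; [h!] is prime to [p]. *)
Lemma gauss_lemma p c : prime p -> Z.odd p = true -> Z.gcd c p = 1 ->
  (p | c ^ ((p - 1) / 2) - gauss c p).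
Proof.
  intros Hp Op Hg. pose proof (prime_ge_2 p Hp). destruct (odd_half p ltac:(lia) Op) as [Eh Hh].
  set (h := (p - 1) / 2) in *. set (P := Zprod (upto h) (fun r => r)).
  assert (D : (p | P * (c ^ h - gauss c p))).
  { replace (P * (c ^ h - gauss c p)) with (c ^ h * P - gauss c p * P) by ring.
    unfold P at 1. rewrite <- Zprod_upto_scal by easy.
    replace (gauss c p * P) with (Zprod (upto h) (fun r => sgres p (c * r) * absres p (c * r))).
    - apply Zprod_congr. intros r _. apply sgres_absres. lia.
    - pose proof (Zprod_perm _ _ (fun r => r) (absres_perm c p ltac:(lia) Op Hg)) as Pm.
      fold h in Pm. rewrite Zprod_map in Pm. unfold P. rewrite <- Pm, Zprod_mult. reflexivity. }
  apply prime_mult in D; [|easy]. destruct D as [D|D]; [|easy]. exfalso. revert D.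
  apply prime_not_divide_Zprod; [easy|]. intros r Hr D. rewrite in_upto in Hr.
  apply Z.divide_pos_le in D; lia.
Qed.

Definition peval (cs : list Z) (x : Z) : Z := fold_right (fun a acc => a + x * acc) 0 cs.

(** The quotient on division by [X - r], by Horner's scheme. *)
Fixpoint pquo (cs : list Z) (r : Z) : list Z :=
  match cs with
  | [] => []
  | a :: cs' => match cs' with [] => [] | _ => peval cs' r :: pquo cs' r end
  end.

Lemma peval_pquo cs r x : peval cs x = peval cs r + (x - r) * peval (pquo cs r) x.
Proof.
  induction cs as [|a cs IH]; [simpl; ring|]. destruct cs as [|b cs']; [simpl; ring|].
  change (peval (a :: b :: cs') x) with (a + x * peval (b :: cs') x).
  change (peval (a :: b :: cs') r) with (a + r * peval (b :: cs') r).
  change (peval (pquo (a :: b :: cs') r) x) with (peval (b :: cs') r + x * peval (pquo (b :: cs') r) x).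
  rewrite IH. ring.
Qed.

Lemma pquo_length cs r : length (pquo cs r) = (length cs - 1)%nat.
Proof.
  induction cs as [|a cs IH]; [reflexivity|]. destruct cs as [|b cs']; [reflexivity|].
  change (pquo (a :: b :: cs') r) with (peval (b :: cs') r :: pquo (b :: cs') r).
  simpl length in *. lia.
Qed.

Lemma pquo_divide p cs r : (p | peval cs r) -> (forall a, In a (pquo cs r) -> (p | a)) ->
  forall a, In a cs -> (p | a).
Proof.
  induction cs as [|a cs IH]; intros H0 H b Hb; [easy|].
  destruct cs as [|a' cs'].
  - destruct Hb as [<-|[]]. simpl in H0. now replace (a + r * 0) with a in H0 by ring.
  - change (pquo (a :: a' :: cs') r) with (peval (a' :: cs') r :: pquo (a' :: cs') r) in H.
    change (peval (a :: a' :: cs') r) with (a + r * peval (a' :: cs') r) in H0.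
    assert (H1 : (p | peval (a' :: cs') r)) by (apply H; now left).
    destruct Hb as [<-|Hb].
    + replace a with (a + r * peval (a' :: cs') r - r * peval (a' :: cs') r) by ring.
      apply Z.divide_sub_r; [easy|]. now apply Z.divide_mul_r.
    + apply IH; try easy. intros c Hc. apply H. now right.
Qed.

(** Lagrange's bound: as [p] is prime, the remaining roots are roots of the quotient by [X - r], and
    [pquo_divide] carries divisibility of the quotient's coefficients back to [cs]. *)
Lemma poly_roots_mod p : prime p -> forall rs cs, (length cs <= length rs)%nat ->
  NoDup (map (fun x => x mod p) rs) -> (forall r, In r rs -> (p | peval cs r)) ->
  forall a, In a cs -> (p | a).
Proof.
  intros Hp. pose proof (prime_ge_2 p Hp). induction rs as [|r rs IH]; intros cs Hl Hn Hr a Ha.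
  - destruct cs; [easy|simpl in Hl; lia].
  - simpl in Hn. apply NoDup_cons_iff in Hn. destruct Hn as [Hn1 Hn2].
    assert (H0 : (p | peval cs r)) by (apply Hr; now left).
    apply (pquo_divide p cs r); try easy. apply IH; try easy.
    + rewrite pquo_length. simpl in Hl. lia.
    + intros x Hx. assert (D : (p | (x - r) * peval (pquo cs r) x)).
      { replace ((x - r) * peval (pquo cs r) x) with (peval cs x - peval cs r)
          by (rewrite (peval_pquo cs r x); ring).
        apply Z.divide_sub_r; [apply Hr; now right|easy]. }
      apply prime_mult in D; [|easy]. destruct D as [D|D]; [|easy]. exfalso.
      apply Hn1. apply in_map_iff. exists x. split; [|easy].
      destruct D as [k Hk]. replace x with (r + k * p) by lia. apply Z.mod_add. lia.
Qed.

Lemma peval_monomial k x : peval (repeat 0 k ++ [1]) x = x ^ Z.of_nat k.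
Proof.
  induction k as [|k IH].
  { unfold peval. cbn [repeat app fold_right]. change (Z.of_nat 0) with 0. rewrite Z.pow_0_r. ring. }
  change (peval (repeat 0 (S k) ++ [1]) x) with (0 + x * peval (repeat 0 k ++ [1]) x).
  rewrite IH, Nat2Z.inj_succ, Z.pow_succ_r; lia.
Qed.

(** A square has sign 1 by [gauss_sq]. If a non-square [a] had sign 1, then [a] and the squares of
    [1, ..., h] would be [h + 1] distinct roots modulo [p] of [X^h - 1], by [gauss_lemma]. *)
Lemma legendre_gauss p a : prime p -> Z.odd p = true -> Z.gcd a p = 1 -> legendre a p = gauss a p.
Proof.
  intros Hp Op Hg. pose proof (prime_ge_2 p Hp). destruct (odd_half p ltac:(lia) Op) as [Eh Hh].
  set (h := (p - 1) / 2) in *.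
  assert (CP : forall x, ~ (p | x) -> Z.gcd x p = 1).
  { intros x Hx. apply Zgcd_1_rel_prime, rel_prime_sym. now apply prime_rel_prime. }
  assert (NP : forall x, Z.gcd x p = 1 -> ~ (p | x)).
  { intros x Hx D. assert (E : (p | Z.gcd x p)) by (apply Z.gcd_greatest; [easy|apply Z.divide_refl]).
    rewrite Hx in E. apply Z.divide_1_r_nonneg in E; lia. }
  unfold legendre. destruct (Z.eqb_spec (a mod p) 0) as [E|E].
  { exfalso. apply (NP a Hg). apply Z.mod_divide; lia. }
  destruct (existsb _ _) eqn:Ex.
  - apply existsb_exists in Ex. destruct Ex as [x [_ Hx]]. apply Z.eqb_eq in Hx.
    apply Z.mod_divide in Hx; [|lia].
    assert (Gx : Z.gcd x p = 1).
    { apply CP. intros D. apply (NP a Hg). replace a with (x * x - (x * x - a)) by ring.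
      apply Z.divide_sub_r; [now apply Z.divide_mul_l|easy]. }
    rewrite <- (gauss_sq x p ltac:(lia) Op Gx). apply gauss_mod. destruct Hx as [k Hk].
    replace (x * x) with (a + k * p) by lia. rewrite Z.mod_add; lia.
  - destruct (gauss_pm a p) as [Ga|Ga]; [exfalso|easy].
    assert (NS : forall x, ~ (p | x * x - a)).
    { intros x D. enough (existsb (fun x0 => (x0 * x0 - a) mod p =? 0) (map Z.of_nat (seq 0 (Z.to_nat p))) = true) by congruence.
      apply existsb_exists. pose proof (Z.mod_pos_bound x p ltac:(lia)). exists (x mod p). split.
      - apply in_map_iff. exists (Z.to_nat (x mod p)). split; [lia|]. apply in_seq. lia.
      - apply Z.eqb_eq. apply Z.mod_divide in D; [|lia].
        rewrite Zminus_mod, <- Zmult_mod, <- Zminus_mod. exact D. }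
    set (cs := -1 :: repeat 0 (Z.to_nat h - 1) ++ [1]).
    assert (Hh0 : 1 <= h) by (destruct (Z.eq_dec h 0); lia).
    assert (Ev : forall x, peval cs x = x ^ h - 1).
    { intros x. unfold cs. change (-1 + x * peval (repeat 0 (Z.to_nat h - 1) ++ [1]) x = x ^ h - 1).
      rewrite peval_monomial. replace (x ^ h) with (x * x ^ Z.of_nat (Z.to_nat h - 1)); [ring|].
      rewrite <- Z.pow_succ_r by lia. f_equal. lia. }
    assert (D1 : (p | 1)).
    { apply (poly_roots_mod p Hp (a :: map (fun r => r * r) (upto h)) cs).
      - unfold cs. simpl. rewrite length_app, repeat_length, length_map. simpl.
        unfold upto. rewrite length_map, length_seq. lia.
      - simpl. constructor.
        + rewrite map_map. intros D. apply in_map_iff in D. destruct D as [x [D _]].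
          apply (NS x). apply Z.mod_divide; [lia|]. rewrite Zminus_mod, D, Z.sub_diag. apply Z.mod_0_l. lia.
        + rewrite map_map. apply FinFun.Injective_map_NoDup_in; [|apply NoDup_upto].
          intros x y Hx Hy Exy. rewrite in_upto in Hx, Hy.
          assert (D : (p | (x - y) * (x + y))).
          { replace ((x - y) * (x + y)) with (x * x - y * y) by ring. apply Z.mod_divide; [lia|].
            rewrite Zminus_mod, Exy, Z.sub_diag. apply Z.mod_0_l. lia. }
          apply prime_mult in D; [|easy]. destruct D as [[k Hk]|D].
          * assert (k = 0) by nia. lia.
          * apply Z.divide_pos_le in D; lia.
      - intros r [<-|Hr]; rewrite Ev.
        + rewrite <- Ga. now apply gauss_lemma.
        + apply in_map_iff in Hr. destruct Hr as [x [<- Hx]]. rewrite in_upto in Hx.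
          assert (Gx : Z.gcd x p = 1) by (apply CP; intros D; apply Z.divide_pos_le in D; lia).
          rewrite <- (gauss_sq x p ltac:(lia) Op Gx). apply gauss_lemma; try easy.
          now apply gcd_mul_1.
      - unfold cs. right. apply in_or_app. right. now left. }
    apply Z.divide_1_r_nonneg in D1; lia.
Qed.

(** * The Kronecker symbol *)

(** Identifies the trial-division loop with any [phi] that obeys its recursion at primes. As [n] has
    no divisor between 1 and [p], a [p] dividing [n] is prime. The measure [2 n - p] drops both when
    [p] grows and when [n] is divided; [n = 1] exits at once and is exempt. *)
Lemma kron_aux_spec a (phi : Z -> Z) M : phi 1 = 1 ->
  (forall p n, prime p -> 0 < n -> (p * n | M) -> phi (p * n) = kron_prime a p * phi n) ->
  forall fuel n p, 2 <= p -> 0 < n -> (n | M) -> (forall q, 1 < q < p -> ~ (q | n)) ->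
  (n = 1 \/ 2 * n - p <= Z.of_nat fuel) -> kron_aux fuel a n p = phi n.
Proof.
  intros H1 Hm. induction fuel as [|fuel IH]; intros n p Hp Hn HM Hq Hf.
  - simpl. destruct (Z.eq_dec n 1) as [->|N1]; [easy|]. exfalso.
    apply (Hq n); [|apply Z.divide_refl]. lia.
  - simpl. destruct (Z.leb_spec n 1) as [L|L].
    { now replace n with 1 by lia. }
    assert (p <= n) by (apply Z.nlt_ge; intros K; apply (Hq n); [lia|apply Z.divide_refl]).
    destruct (Z.eqb_spec (n mod p) 0) as [E|E].
    + apply Z.div_exact in E; [|lia]. set (n' := n / p) in *.
      assert (0 < n') by nia.
      assert (Pp : prime p).
      { apply prime_alt. split; [lia|]. intros q Hq' D. apply (Hq q Hq').
        rewrite E. now apply Z.divide_mul_l. }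
      rewrite IH; try easy.
      * rewrite E. rewrite Hm; try easy. now rewrite <- E.
      * eapply Z.divide_trans; [|exact HM]. exists p. lia.
      * intros q Hq' D. apply (Hq q Hq'). rewrite E. now apply Z.divide_mul_r.
      * destruct (Z.eq_dec n' 1); [now left|right]. nia.
    + assert (n <> p) by (intros ->; apply E, Z.mod_same; lia).
      apply IH; try easy; [lia| |lia].
      intros q Hq' D. destruct (Z.eq_dec q p) as [->|].
      * apply E. apply Z.mod_divide; [lia|easy].
      * apply (Hq q); [lia|easy].
Qed.

Lemma kron_spec a (phi : Z -> Z) n : 0 < n -> phi 1 = 1 ->
  (forall p m, prime p -> 0 < m -> (p * m | n) -> phi (p * m) = kron_prime a p * phi m) ->
  kron a n = phi n.
Proof.
  intros Hn H1 Hm. unfold kron. destruct (Z.eqb_spec n 0); [lia|].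
  destruct (Z.ltb_spec n 0); [lia|]. rewrite Z.mul_1_l.
  rewrite Z.abs_eq by lia. apply (kron_aux_spec a phi n); try easy; try lia.
Qed.

Lemma odd_prime_of_neq2 p : prime p -> p <> 2 -> Z.odd p = true.
Proof.
  intros Hp H2. destruct (Z.odd p) eqn:E; [easy|]. exfalso.
  destruct (even_ex _ E) as [k Ek].
  assert (D : (2 | p)) by (exists k; lia). apply prime_div_prime in D; [lia| apply prime_2|easy].
Qed.

Lemma odd_divide a b : (a | b) -> Z.odd b = true -> Z.odd a = true.
Proof.
  intros [k ->] H. rewrite Z.odd_mul in H. now apply andb_prop in H.
Qed.

Lemma kron_gauss a n : 0 < n -> Z.odd n = true -> Z.gcd a n = 1 -> kron a n = gauss a n.
Proof.
  intros Hn On Hg. apply kron_spec; [easy|apply gauss_1_r|].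
  intros p m Hp Hm D. pose proof (prime_ge_2 p Hp).
  assert (Dp : (p | n)) by (eapply Z.divide_trans; [|exact D]; exists m; ring).
  assert (Dm : (m | n)) by (eapply Z.divide_trans; [|exact D]; exists p; ring).
  pose proof (odd_divide _ _ Dp On). pose proof (odd_divide _ _ Dm On).
  pose proof (gcd_divide_1 _ _ _ Hg Dp). pose proof (gcd_divide_1 _ _ _ Hg Dm).
  rewrite gauss_mul_r by (easy || lia). f_equal. unfold kron_prime.
  destruct (Z.eqb_spec p 2) as [->|]; [easy|]. symmetry. now apply legendre_gauss.
Qed.

Lemma v2_aux_pow k : forall fuel o, (k < fuel)%nat -> 0 < o -> Z.odd o = true ->
  v2_aux fuel (2 ^ Z.of_nat k * o) = k.
Proof.
  induction k as [|k IH]; intros fuel o Hf Ho Oo; (destruct fuel as [|fuel]; [lia|]).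
  - change (2 ^ Z.of_nat 0 * o) with (1 * o). rewrite Z.mul_1_l. cbn [v2_aux]. destruct (Z.eqb_spec o 0); [lia|].
    now rewrite <- Z.negb_odd, Oo.
  - replace (2 ^ Z.of_nat (S k) * o) with (2 * (2 ^ Z.of_nat k * o))
      by (rewrite Nat2Z.inj_succ, Z.pow_succ_r by lia; ring).
    cbn [v2_aux]. assert (0 < 2 ^ Z.of_nat k) by (apply Z.pow_pos_nonneg; lia).
    set (m := 2 ^ Z.of_nat k * o) in *.
    destruct (Z.eqb_spec (2 * m) 0); [nia|].
    replace (Z.even (2 * m)) with true by (now rewrite Z.even_mul).
    f_equal. rewrite Z.mul_comm, Z.div_mul by lia. apply IH; try easy. lia.
Qed.

Lemma v2_pow k o : 0 < o -> Z.odd o = true -> v2 (2 ^ Z.of_nat k * o) = k.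
Proof.
  intros Ho Oo. unfold v2. apply v2_aux_pow; try easy.
  pose proof (Z.pow_gt_lin_r 2 (Z.of_nat k) ltac:(lia) ltac:(lia)). nia.
Qed.

Lemma odd_part_pow k o : 0 < o -> Z.odd o = true -> odd_part (2 ^ Z.of_nat k * o) = o.
Proof.
  intros Ho Oo. unfold odd_part. rewrite v2_pow by easy.
  rewrite Z.mul_comm. apply Z.div_mul. apply Z.pow_nonzero; lia.
Qed.

Lemma two_adic n : 0 < n -> exists k o, n = 2 ^ Z.of_nat k * o /\ 0 < o /\ Z.odd o = true.
Proof.
  intros Hn. assert (Hn' : 0 <= n) by lia. revert n Hn' Hn.
  apply (Z_lt_induction (fun n => 0 < n -> exists k o, n = 2 ^ Z.of_nat k * o /\ 0 < o /\ Z.odd o = true)).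
  intros n IH Hn. destruct (Z.odd n) eqn:On.
  - exists O, n. simpl Z.of_nat. split; [ring|easy].
  - destruct (even_ex _ On) as [m ->].
    destruct (IH m) as [k [o [E H]]]; [lia|lia|]. exists (S k), o. split; [|easy].
    rewrite E at 1. rewrite Nat2Z.inj_succ, Z.pow_succ_r by lia. ring.
Qed.

Lemma odd_part_mul m n : 0 < m -> 0 < n -> odd_part (m * n) = odd_part m * odd_part n.
Proof.
  intros Hm Hn. destruct (two_adic m Hm) as [k [o [-> [Ho Oo]]]].
  destruct (two_adic n Hn) as [k' [o' [-> [Ho' Oo']]]].
  replace (2 ^ Z.of_nat k * o * (2 ^ Z.of_nat k' * o')) with (2 ^ Z.of_nat (k + k') * (o * o'))
    by (rewrite Nat2Z.inj_add, Z.pow_add_r by lia; ring).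
  rewrite !odd_part_pow; try easy; [nia|now apply odd_mul_true].
Qed.

Lemma v2_mul m n : 0 < m -> 0 < n -> v2 (m * n) = (v2 m + v2 n)%nat.
Proof.
  intros Hm Hn. destruct (two_adic m Hm) as [k [o [-> [Ho Oo]]]].
  destruct (two_adic n Hn) as [k' [o' [-> [Ho' Oo']]]].
  replace (2 ^ Z.of_nat k * o * (2 ^ Z.of_nat k' * o')) with (2 ^ Z.of_nat (k + k') * (o * o'))
    by (rewrite Nat2Z.inj_add, Z.pow_add_r by lia; ring).
  rewrite !v2_pow; try easy; [nia|now apply odd_mul_true].
Qed.

Lemma odd_part_pos n : 0 < n -> 0 < odd_part n /\ Z.odd (odd_part n) = true.
Proof.
  intros Hn. destruct (two_adic n Hn) as [k [o [-> [Ho Oo]]]]. now rewrite odd_part_pow.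
Qed.

Lemma odd_part_odd n : 0 < n -> Z.odd n = true -> odd_part n = n.
Proof.
  intros Hn On. pose proof (odd_part_pow 0 n Hn On) as H. simpl Z.of_nat in H.
  now rewrite Z.pow_0_r, Z.mul_1_l in H.
Qed.

Lemma sign34_sym c d : sign34 c d = sign34 d c.
Proof. unfold sign34. now rewrite andb_comm. Qed.

(** Here [n] may be even, as [varpi] is in general. At the prime 2 the rule of [kron2] is the
    supplementary law [gauss_2]; at odd primes it is reciprocity. *)
Lemma kron_flip a n : 0 < a -> 0 < n -> Z.odd a = true -> Z.gcd a n = 1 ->
  kron a n = gauss n a * sign34 a (odd_part n).
Proof.
  intros Ha Hn Oa Hg. apply (kron_spec a (fun n => gauss n a * sign34 a (odd_part n))); [easy| |].
  - rewrite gauss_1_l by easy. rewrite odd_part_odd by easy. unfold sign34. now rewrite andb_false_r.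
  - intros p m Hp Hm D. pose proof (prime_ge_2 p Hp).
    assert (Dp : (p | n)) by (eapply Z.divide_trans; [|exact D]; exists m; ring).
    assert (Dm : (m | n)) by (eapply Z.divide_trans; [|exact D]; exists p; ring).
    pose proof (gcd_divide_1 _ _ _ Hg Dp) as Gp. pose proof (gcd_divide_1 _ _ _ Hg Dm) as Gm.
    rewrite Z.gcd_comm in Gm. assert (Gp' := Gp). rewrite Z.gcd_comm in Gp'.
    rewrite gauss_mul by easy. rewrite odd_part_mul by lia.
    destruct (odd_part_pos p ltac:(lia)), (odd_part_pos m Hm).
    rewrite sign34_mul_r by easy. unfold kron_prime. destruct (Z.eqb_spec p 2) as [->|Np].
    + change (odd_part 2) with 1. unfold kron2. rewrite gauss_2 by easy.
      rewrite <- Z.negb_odd, Oa. simpl negb. cbv iota.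
      unfold sign34 at 1. rewrite andb_false_r. ring.
    + pose proof (odd_prime_of_neq2 p Hp Np). rewrite (odd_part_odd p) by (easy || lia).
      rewrite legendre_gauss, (gauss_flip a p) by (easy || lia). ring.
Qed.

(** * Arithmetic of the weights *)

(** Induction on factorisations of [M]. For a prime, [i = 0] or [i = 1] works. For [M = a b], solve
    modulo [a] first, then modulo [b] with the step [v a], which leaves the residue modulo [a]
    alone. *)
Lemma coprime_shift M : 0 < M -> forall u v, Z.gcd (Z.gcd u v) M = 1 ->
  exists i, 0 <= i /\ Z.gcd (u + v * i) M = 1.
Proof.
  intros HM. assert (HM' : 0 <= M) by lia. revert M HM' HM.
  apply (Z_lt_induction (fun M => 0 < M -> forall u v, Z.gcd (Z.gcd u v) M = 1 ->
    exists i, 0 <= i /\ Z.gcd (u + v * i) M = 1)).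
  intros M IH HM u v Hg.
  destruct (Z.eq_dec M 1) as [->|M1]; [exists 0; split; [lia|apply Z.gcd_1_r]|].
  destruct (prime_dec M) as [Pr|NP].
  - assert (NP : forall x, ~ (M | x) -> Z.gcd x M = 1).
    { intros x Hx. apply Zgcd_1_rel_prime, rel_prime_sym. now apply prime_rel_prime. }
    destruct (Zdivide_dec M u) as [D|D].
    + exists 1. split; [lia|]. apply NP. intros D'.
      assert (E : (M | Z.gcd (Z.gcd u v) M)).
      { apply Z.gcd_greatest; [apply Z.gcd_greatest; [easy|]|apply Z.divide_refl].
        replace v with (u + v * 1 - u) by ring. now apply Z.divide_sub_r. }
      rewrite Hg in E. apply Z.divide_1_r_nonneg in E; lia.
    + exists 0. split; [lia|]. apply NP. now replace (u + v * 0) with u by ring.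
  - destruct (not_prime_divide M ltac:(lia) NP) as [a [Ha [b Hb]]].
    assert (0 < b < M) by nia.
    destruct (IH a ltac:(lia) ltac:(lia) u v) as [i [Hi Gi]].
    { apply (gcd_divide_1 _ M); [easy|]. exists b. lia. }
    destruct (IH b ltac:(lia) ltac:(lia) (u + v * i) (v * a)) as [t [Ht Gt]].
    { apply Z.bezout_1_gcd.
      assert (G1 : Z.gcd (Z.gcd u v) b = 1) by (apply (gcd_divide_1 _ M); [easy|]; exists a; lia).
      destruct (Z.gcd_bezout _ _ _ G1) as [x1 [y1 E1]].
      destruct (Z.gcd_bezout u v _ eq_refl) as [x2 [y2 E2]].
      destruct (Z.gcd_bezout _ _ _ Gi) as [x3 [y3 E3]].
      destruct (Z.gcd_divide_l (u + v * i) (v * a)) as [k1 K1].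
      destruct (Z.gcd_divide_r (u + v * i) (v * a)) as [k2 K2].
      set (g := Z.gcd (u + v * i) (v * a)) in *.
      assert (Ev : v = (x3 * v * k1 + y3 * k2) * g).
      { replace ((x3 * v * k1 + y3 * k2) * g) with (x3 * v * (k1 * g) + y3 * (k2 * g)) by ring.
        rewrite <- K1, <- K2. replace (x3 * v * (u + v * i) + y3 * (v * a)) with (v * (x3 * (u + v * i) + y3 * a)) by ring.
        rewrite E3. ring. }
      set (w := x3 * v * k1 + y3 * k2) in *.
      exists (x1 * (x2 * (k1 - w * i) + y2 * w)), y1.
      rewrite <- E1, <- E2.
      replace (x2 * u) with (x2 * (k1 * g - v * i)) by (rewrite <- K1; ring).
      rewrite Ev. ring. }
    exists (i + a * t). split; [nia|].
    replace (u + v * (i + a * t)) with (u + v * i + v * a * t) by ring.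
    rewrite Hb, Z.gcd_comm. apply gcd_mul_1; rewrite Z.gcd_comm; [exact Gt|].
    replace (u + v * i + v * a * t) with (u + v * i + (v * t) * a) by ring.
    rewrite Z.gcd_comm, Z.gcd_add_mult_diag_r, Z.gcd_comm. exact Gi.
Qed.

(** Completes the row [(al, be + de j)] to a matrix of level [N] with lower right entry [s] positive
    and prime to 6, as [chi_nice] demands. Divisibility of [r] by 8 or 3 makes [s] inverse to [al]
    modulo 8 or 3, hence congruent to [al]. *)
Lemma coset_rep_exists al be de N : 0 < al -> 0 < de -> 0 <= be -> 0 < N ->
  Z.gcd (Z.gcd al be) de = 1 -> Z.gcd al N = 1 ->
  exists j r s, 0 <= j /\ 0 < be + de * j /\ 0 < r /\ 0 < s /\
    al * s - (be + de * j) * (N * r) = 1 /\ Z.gcd s 6 = 1 /\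
    (Z.odd al = true -> (8 | r)) /\ (~ (3 | al) -> (3 | r)).
Proof.
  intros Hal Hde Hbe HN Hg HgN.
  destruct (coprime_shift al Hal be de) as [j0 [Hj0 Gj0]].
  { rewrite Z.gcd_comm, Z.gcd_assoc. exact Hg. }
  set (j := j0 + al). set (q := be + de * j).
  assert (Hq : 0 < q) by (unfold q, j; nia).
  assert (Gq : Z.gcd al q = 1).
  { unfold q, j. replace (be + de * (j0 + al)) with (be + de * j0 + de * al) by ring.
    rewrite Z.gcd_add_mult_diag_r, Z.gcd_comm. exact Gj0. }
  (* The factors demanded of [r] go into the Bezout modulus; [M] is prime to [al], so the identity
     stays solvable. *)
  set (M := (if Z.odd al then 8 else 1) * (if Zdivide_dec 3 al then 1 else 3)).
  assert (HM : 0 < M) by (unfold M; destruct (Z.odd al), (Zdivide_dec 3 al); lia).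
  assert (GM : Z.gcd M al = 1).
  { unfold M. apply gcd_mul_1.
    - destruct (Z.odd al) eqn:O; [|apply Z.gcd_1_l].
      destruct (odd_ex _ O) as [k ->].
      change 8 with (2 * (2 * 2)). assert (Z.gcd 2 (2 * k + 1) = 1).
      { replace (2 * k + 1) with (1 + k * 2) by ring. now rewrite Z.gcd_add_mult_diag_r. }
      apply gcd_mul_1; [assumption|apply gcd_mul_1; assumption].
    - destruct (Zdivide_dec 3 al) as [D|D]; [apply Z.gcd_1_l|].
      apply Zgcd_1_rel_prime, prime_rel_prime; [apply prime_3|easy]. }
  assert (G : Z.gcd al (q * N * M) = 1).
  { rewrite Z.gcd_comm. apply gcd_mul_1; [apply gcd_mul_1; now rewrite Z.gcd_comm|easy]. }
  destruct (Z.gcd_bezout _ _ _ G) as [s0 [t0 E0]].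
  set (B := q * N * M) in *. assert (HB : 0 < B) by (unfold B; nia).
  (* Adding [T] times the homogeneous solution makes both cofactors positive. A further nonnegative
     multiple [i] then makes [s] prime to 6. *)
  set (T := Z.abs s0 + Z.abs t0 + 1).
  assert (Hs1 : 0 < s0 + B * T) by (unfold T; nia).
  assert (Ht1 : 0 < - t0 + al * T) by (unfold T; nia).
  assert (E1 : al * (s0 + B * T) - B * (- t0 + al * T) = 1) by (rewrite <- E0; ring).
  destruct (coprime_shift 6 ltac:(lia) (s0 + B * T) B) as [i [Hi Gi]].
  { replace (Z.gcd (s0 + B * T) B) with 1; [reflexivity|]. symmetry. apply Z.bezout_1_gcd.
    exists al, (t0 - al * T). rewrite <- E1. ring. }
  exists j, (M * (- t0 + al * T + al * i)), (s0 + B * T + B * i).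
  split; [unfold j; lia|]. split; [exact Hq|]. split; [nia|]. split; [nia|].
  split; [fold q; rewrite <- E1; unfold B; ring|]. split; [exact Gi|].
  split; intros H.
  - unfold M. rewrite H. apply Z.divide_mul_l, Z.divide_mul_l, Z.divide_refl.
  - unfold M. destruct (Zdivide_dec 3 al); [easy|]. apply Z.divide_mul_l, Z.divide_mul_r, Z.divide_refl.
Qed.

Lemma gcd6 d : Z.gcd d 6 = 1 -> Z.odd d = true /\ (3 | d * d - 1) /\ (8 | d * d - 1) /\ ~ (3 | d).
Proof.
  intros H. assert (O : Z.odd d = true).
  { destruct (Z.odd d) eqn:E; [easy|]. exfalso. destruct (even_ex _ E) as [k ->].
    assert (D : (2 | Z.gcd (2 * k) 6)) by (apply Z.gcd_greatest; [exists k; ring|exists 3; ring]).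
    rewrite H in D. destruct D; lia. }
  assert (T : ~ (3 | d)).
  { intros D'. assert (D : (3 | Z.gcd d 6)) by (apply Z.gcd_greatest; [easy|exists 2; ring]).
    rewrite H in D. destruct D; lia. }
  repeat split; try easy.
  - assert (d mod 3 = 1 \/ d mod 3 = 2) as [E|E].
    { pose proof (Z.mod_pos_bound d 3). assert (d mod 3 <> 0) by (intro K; apply T, Z.mod_divide; lia). lia. }
    + exists ((d / 3) * (d + 1)). pose proof (Z.div_mod d 3 ltac:(lia)). set (k := d / 3) in *. nia.
    + exists ((d / 3 + 1) * (d - 1)). pose proof (Z.div_mod d 3 ltac:(lia)). set (k := d / 3) in *. nia.
  - destruct (odd_ex _ O) as [k ->].
    destruct (Z.Even_or_Odd k) as [[m ->]|[m ->]]; [exists (m * (2 * m + 1))|exists ((2 * m + 1) * (m + 1))]; ring.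
Qed.

Lemma odd_sq8 d : Z.odd d = true -> (8 | d * d - 1).
Proof.
  intros O. destruct (odd_ex _ O) as [k ->].
  destruct (Z.Even_or_Odd k) as [[m ->]|[m ->]]; [exists (m * (2 * m + 1))|exists ((2 * m + 1) * (m + 1))]; ring.
Qed.

Lemma divide_24 x : (8 | x) -> (3 | x) -> (24 | x).
Proof. intros [u Hu] [v Hv]. exists (3 * u - v). lia. Qed.

(** Used with [M = 8] and [M = 3]. Since [al] is its own inverse and [M] divides [r], [s] is
    congruent to [al]; since [x l] is congruent to [x], also [x de] is congruent to [x al]. The sum
    then collapses. *)
Lemma psi_sum_divide M l al de x y be j r s N : (M | x * (l - 1)) -> al * de = l ->
  (M | al * al - 1) -> (M | r) -> al * s - (be + de * j) * (N * r) = 1 ->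
  (M | x * (j - s * (be + de * j) + be * de) + r * y * (s - de)).
Proof.
  intros [u Hu] Hl [v Hv] [w Hw] E.
  set (q := be + de * j) in *.
  assert (Es : exists k, s = al + k * M).
  { exists (q * N * w * al - v * s).
    assert (al * s = 1 + q * N * w * M) by (rewrite Hw in E; lia).
    replace s with (al * (al * s) - (al * al - 1) * s) at 1 by ring.
    rewrite Hv, H. ring. }
  destruct Es as [k ->].
  assert (E1 : x * (de - al) = (u * al - x * de * v) * M).
  { replace ((u * al - x * de * v) * M) with ((u * M) * al - x * de * (v * M)) by ring.
    rewrite <- Hu, <- Hv, <- Hl. ring. }
  exists (- x * k * q - j * u + be * (u * al - x * de * v) + w * y * (al + k * M - de)).
  transitivity (x * (j - al * q + be * de) - x * k * q * M + (r * y * (al + k * M - de))); [ring|].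
  replace (x * (j - al * q + be * de)) with (- j * (x * (l - 1)) + be * (x * (de - al)))
    by (unfold q; rewrite <- Hl; ring).
  rewrite Hu, E1, Hw. ring.
Qed.

(** * Products over the divisors of the level, and the invariants of [r] *)

Section Products.
Variable r : nat -> Z.
Variable w : nat -> Z.

(** [1 - g] is 0 or 2, so modulo 4 only the parity of [k] matters. Thus the exponents [|r_n|] of
    [varpi] can be traded for the [r_n] of the character. *)
Lemma pow_abs_parity (g : Z) (k : Z) : (g = 1 \/ g = -1) -> (4 | (1 - g ^ Z.abs k) - k * (1 - g)).
Proof.
  intros [-> | ->].
  - rewrite Z.pow_1_l by lia. exists 0. ring.
  - destruct (Z.Even_or_Odd k) as [[m Hm]|[m Hm]].
    + replace ((-1) ^ Z.abs k) with 1; [exists (- m); lia|]. change (-1) with (- (1)).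
      rewrite Z.pow_opp_even; [symmetry; apply Z.pow_1_l; lia|exists (Z.abs m); lia].
    + replace ((-1) ^ Z.abs k) with (-1); [exists (- m); lia|]. change (-1) with (- (1)) at 2.
      rewrite Z.pow_opp_odd; [rewrite Z.pow_1_l; lia|].
      destruct (Z.abs_spec k) as [[? ->]|[? ->]]; [exists m|exists (- m - 1)]; lia.
Qed.

Lemma gauss_pow m k d : 0 < d -> Z.odd d = true -> Z.gcd m d = 1 -> 0 <= k ->
  gauss (m ^ k) d = gauss m d ^ k /\ Z.gcd (m ^ k) d = 1.
Proof.
  intros Hd Od Hg Hk. revert k Hk. apply upto_ind.
  - rewrite !Z.pow_0_r. split; [now apply gauss_1_l|apply Z.gcd_1_l].
  - intros k Hk [IH1 IH2]. rewrite !Z.pow_add_r, !Z.pow_1_r by lia. split.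
    + now rewrite gauss_mul, IH1.
    + now apply gcd_mul_1.
Qed.

(** Makes the symbol additive: [1 - g h] is congruent to [(1 - g) + (1 - h)] modulo 4 for signs [g]
    and [h]. *)
Lemma gauss_Zprod (l : list nat) d : 0 < d -> Z.odd d = true ->
  (forall n, In n l -> Z.gcd (w n) d = 1) ->
  (4 | (1 - gauss (Zprod l (fun n => w n ^ Z.abs (r n))) d) - Zsum l (fun n => r n * (1 - gauss (w n) d)))
  /\ Z.gcd (Zprod l (fun n => w n ^ Z.abs (r n))) d = 1.
Proof.
  intros Hd Od. induction l as [|n l IH]; intros Hl.
  - unfold Zprod, Zsum; cbn [map fold_right]. rewrite gauss_1_l by easy.
    split; [exists 0; ring|apply Z.gcd_1_l].
  - rewrite Zprod_cons, Zsum_cons.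
    destruct IH as [[u Hu] Hg]; [intros; apply Hl; now right|].
    destruct (gauss_pow (w n) (Z.abs (r n)) d Hd Od (Hl n (or_introl eq_refl)) ltac:(lia)) as [E1 E2].
    split; [|now apply gcd_mul_1].
    rewrite gauss_mul, E1 by easy.
    destruct (pow_abs_parity _ (r n) (gauss_pm (w n) d)) as [v Hv].
    set (W := gauss (Zprod l _) d) in *. set (S := Zsum l _) in *.
    set (g := gauss (w n) d ^ Z.abs (r n)) in *.
    assert (Hgp : g = 1 \/ g = -1) by (rewrite <- E1; apply gauss_pm).
    assert (HW : W = 1 \/ W = -1) by apply gauss_pm.
    clear E1. clearbody g W S. destruct Hgp as [-> | ->], HW as [-> | ->]; [exists (u + v)|exists (u + v)|exists (u + v)|exists (u + v - 1)]; lia.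
Qed.

Lemma gauss_Zprod_r (l : list nat) m : 
  (forall n, In n l -> 0 < w n /\ Z.odd (w n) = true /\ Z.gcd m (w n) = 1 /\ gauss m (w n) = 1) ->
  let W := Zprod l (fun n => w n ^ Z.abs (r n)) in
  0 < W /\ Z.odd W = true /\ Z.gcd m W = 1 /\ gauss m W = 1.
Proof.
  assert (M : forall a b, (0 < a /\ Z.odd a = true /\ Z.gcd m a = 1 /\ gauss m a = 1) ->
    (0 < b /\ Z.odd b = true /\ Z.gcd m b = 1 /\ gauss m b = 1) ->
    0 < a * b /\ Z.odd (a * b) = true /\ Z.gcd m (a * b) = 1 /\ gauss m (a * b) = 1).
  { intros a b (A1 & A2 & A3 & A4) (B1 & B2 & B3 & B4). split; [nia|].
    split; [now apply odd_mul_true|]. split.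
    - rewrite Z.gcd_comm. apply gcd_mul_1; now rewrite Z.gcd_comm.
    - rewrite gauss_mul_r by easy. lia. }
  assert (B : 0 < 1 /\ Z.odd 1 = true /\ Z.gcd m 1 = 1 /\ gauss m 1 = 1)
    by (repeat split; try easy; apply Z.gcd_1_r).
  intros H. cbv zeta. induction l as [|n l IH]; [exact B|].
  rewrite Zprod_cons. apply M; [|apply IH; intros; apply H; now right].
  specialize (H n (or_introl eq_refl)). assert (K : 0 <= Z.abs (r n)) by lia.
  revert K. generalize (Z.abs (r n)). apply upto_ind; [exact B|].
  intros k Hk IHk. rewrite Z.pow_add_r, Z.pow_1_r by lia. now apply M.
Qed.

(** For odd [a] and [b], [a b - 1] is congruent to [(a - 1) + (b - 1)] modulo 4, and a multiple
    [k (a - 1)] depends modulo 4 only on the parity of [k]. *)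
Lemma odd_part_Zprod (l : list nat) : (forall n, In n l -> 0 < w n) ->
  let W := Zprod l (fun n => w n ^ Z.abs (r n)) in
  0 < W /\ (4 | odd_part W - 1 - Zsum l (fun n => r n * (odd_part (w n) - 1))) /\
  (2 | Z.of_nat (v2 W) - Zsum l (fun n => r n * Z.of_nat (v2 (w n)))).
Proof.
  assert (P4 : forall a b, Z.odd a = true -> Z.odd b = true -> (4 | a * b - 1 - (a - 1) - (b - 1))).
  { intros a b Oa Ob. destruct (odd_ex _ Oa) as [x ->], (odd_ex _ Ob) as [y ->]. exists (x * y). ring. }
  assert (PW : forall a, 0 < a -> forall k, 0 <= k -> 0 < a ^ k /\ (4 | odd_part (a ^ k) - 1 - k * (odd_part a - 1)) /\ Z.of_nat (v2 (a ^ k)) = k * Z.of_nat (v2 a)).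
  { intros a Ha. apply upto_ind.
    - rewrite Z.pow_0_r. split; [lia|]. split; [exists 0|]; reflexivity.
    - intros k Hk (I1 & I2 & I3). rewrite Z.pow_add_r, Z.pow_1_r by lia.
      split; [nia|]. rewrite odd_part_mul, v2_mul by easy. split.
      + destruct I2 as [u Hu]. destruct (P4 (odd_part (a ^ k)) (odd_part a)) as [v Hv]; try now apply odd_part_pos.
        exists (u + v). lia.
      + rewrite Nat2Z.inj_add, I3. ring. }
  intros H. cbv zeta. induction l as [|n l IH].
  - split; [easy|]. split; exists 0; reflexivity.
  - destruct IH as (I1 & [u Hu] & [u' Hu']); [intros; apply H; now right|].
    rewrite Zprod_cons, !Zsum_cons. set (W := Zprod l _) in *.
    destruct (PW (w n) (H n (or_introl eq_refl)) (Z.abs (r n)) ltac:(lia)) as (J1 & [v Hv] & J3).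
    set (a := w n ^ Z.abs (r n)) in *.
    split; [nia|]. rewrite odd_part_mul, v2_mul by easy. split.
    + destruct (P4 (odd_part a) (odd_part W)) as [t Ht]; try now apply odd_part_pos.
      destruct (odd_part_pos (w n) (H n (or_introl eq_refl))) as [_ O].
      destruct (odd_ex _ O) as [x Hx].
      set (S := Zsum l (fun n => r n * (odd_part (w n) - 1))) in *. rewrite Hx in *.
      destruct (Z.abs_spec (r n)) as [[? E]|[? E]]; rewrite E in *.
      * exists (u + v + t). lia.
      * exists (u + v + t - r n * x). lia.
    + rewrite Nat2Z.inj_add, J3. set (S := Zsum l _) in *.
      destruct (Z.abs_spec (r n)) as [[? E]|[? E]]; rewrite E in *.
      * exists u'. lia.
      * exists (u' - r n * Z.of_nat (v2 (w n))). lia.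
Qed.

End Products.

(** 24 times the order of the eta-quotient at the cusp 0 in the local parameter of width [N], the
    counterpart of [xN] at infinity. *)
Definition yN (N : nat) (r : nat -> Z) : Z :=
  Zsum (divs N) (fun n => Z.of_nat (N / n) * r n).
Definition deltaZ (N : nat) (r : nat -> Z) : Z :=
  if odd_part (varpi N r) mod 4 =? 1 then 0 else 1.
Definition delta1Z (N : nat) (r : nat -> Z) (l : Z) : Z :=
  if andb (andb (Z.even l) (Nat.eqb (N mod 4) 0))
          (andb (Z.odd (k2 N r)) (Nat.odd (v2 (varpi N r)))) then 1 else 0.

Lemma in_divs N n : In n (divs N) -> exists m : nat,
  (0 < n)%nat /\ N = (n * m)%nat /\ (N / n)%nat = m /\ ((0 < N)%nat -> (0 < m)%nat).
Proof.
  unfold divs. rewrite filter_In, in_seq. intros [H1 H2]. apply Nat.eqb_eq in H2.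
  exists (N / n)%nat. apply Nat.Div0.div_exact in H2. repeat split; try lia.
Qed.

(** The form in which the congruence [l = 1] modulo [m_f] enters: [24 / g] divides [l - 1], while
    [g] divides both [x] and [y]. *)
Lemma in_Lf_divide N r l : in_Lf N r l -> (24 | xN N r * (l - 1)) /\ (24 | yN N r * (l - 1)).
Proof.
  intros [_ [Hm _]]. unfold m_f in Hm. fold (yN N r) in Hm.
  set (x := xN N r) in *. set (y := yN N r) in *. set (g := Z.gcd 24 (Z.gcd y x)) in *.
  assert (G1 : (g | 24)) by apply Z.gcd_divide_l.
  assert (G2 : (g | Z.gcd y x)) by apply Z.gcd_divide_r.
  assert (Gy : (g | y)) by (eapply Z.divide_trans; [exact G2|apply Z.gcd_divide_l]).
  assert (Gx : (g | x)) by (eapply Z.divide_trans; [exact G2|apply Z.gcd_divide_r]).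
  assert (g <> 0) by (destruct G1; lia).
  clear G2. clearbody g. clearbody x y. destruct G1 as [a Ea]. destruct Hm as [k Hk].
  replace (24 / g) with a in Hk by (rewrite Ea, Z.div_mul; easy).
  destruct Gx as [x1 ->], Gy as [y1 ->]. rewrite Hk.
  split; [exists (x1 * k)|exists (y1 * k)]; rewrite Ea; ring.
Qed.

(** The odd part of [varpi] is [1 + 2 deltaZ] modulo 4, so [odd_part_Zprod] expresses [deltaZ], and
    likewise the parity of the 2-adic valuation, linearly in [r]. *)
Lemma varpi_facts N r : (0 < N)%nat -> 0 < varpi N r /\
  (4 | k2 N r + 2 * deltaZ N r - Zsum (divs N) (fun n => r n * odd_part (Z.of_nat (N / n)))) /\
  (2 | Z.of_nat (v2 (varpi N r)) - Zsum (divs N) (fun n => r n * Z.of_nat (v2 (Z.of_nat (N / n))))).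
Proof.
  intros HN. destruct (odd_part_Zprod r (fun n => Z.of_nat (N / n)) (divs N)) as (H1 & [u Hu] & H3).
  { intros n Hn. apply in_divs in Hn. destruct Hn as [m (H1 & H2 & -> & H4)]. lia. }
  fold (varpi N r) in *. split; [exact H1|]. split; [|exact H3].
  destruct (odd_part_pos _ H1) as [P1 P2].
  rewrite (Zsum_ext _ _ (fun n => r n * odd_part (Z.of_nat (N / n)) + -1 * r n)) in Hu by (intros; ring).
  rewrite Zsum_plus, Zsum_scal in Hu. fold (k2 N r) in Hu.
  unfold deltaZ. pose proof (Z.div_mod (odd_part (varpi N r)) 4 ltac:(lia)) as E.
  set (S := Zsum _ _) in *. set (o := odd_part (varpi N r)) in *.
  destruct (odd_mod4 o P2) as [M|M]; rewrite M in *; simpl (_ =? _); cbv iota.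
  - exists (u - o / 4). lia.
  - exists (u - o / 4). lia.
Qed.

Lemma k2_delta_odd N r : (0 < N)%nat -> Z.odd (Z.of_nat N) = true ->
  (4 | k2 N r + 2 * deltaZ N r - yN N r).
Proof.
  intros HN ON. destruct (varpi_facts N r HN) as (_ & H & _).
  rewrite (Zsum_ext _ _ (fun n => Z.of_nat (N / n) * r n)) in H; [exact H|].
  intros n Hn. apply in_divs in Hn. destruct Hn as [m (H1 & H2 & -> & H4)].
  rewrite odd_part_odd; [ring|lia|]. apply (odd_divide _ (Z.of_nat N)); [|easy].
  exists (Z.of_nat n). lia.
Qed.

Lemma Zsum_congr {A} m (l : list A) F F' : (forall a, In a l -> (m | F a - F' a)) ->
  (m | Zsum l F - Zsum l F').
Proof.
  induction l as [|a l IH]; intros H; [exists 0; reflexivity|]. rewrite !Zsum_cons.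
  replace (F a + Zsum l F - (F' a + Zsum l F')) with (F a - F' a + (Zsum l F - Zsum l F')) by ring.
  apply Z.divide_add_r; [apply H; now left|]. apply IH. intros; apply H; now right.
Qed.

(** Accounts for [delta1]. If 8 divides [N] nothing is needed. If [N] is 4 modulo 8, one more factor
    2 must come from [k2 + 2 deltaZ] or, when [k2] is odd, from [1 + delta1Z]. If [N] is 2 modulo 4,
    [k2 + 2 deltaZ] is itself divisible by 4. *)
Lemma even_level_divide N r l : (0 < N)%nat -> Z.even (Z.of_nat N) = true -> Z.even l = true ->
  (8 | xN N r) -> (8 | yN N r) ->
  (8 | Z.of_nat N * (k2 N r + 2 * deltaZ N r) * (1 + delta1Z N r l)).
Proof.
  intros HN EN El Hx Hy. destruct (varpi_facts N r HN) as (_ & H0 & H1).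
  apply Z.even_spec in EN. destruct EN as [M HM].
  destruct (Z.Even_or_Odd M) as [[M2 HM2]|[M2 HM2]].
  - destruct (Z.Even_or_Odd M2) as [[M4 HM4]|[M4 HM4]].
    { apply Z.divide_mul_l, Z.divide_mul_l. exists M4. lia. }
    assert (K : (2 | (k2 N r + 2 * deltaZ N r) * (1 + delta1Z N r l))).
    2:{ destruct K as [k Hk]. exists (M2 * k). rewrite <- Z.mul_assoc, Hk. lia. }
    unfold delta1Z. rewrite El. replace (Nat.eqb (N mod 4) 0) with true.
    2:{ symmetry. apply Nat.eqb_eq. replace N with (Z.to_nat M2 * 4)%nat by lia. apply Nat.Div0.mod_mul. }
    destruct (Z.odd (k2 N r)) eqn:Ok.
    2:{ apply Z.divide_mul_l. destruct (even_ex _ Ok) as [k ->]. exists (k + deltaZ N r). ring. }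
    (* For [n m = N] with [N] equal to 4 modulo 8, the number [n + m + v2 m] is odd in each of the
       three distributions of the two factors 2. As [x] and [y] are even, an odd [k2] forces
       [v2 (varpi N r)] to be odd. *)
    assert (D : (2 | k2 N r - (xN N r + yN N r + Z.of_nat (v2 (varpi N r))))).
    { destruct H1 as [u Hu]. set (v := Z.of_nat (v2 (varpi N r))) in *.
      set (S := Zsum _ _) in Hu.
      enough (D : (2 | k2 N r - (xN N r + (yN N r + S)))) by (destruct D as [t Ht]; exists (t - u); lia).
      unfold xN, yN, S, k2. rewrite <- !Zsum_plus. apply Zsum_congr. intros n Hn.
      apply in_divs in Hn. destruct Hn as [m (N1 & N2 & -> & N4)]. specialize (N4 HN).
      assert (E : Z.of_nat n * Z.of_nat m = 4 * M2) by lia.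
      destruct (two_adic (Z.of_nat n) ltac:(lia)) as [i [o (E1 & Po & Oo)]].
      destruct (two_adic (Z.of_nat m) ltac:(lia)) as [i' [o' (E1' & Po' & Oo')]].
      assert (Ei : (i + i' = 2)%nat).
      { assert (V : v2 (Z.of_nat n * Z.of_nat m) = (i + i')%nat).
        { rewrite v2_mul by lia. rewrite E1, E1', !v2_pow by easy. reflexivity. }
        rewrite E in V. change 4 with (2 ^ Z.of_nat 2) in V. rewrite v2_pow in V; try easy; [lia|].
        apply odd_intro; exists M4. lia. }
      rewrite E1' at 2. rewrite v2_pow by easy. rewrite E1, E1'.
      destruct (odd_ex _ Oo) as [a ->], (odd_ex _ Oo') as [a' ->].
      assert (i = 0 /\ i' = 2 \/ i = 1 /\ i' = 1 \/ i = 2 /\ i' = 0)%nat as [[-> ->]|[[-> ->]|[-> ->]]] by lia.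
      - exists (r n * (- a - 2 * (2 * a' + 1) - 1)). change (2 ^ Z.of_nat 0) with 1. change (2 ^ Z.of_nat 2) with 4. change (Z.of_nat 2) with 2. ring.
      - exists (r n * (- (2 * a + 1) - (2 * a' + 1))). change (2 ^ Z.of_nat 1) with 2. change (Z.of_nat 1) with 1. ring.
      - exists (r n * (- 2 * (2 * a + 1) - a')). change (2 ^ Z.of_nat 0) with 1. change (2 ^ Z.of_nat 2) with 4. change (Z.of_nat 0) with 0. ring. }
    replace (Nat.odd (v2 (varpi N r))) with true.
    { simpl andb. cbv iota. apply Z.divide_mul_r. exists 1. reflexivity. }
    symmetry. apply Nat.odd_spec. destruct (odd_ex _ Ok) as [k Hk].
    destruct (Nat.Even_or_Odd (v2 (varpi N r))) as [[v Hv]|]; [exfalso|easy].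
    destruct D as [t Ht], Hx as [x' Hx], Hy as [y' Hy]. lia.
  - assert (K : (4 | k2 N r + 2 * deltaZ N r)).
    2:{ destruct K as [k ->]. exists (M * k * (1 + delta1Z N r l)). rewrite HM. ring. }
    set (z := Zsum (divs N) (fun n => r n * odd_part (Z.of_nat (N / n)))) in *.
    (* With [n m = 2 M] and [M] odd, [m + M n] is three times the odd part of [m] modulo 8, because
       odd squares are 1 modulo 8. *)
    assert (D : (8 | (yN N r + M * xN N r) - 3 * z)).
    { unfold yN, xN, z. rewrite <- !Zsum_scal, <- Zsum_plus. apply Zsum_congr. intros n Hn.
      apply in_divs in Hn. destruct Hn as [m (N1 & N2 & -> & N4)]. specialize (N4 HN).
      assert (E : Z.of_nat n * Z.of_nat m = 2 * M) by lia.
      destruct (two_adic (Z.of_nat n) ltac:(lia)) as [i [o (E1 & Po & Oo)]].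
      destruct (two_adic (Z.of_nat m) ltac:(lia)) as [i' [o' (E1' & Po' & Oo')]].
      assert (OM : Z.odd M = true) by (apply odd_intro; now exists M2).
      assert (Ei : (i + i' = 1)%nat /\ M = o * o').
      { assert (V : v2 (Z.of_nat n * Z.of_nat m) = (i + i')%nat).
        { rewrite v2_mul by lia. rewrite E1, E1', !v2_pow by easy. reflexivity. }
        assert (V' : odd_part (Z.of_nat n * Z.of_nat m) = o * o').
        { rewrite odd_part_mul by lia. rewrite E1, E1', !odd_part_pow by easy. reflexivity. }
        rewrite E in V, V'. change (2 * M) with (2 ^ Z.of_nat 1 * M) in V, V'.
        rewrite v2_pow in V by (easy || lia). rewrite odd_part_pow in V' by (easy || lia). lia. }
      rewrite E1' at 2. rewrite odd_part_pow by easy. rewrite E1, E1'. destruct Ei as [Ei ->].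
      destruct (odd_sq8 o Oo) as [t Ht].
      assert (i = 0 /\ i' = 1 \/ i = 1 /\ i' = 0)%nat as [[-> ->]|[-> ->]] by lia;
      change (2 ^ Z.of_nat 0) with 1; change (2 ^ Z.of_nat 1) with 2.
      - exists (r n * o' * t). replace (r n * o' * t * 8) with (r n * o' * (t * 8)) by ring. rewrite <- Ht. ring.
      - exists (2 * r n * o' * t). replace (2 * r n * o' * t * 8) with (2 * r n * o' * (t * 8)) by ring. rewrite <- Ht. ring. }
    destruct D as [t Ht], Hx as [x' Hx], Hy as [y' Hy], H0 as [u Hu].
    exists (u + 2 * (3 * (y' + M * x' - t) - z)).
    assert (3 * z = 8 * (y' + M * x' - t)) by (rewrite Hx, Hy in Ht; lia). lia.
Qed.

Lemma kron_pm a n : 0 < n -> Z.gcd a n = 1 -> kron a n = 1 \/ kron a n = -1.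
Proof.
  intros Hn Hg. unfold kron. destruct (Z.eqb_spec n 0); [lia|].
  destruct (Z.ltb_spec n 0); [lia|]. rewrite Z.mul_1_l, Z.abs_eq by lia.
  assert (K : forall fuel n p, 2 <= p -> 0 < n -> Z.gcd a n = 1 ->
    kron_aux fuel a n p = 1 \/ kron_aux fuel a n p = -1).
  { clear n Hn Hg n0 H. induction fuel as [|fuel IH]; intros n p Hp Hn Hg; [now left|].
    cbn [kron_aux]. destruct (n <=? 1); [now left|].
    destruct (Z.eqb_spec (n mod p) 0) as [E|E]; [|apply IH; lia].
    apply Z.div_exact in E; [|lia].
    assert (Hn' : 0 < n / p) by nia.
    assert (Gp : Z.gcd a p = 1) by (apply (gcd_divide_1 _ n); [easy|]; exists (n / p); lia).
    assert (Gn : Z.gcd a (n / p) = 1) by (apply (gcd_divide_1 _ n); [easy|]; exists p; lia).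
    assert (Kp : kron_prime a p = 1 \/ kron_prime a p = -1).
    { unfold kron_prime. destruct (Z.eqb_spec p 2) as [->|].
      - unfold kron2. destruct (Z.even a) eqn:Ea; [|destruct (_ || _); auto].
        exfalso. apply Z.even_spec in Ea. destruct Ea as [k ->].
        assert (D : (2 | Z.gcd (2 * k) 2)) by (apply Z.gcd_greatest; [exists k; ring|apply Z.divide_refl]).
        rewrite Gp in D. destruct D; lia.
      - unfold legendre. destruct (Z.eqb_spec (a mod p) 0) as [D|D]; [|destruct (existsb _ _); auto].
        exfalso. rewrite Z.gcd_comm, <- Z.gcd_mod, D, Z.gcd_0_l in Gp; lia. }
    destruct (IH (n / p) p Hp Hn' Gn) as [-> | ->], Kp as [-> | ->]; auto. }
  apply K; lia || easy.
Qed.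

(* [psi_lr = e (psiZ / 8)] *)
Definition psiZ (N : nat) (r : nat -> Z) (l al be : Z) : Z :=
  let kd := k2 N r + 2 * deltaZ N r in
  if Z.odd l then kd * ((l - 1) * (Z.of_nat N - 1) - (l / al - 1))
  else if Nat.even N then - kd * (al - 1) - Z.of_nat N * kd * (1 + delta1Z N r l) * be
  else 0.

Lemma gcd_pos_l a b : 0 < a -> 0 < Z.gcd a b.
Proof.
  intros Ha. pose proof (Z.gcd_nonneg a b).
  assert (Z.gcd a b <> 0) by (intro E; apply Z.gcd_eq_0_l in E; lia). lia.
Qed.

Lemma varpi_coprime N r a : (0 < N)%nat -> Z.gcd a (Z.of_nat N) = 1 -> Z.gcd a (varpi N r) = 1.
Proof.
  intros HN Ha. rewrite Z.gcd_comm. unfold varpi.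
  assert (H : forall n, In n (divs N) -> Z.gcd (Z.of_nat (N / n)) a = 1).
  { intros n Hn. apply in_divs in Hn. destruct Hn as [m (N1 & N2 & -> & N4)].
    rewrite Z.gcd_comm. apply (gcd_divide_1 _ (Z.of_nat N)); [easy|]. exists (Z.of_nat n). lia. }
  induction (divs N) as [|n l IH]; [apply Z.gcd_1_l|]. rewrite Zprod_cons.
  apply gcd_mul_1; [|apply IH; intros; apply H; now right].
  specialize (H n (or_introl eq_refl)). assert (K : 0 <= Z.abs (r n)) by lia.
  revert K. generalize (Z.abs (r n)). apply upto_ind; [rewrite Z.pow_0_r; apply Z.gcd_1_l|].
  intros k Hk IHk. rewrite Z.pow_add_r, Z.pow_1_r by lia. now apply gcd_mul_1.
Qed.

(** * The congruence modulo 24 between characters and weights *)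

Section WeightCongruence.
Variables (N : nat) (r : nat -> Z) (l al de be j r' s : Z).
Hypothesis HN : (0 < N)%nat.
Hypothesis Hl : in_Lf N r l.
Hypothesis Hald : al * de = l.
Hypothesis Hal : 0 < al.
Hypothesis Hde : 0 < de.
Hypothesis HgN : Z.gcd al (Z.of_nat N) = 1.
Hypothesis Hg3 : Z.gcd (Z.gcd al be) de = 1.
Hypothesis Hq : 0 < be + de * j.
Hypothesis Hr' : 0 < r'.
Hypothesis Hs : 0 < s.
Hypothesis Hdet : al * s - (be + de * j) * (Z.of_nat N * r') = 1.
Hypothesis Hs6 : Z.gcd s 6 = 1.
Hypothesis H8 : Z.odd al = true -> (8 | r').
Hypothesis H3 : ~ (3 | al) -> (3 | r').

Let NZ := Z.of_nat N.
Let q := be + de * j.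
Let x := xN N r.
Let y := yN N r.
Let kd := k2 N r + 2 * deltaZ N r.
Let vp := varpi N r.
Let g := Z.gcd al de.

Lemma gcd_N_s : Z.gcd NZ s = 1.
Proof. apply Z.bezout_1_gcd. exists (- (be + de * j) * r'), al. unfold NZ. lia. Qed.

(** For even [l] the factor [l - 1] is a unit modulo 8. *)
Lemma even_l_divide : Z.even l = true -> (8 | x) /\ (8 | y).
Proof.
  intros E. apply Z.even_spec in E. destruct E as [k Hk].
  destruct (in_Lf_divide N r l Hl) as [[u Hu] [v Hv]]. fold x in Hu. fold y in Hv.
  split.
  - apply (Z.gauss 8 (l - 1)); [exists (3 * u); lia|].
    change 8 with (2 * (2 * 2)).
    assert (Z.gcd 2 (l - 1) = 1) by (apply Z.bezout_1_gcd; exists k, (-1); lia).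
    apply gcd_mul_1; [assumption|apply gcd_mul_1; assumption].
  - apply (Z.gauss 8 (l - 1)); [exists (3 * v); lia|].
    change 8 with (2 * (2 * 2)).
    assert (Z.gcd 2 (l - 1) = 1) by (apply Z.bezout_1_gcd; exists k, (-1); lia).
    apply gcd_mul_1; [assumption|apply gcd_mul_1; assumption].
Qed.

(** The terms free of symbols. At 2 and at 3 alike: if the prime divides [l], then [x] and [y]
    already vanish modulo 8 or 3; otherwise [al] is a unit and [psi_sum_divide] applies. *)
Lemma additive_part : (24 | x * (j - s * q + be * de) + r' * y * (s - de)).
Proof.
  destruct (in_Lf_divide N r l Hl) as [Dx Dy]. fold x in Dx. fold y in Dy.
  apply divide_24.
  - destruct (Z.even l) eqn:El.
    + destruct (even_l_divide El) as [Ex Ey]. apply Z.divide_add_r; [now apply Z.divide_mul_l|].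
      apply Z.divide_mul_l. now apply Z.divide_mul_r.
    + assert (Ol : Z.odd l = true) by (rewrite <- Z.negb_even, El; reflexivity).
      assert (Oa : Z.odd al = true) by (apply (odd_divide _ l); [exists de; lia|easy]).
      apply (psi_sum_divide 8 l al de x y be j r' s NZ); try easy.
      * eapply Z.divide_trans; [|exact Dx]. now exists 3.
      * now apply odd_sq8.
      * now apply H8.
  - destruct (Zdivide_dec 3 l) as [[k Hk]|D].
    + assert (P : forall z, (24 | z * (l - 1)) -> (3 | z)).
      { intros z [u Hu]. exists (z * k - 8 * u). lia. }
      apply Z.divide_add_r; [now apply Z.divide_mul_l, P|].
      apply Z.divide_mul_l. now apply Z.divide_mul_r, P.
    + assert (Da : ~ (3 | al)) by (intros Da; apply D; rewrite <- Hald; now apply Z.divide_mul_l).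
      apply (psi_sum_divide 3 l al de x y be j r' s NZ); try easy.
      * eapply Z.divide_trans; [|exact Dx]. now exists 8.
      * assert (al mod 3 = 1 \/ al mod 3 = 2) as [E|E].
        { pose proof (Z.mod_pos_bound al 3). assert (al mod 3 <> 0) by (intro K; apply Da, Z.mod_divide; lia). lia. }
        -- exists ((al / 3) * (al + 1)). pose proof (Z.div_mod al 3 ltac:(lia)). set (k := al / 3) in *. nia.
        -- exists ((al / 3 + 1) * (al - 1)). pose proof (Z.div_mod al 3 ltac:(lia)). set (k := al / 3) in *. nia.
      * now apply H3.
Qed.

Lemma divisor_props n : In n (divs N) -> exists w, Z.of_nat (N / n) = w /\ 0 < w /\ (w | NZ) /\ (w | al * s - 1).
Proof.
  intros Hn. apply in_divs in Hn. destruct Hn as [m (N1 & N2 & -> & N4)]. specialize (N4 HN).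
  exists (Z.of_nat m). split; [easy|]. split; [lia|].
  assert (D : (Z.of_nat m | NZ)) by (exists (Z.of_nat n); unfold NZ; lia). split; [easy|].
  eapply Z.divide_trans; [exact D|]. exists (q * r'). unfold q, NZ. lia.
Qed.

Lemma odd_s : Z.odd s = true.
Proof. now apply gcd6. Qed.

Lemma varpi_pos : 0 < vp.
Proof. now apply varpi_facts. Qed.

(** The reciprocity sign between [a] and [varpi] is [(-1)^(deltaZ (a - 1)/2)]; this is how [delta]
    gets into the weights. *)
Lemma deltaZ_sign a : Z.odd a = true -> (8 | 2 * (1 - sign34 a (odd_part vp)) - 2 * (a - 1) * deltaZ N r).
Proof.
  intros Oa. unfold deltaZ, sign34. fold vp. destruct (odd_part_pos vp varpi_pos) as [_ Oo].
  pose proof (Z.div_mod a 4 ltac:(lia)) as Ea. set (k := a / 4) in *.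
  destruct (odd_mod4 _ Oo) as [-> | ->], (odd_mod4 a Oa) as [E|E]; rewrite E in *; cbn [Z.eqb andb Pos.eqb].
  - exists 0. ring.
  - exists 0. ring.
  - exists (- k). lia.
  - exists (- k). lia.
Qed.

Lemma two_signs g1 g2 sg : (g1 = 1 \/ g1 = -1) -> (sg = 1 \/ sg = -1) -> g2 = g1 * sg ->
  (8 | 2 * (1 - g1) + 2 * (1 - g2) - 2 * (1 - sg)).
Proof.
  intros [-> | ->] [-> | ->] ->; [exists 0|exists 0|exists 1|exists 0]; reflexivity.
Qed.

Lemma sign34_pm a b : sign34 a b = 1 \/ sign34 a b = -1.
Proof. unfold sign34. destruct (_ && _); auto. Qed.

(** Here [N] is odd, and [al s] is 1 modulo each [N / n], so [al] and [s] have the same symbol over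
    [varpi]. Flipping that of [s] costs a sign which [(s - 1) k2] absorbs, as [k2] is [-2 deltaZ]
    modulo 4. *)
Lemma level_part_even : Z.odd al = false ->
  (8 | (s - 1) * k2 N r + 2 * (1 - gauss vp s) + 2 * (1 - kron al vp)).
Proof.
  intros Ea. rewrite <- Z.negb_even in Ea. apply negb_false_iff in Ea.
  assert (El : Z.even l = true) by (rewrite <- Hald, Z.even_mul, Ea; reflexivity).
  destruct (even_l_divide El) as [_ Dy].
  assert (ON : Z.odd NZ = true).
  { destruct (Z.odd NZ) eqn:O; [easy|]. exfalso. destruct (even_ex _ O) as [u Hu]. apply Z.even_spec in Ea. destruct Ea as [v Hv].
    assert (D : (2 | Z.gcd al NZ)) by (apply Z.gcd_greatest; [exists v|exists u]; lia).
    unfold NZ in D. rewrite HgN in D. destruct D; lia. }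
  destruct (k2_delta_odd N r HN ON) as [u Hu]. fold y in Hu. destruct Dy as [v Hv].
  destruct (gauss_Zprod_r r (fun n => Z.of_nat (N / n)) (divs N) (al * s)) as (V1 & V2 & V3 & V4).
  { intros n Hn. destruct (divisor_props n Hn) as [w (-> & W1 & W2 & W3)].
    assert (Ow : Z.odd w = true) by now apply (odd_divide _ NZ).
    repeat split; try easy.
    - rewrite Z.gcd_comm. now apply gcd_of_divide_pred.
    - rewrite <- (gauss_1_l w) by easy. apply gauss_mod. destruct W3 as [t Ht].
      replace (al * s) with (1 + t * w) by lia. apply Z.mod_add. lia. }
  fold (varpi N r) in V1, V2, V3, V4. fold vp in V1, V2, V3, V4.
  assert (Ga : Z.gcd al vp = 1).
  { apply Z.bezout_1_gcd. destruct (Z.gcd_bezout _ _ _ V3) as [a1 [b1 E1]]. exists (a1 * s), b1. lia. }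
  assert (Gs : Z.gcd s vp = 1).
  { apply Z.bezout_1_gcd. destruct (Z.gcd_bezout _ _ _ V3) as [a1 [b1 E1]]. exists (a1 * al), b1. lia. }
  rewrite kron_gauss by easy. rewrite gauss_mul in V4 by easy.
  assert (E : gauss vp s = sign34 s vp * gauss s vp).
  { rewrite sign34_sym. apply gauss_flip; try easy; [apply odd_s|now rewrite Z.gcd_comm]. }
  assert (E' : gauss al vp = gauss vp s * sign34 s vp).
  { rewrite E. destruct (gauss_pm s vp) as [K|K], (gauss_pm al vp) as [K'|K'], (sign34_pm s vp) as [K''|K'']; rewrite ?K, ?K', ?K'' in *; lia. }
  destruct (two_signs _ _ _ (gauss_pm vp s) (sign34_pm s vp) E') as [t1 T1].
  destruct (deltaZ_sign s odd_s) as [t2 T2]. rewrite odd_part_odd in T2 by easy.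
  pose proof odd_s as Os. destruct (odd_ex _ Os) as [w Hw].
  exists (t1 + t2 + w * (u + 2 * v)). rewrite Hw in *.
  assert (k2 N r = u * 4 + v * 8 - 2 * deltaZ N r) by lia.
  assert (K : 2 * w * k2 N r = 2 * w * (u * 4 + v * 8 - 2 * deltaZ N r)) by now rewrite H.
  lia.
Qed.

(** Since 8 divides [r'], [s] is inverse to [al] modulo 8, and odd numbers are their own inverses
    there. *)
Lemma s_mod8 : Z.odd al = true -> (8 | s - al) /\ s mod 8 = al mod 8.
Proof.
  intros Oa. destruct (H8 Oa) as [u Hu]. destruct (odd_sq8 al Oa) as [v Hv].
  assert (D : (8 | s - al)).
  { exists (al * (q * NZ * u) - v * s).
    replace ((al * (q * NZ * u) - v * s) * 8) with (al * (q * (NZ * (u * 8))) - (v * 8) * s) by ring.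
    rewrite <- Hv, <- Hu. replace (q * (NZ * r')) with (al * s - 1) by (unfold q, NZ; lia). ring. }
  split; [easy|]. destruct D as [k Hk]. replace s with (al + k * 8) by lia. apply Z.mod_add. lia.
Qed.

Lemma gauss_varpi_al : Z.odd al = true -> gauss vp s = gauss vp al /\ Z.gcd vp al = 1.
Proof.
  intros Oa. destruct (s_mod8 Oa) as [_ E8].
  (* The transfer is made for each [N / n]: these divide [al s - 1], whereas their product [varpi]
     need not. *)
  assert (C : forall n, In n (divs N) -> Z.gcd (Z.of_nat (N / n)) al = 1 /\ Z.gcd (Z.of_nat (N / n)) s = 1
     /\ gauss (Z.of_nat (N / n)) s = gauss (Z.of_nat (N / n)) al).
  { intros n Hn. destruct (divisor_props n Hn) as [w (-> & W1 & W2 & W3)].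
    split; [|split].
    - rewrite Z.gcd_comm. now apply (gcd_divide_1 _ NZ).
    - rewrite Z.gcd_comm. apply (gcd_divide_1 _ NZ); [rewrite Z.gcd_comm; apply gcd_N_s|easy].
    - apply gauss_transfer; try easy; [lia|apply odd_s]. }
  destruct (gauss_Zprod r (fun n => Z.of_nat (N / n)) (divs N) s Hs odd_s) as [[u Hu] _]; [intros n Hn; now apply C|].
  destruct (gauss_Zprod r (fun n => Z.of_nat (N / n)) (divs N) al Hal Oa) as [[v Hv] G]; [intros n Hn; now apply C|].
  fold (varpi N r) in Hu, Hv, G. fold vp in Hu, Hv, G. split; [|exact G].
  rewrite (Zsum_ext _ _ (fun n => r n * (1 - gauss (Z.of_nat (N / n)) al))) in Hu.
  - destruct (gauss_pm vp s), (gauss_pm vp al); lia.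
  - intros n Hn. f_equal. f_equal. now apply C.
Qed.

(** The symbol of [varpi] moves from [s] to [al], and flipping it gives [kron al vp] up to the sign
    recorded by [deltaZ]. What is left, [kd (al - 1)], is cancelled by [psiZ] in [psi_part_odd]. *)
Lemma level_part_odd : Z.odd al = true ->
  (8 | (s - 1) * k2 N r + 2 * (1 - gauss vp s) + 2 * (1 - kron al vp) - kd * (al - 1)).
Proof.
  intros Oa. destruct (gauss_varpi_al Oa) as [E G]. destruct (s_mod8 Oa) as [[k Hk] _].
  rewrite E. assert (K := kron_flip al vp Hal varpi_pos Oa). rewrite Z.gcd_comm in K. specialize (K G).
  destruct (two_signs _ _ _ (gauss_pm vp al) (sign34_pm al (odd_part vp)) K) as [t1 T1].
  destruct (deltaZ_sign al Oa) as [t2 T2].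
  exists (t1 + t2 + k * k2 N r). unfold kd. replace s with (al + k * 8) by lia. lia.
Qed.

Lemma gcd_q_al : Z.gcd q al = 1.
Proof. apply Z.bezout_1_gcd. exists (- (NZ * r')), s. unfold NZ, q. lia. Qed.

Lemma kron_beta_coprime : Z.gcd (- NZ * be) g = 1.
Proof.
  unfold g. replace (- NZ * be) with (- 1 * NZ * be) by ring. apply gcd_mul_1.
  - apply gcd_mul_1; [now destruct (Z.gcd al de)|]. rewrite Z.gcd_comm.
    apply Z.bezout_1_gcd. destruct (Z.gcd_bezout _ _ _ HgN) as [a1 [b1 E]].
    destruct (Z.gcd_divide_l al de) as [k Hk]. exists (a1 * k), b1. unfold NZ. rewrite <- E. rewrite Hk at 2. ring.
  - rewrite Z.gcd_assoc, (Z.gcd_comm be). exact Hg3.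
Qed.

(** The gcd [g] of [al] and [de] divides [t]; the cofactors of [g] are coprime with square product,
    so each is a square. *)
Lemma square_split : (exists t, l = t * t) -> exists a1 d1, al = g * (a1 * a1) /\ de = g * (d1 * d1).
Proof.
  intros [t Ht]. destruct (Z.gcd_divide_l al de) as [a Ha]. destruct (Z.gcd_divide_r al de) as [d Hd].
  fold g in Ha, Hd. pose proof (gcd_pos_l al de Hal). fold g in H.
  assert (Gad : Z.gcd a d = 1).
  { assert (E : Z.gcd (a * g) (d * g) = g) by (rewrite <- Ha, <- Hd; reflexivity).
    rewrite Z.gcd_mul_mono_r_nonneg in E by lia. nia. }
  assert (Dt : (g | t)).
  { assert (D : (g * g | t * t)) by (exists (a * d); nia).
    destruct (Z.gcd_divide_l g t) as [g1 G1]. destruct (Z.gcd_divide_r g t) as [t1 T1].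
    set (h := Z.gcd g t) in *.
    assert (Hh : 0 < h).
    { pose proof (Z.gcd_nonneg g t). assert (h <> 0) by (intro E; apply Z.gcd_eq_0_l in E; lia). unfold h in *; lia. }
    assert (G1t : Z.gcd g1 t1 = 1).
    { assert (E : Z.gcd (g1 * h) (t1 * h) = h) by (rewrite <- G1, <- T1; reflexivity).
      rewrite Z.gcd_mul_mono_r_nonneg in E by lia. nia. }
    destruct D as [k Hk]. assert (E : t1 * t1 = k * (g1 * g1)).
    { apply (Z.mul_reg_r _ _ (h * h)); [nia|]. rewrite G1, T1 in Hk. lia. }
    assert (D1 : (g1 | t1 * 1)).
    { apply (Z.gauss g1 t1); [exists (k * g1); lia|easy]. }
    rewrite Z.mul_1_r in D1. assert (E1 : (g1 | 1)).
    { rewrite <- G1t. apply Z.gcd_greatest; [apply Z.divide_refl|easy]. }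
    apply Z.divide_1_r in E1. destruct E1 as [-> | ->]; [exists t1|nia]. nia. }
  destruct Dt as [t' ->].
  assert (E : a * d = t' * t').
  { apply (Z.mul_reg_r _ _ (g * g)); [nia|]. rewrite <- Hald, Ha, Hd in Ht. lia. }
  assert (Pa : 0 < a) by nia. assert (Pd : 0 < d) by nia.
  assert (SQ : forall u v, 0 < u -> 0 < v -> Z.gcd u v = 1 -> u * v = t' * t' -> exists w, u = w * w).
  { intros u v Hu Hv Guv Euv. exists (Z.gcd u t').
    destruct (Z.gcd_divide_l u t') as [u1 U1]. destruct (Z.gcd_divide_r u t') as [t1 T1].
    set (w := Z.gcd u t') in *.
    assert (Hw : 0 < w).
    { pose proof (Z.gcd_nonneg u t'). assert (w <> 0) by (intro K; apply Z.gcd_eq_0_l in K; lia). unfold w in *; lia. }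
    assert (G1 : Z.gcd u1 t1 = 1).
    { assert (K : Z.gcd (u1 * w) (t1 * w) = w) by (rewrite <- U1, <- T1; reflexivity).
      rewrite Z.gcd_mul_mono_r_nonneg in K by lia. nia. }
    assert (K : u1 * v = w * (t1 * t1)).
    { apply (Z.mul_reg_r _ _ w); [lia|]. rewrite U1, T1 in Euv. lia. }
    assert (Pu1 : 0 < u1) by nia.
    assert (D1 : (u1 | w)).
    { apply (coprime_mul_divide (t1 * t1)).
      - apply gcd_mul_1; now rewrite Z.gcd_comm.
      - exists v. lia. }
    assert (D2 : (w | u1)).
    { apply (coprime_mul_divide v).
      - apply (gcd_divide_1 _ u); [now rewrite Z.gcd_comm|exists u1; lia].
      - exists (t1 * t1). lia. }
    apply Z.divide_pos_le in D1, D2; try lia. assert (u1 = w) by lia. lia. }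
  destruct (SQ a d Pa Pd Gad E) as [a1 Ea]. destruct (SQ d a Pd Pa) as [d1 Ed]; [now rewrite Z.gcd_comm|lia|].
  exists a1, d1. subst a d. lia.
Qed.

(** For even [k2] both terms together are a multiple of 8. Otherwise [l] is a square and four
    equalities link the symbols: [r'] is inverse to [- q N] modulo [s]; the lower argument [s] is
    transferred to [al]; [al = g a1^2] reduces it to [g]; and [q] is congruent to [be] modulo
    [g]. *)
Lemma symbol_part_odd : Z.odd al = true ->
  (8 | 2 * k2 N r * (1 - gauss r' s) + 2 * k2 N r * (1 - kron (- NZ * be) g)).
Proof.
  intros Oa. assert (Og : Z.odd g = true) by (apply (odd_divide _ al); [apply Z.gcd_divide_l|easy]).
  pose proof (gcd_pos_l al de Hal) as Pg. fold g in Pg. rewrite kron_gauss by (easy || apply kron_beta_coprime).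
  destruct (Z.odd (k2 N r)) eqn:Ok.
  - destruct Hl as (_ & _ & Hsq). specialize (Hsq Ok).
    destruct (square_split Hsq) as [a1 [d1 [Ea Ed]]].
    pose proof gcd_N_s as GNs. pose proof gcd_q_al as Gqa.
    assert (Gr : Z.gcd r' s = 1) by (apply Z.bezout_1_gcd; exists (- q * NZ), al; unfold q, NZ; lia).
    assert (Gq : Z.gcd (- q * NZ) s = 1) by (apply Z.bezout_1_gcd; exists r', al; unfold q, NZ; lia).
    assert (Gqn : Z.gcd (- q * NZ) al = 1) by (apply Z.bezout_1_gcd; exists r', s; unfold q, NZ; lia).
    assert (E1 : gauss r' s = gauss (- q * NZ) s).
    { assert (M : gauss (r' * (- q * NZ)) s = 1).
      { rewrite <- (gauss_1_l s) by (easy || apply odd_s). apply gauss_mod.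
        replace (r' * (- q * NZ)) with (1 + (- al) * s) by (unfold q, NZ; lia). apply Z.mod_add. lia. }
      rewrite gauss_mul in M by (easy || apply odd_s).
      destruct (gauss_pm r' s), (gauss_pm (- q * NZ) s); lia. }
    assert (E2 : gauss (- q * NZ) s = gauss (- q * NZ) al).
    { apply gauss_transfer; try easy.
      - unfold NZ. nia.
      - apply odd_s.
      - now apply s_mod8.
      - exists (- r'). unfold q, NZ. lia. }
    assert (Oa1 : Z.odd (a1 * a1) = true) by (apply (odd_divide _ al); [exists g; lia|easy]).
    assert (Oa1' : Z.odd a1 = true) by (apply (odd_divide _ (a1 * a1)); [now exists a1|easy]).
    assert (Pa1 : 0 < a1 * a1) by nia.
    assert (G1 : Z.gcd (- q * NZ) g = 1) by (apply (gcd_divide_1 _ al); [easy|exists (a1 * a1); lia]).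
    assert (G2 : Z.gcd (- q * NZ) (Z.abs a1) = 1).
    { apply (gcd_divide_1 _ al); [easy|]. apply Z.divide_abs_l. exists (g * a1). lia. }
    assert (E3 : gauss (- q * NZ) al = gauss (- q * NZ) g).
    { rewrite Ea at 1. replace (a1 * a1) with (Z.abs a1 * Z.abs a1) by nia.
      assert (0 < Z.abs a1) by (destruct (Z.eq_dec a1 0) as [E0|]; [rewrite E0 in Oa1'; discriminate|lia]).
      assert (Z.odd (Z.abs a1) = true) by (apply (odd_divide _ a1); [apply Z.divide_abs_l, Z.divide_refl|easy]).
      rewrite !gauss_mul_r; try easy; [|nia|now apply odd_mul_true|rewrite Z.gcd_comm; apply gcd_mul_1; now rewrite Z.gcd_comm].
      destruct (gauss_pm (- q * NZ) (Z.abs a1)); nia. }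
    assert (E4 : gauss (- q * NZ) g = gauss (- NZ * be) g).
    { apply gauss_mod. replace (- q * NZ) with (- NZ * be + (- NZ * (d1 * d1) * j) * g) by (unfold q; rewrite Ed; ring).
      apply Z.mod_add. lia. }
    rewrite E1, E2, E3, E4. destruct (gauss_pm (- NZ * be) g) as [-> | ->]; [exists 0|exists (k2 N r)]; ring.
  - destruct (even_ex _ Ok) as [k ->].
    destruct (gauss_pm r' s) as [-> | ->], (gauss_pm (- NZ * be) g) as [-> | ->]; [exists 0|exists k|exists k|exists (2 * k)]; ring.
Qed.

(** The case split of [psi_lr]. For [l] odd the sum is [kd] times [al - de + (l - 1)(N - 1)]; for
    [l] and [N] even the remainder is that of [even_level_divide]; for [l] even and [N] odd, [kd] is
    congruent to [y], hence to 0, modulo 4. *)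
Lemma psi_part_odd : Z.odd al = true -> (8 | kd * (al - 1) + psiZ N r l al be).
Proof.
  intros Oa. unfold psiZ. fold kd. replace (l / al) with de by (rewrite <- Hald, Z.mul_comm, Z.div_mul; lia).
  destruct (in_Lf_divide N r l Hl) as [[u Hu] [v Hv]]. fold x in Hu. fold y in Hv.
  destruct (Z.odd l) eqn:Ol.
  - replace (kd * (al - 1) + kd * ((l - 1) * (Z.of_nat N - 1) - (de - 1))) with
      (kd * (al - de + (l - 1) * (Z.of_nat N - 1))) by ring.
    assert (Od : Z.odd de = true) by (apply (odd_divide _ l); [exists al; lia|easy]).
    destruct (Z.odd (k2 N r)) eqn:Ok.
    + apply Z.divide_mul_r. destruct Hl as (_ & _ & Hsq). specialize (Hsq Ok).
      destruct (square_split Hsq) as [a1 [d1 [Ea Ed]]].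
      assert (Oa1 : Z.odd a1 = true) by (apply (odd_divide _ al); [exists (g * a1); lia|easy]).
      assert (Od1 : Z.odd d1 = true) by (apply (odd_divide _ de); [exists (g * d1); lia|easy]).
      destruct Hsq as [t Ht]. assert (Ot : Z.odd t = true) by (apply (odd_divide _ l); [now exists t|easy]).
      destruct (odd_sq8 a1 Oa1) as [k1 K1], (odd_sq8 d1 Od1) as [k2' K2], (odd_sq8 t Ot) as [k3 K3].
      (* For odd [k2] the second factor alone is divisible by 8: odd squares are 1 modulo 8, so
         [al], [g] and [de] agree modulo 8 and [l] is 1. *)
      apply Z.divide_add_r.
      * exists (g * (k1 - k2')). rewrite Ea, Ed. replace (g * (k1 - k2') * 8) with (g * (k1 * 8 - k2' * 8)) by ring.
        rewrite <- K1, <- K2. ring.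
      * apply Z.divide_mul_l. exists k3. lia.
    (* For even [k2], [kd] is even. The second factor can fail to be divisible by 4 only if [N] is
       odd and [al], [de] differ modulo 4; then [l] is 3 modulo 4, so [24 | y (l - 1)] forces
       [4 | y] and hence [4 | kd]. *)
    + assert (EE : (2 | al - de + (l - 1) * (Z.of_nat N - 1)) /\ ((4 | al - de + (l - 1) * (Z.of_nat N - 1)) \/ (4 | kd))).
      { destruct (Z.Even_or_Odd (Z.of_nat N)) as [[m Hm]|[m Hm]].
        - destruct (odd_ex _ Oa) as [a' Ha'], (odd_ex _ Od) as [d' Hd'].
          assert (D : (4 | al - de + (l - 1) * (Z.of_nat N - 1))).
          { exists (a' * d' * (2 * m - 1) + (a' * m + d' * m - d') + 0). rewrite <- Hald, Ha', Hd', Hm. ring. }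
          split; [|now left]. eapply Z.divide_trans; [|exact D]. now exists 2.
        - assert (D2 : (2 | al - de + (l - 1) * (Z.of_nat N - 1))).
          { destruct (odd_ex _ Oa) as [a' ->], (odd_ex _ Od) as [d' ->].
            exists (a' - d' + (l - 1) * m). rewrite Hm. ring. }
          split; [easy|].
          assert (ON : Z.odd (Z.of_nat N) = true) by (apply odd_intro; now exists m).
          destruct (k2_delta_odd N r HN ON) as [w Hw]. fold kd y in Hw.
          destruct (odd_mod4 al Oa) as [Ma|Ma], (odd_mod4 de Od) as [Md|Md];
          pose proof (Z.div_mod al 4 ltac:(lia)) as Qa; pose proof (Z.div_mod de 4 ltac:(lia)) as Qd; rewrite Ma in Qa; rewrite Md in Qd;
          set (a' := al / 4) in *; set (d' := de / 4) in *.
          + left. exists (a' - d' + 2 * m * (4 * a' * d' + a' + d')). rewrite <- Hald, Qa, Qd, Hm. ring.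
          + right. assert (El : l = 4 * (4 * a' * d' + 3 * a' + d') + 3) by (rewrite <- Hald, Qa, Qd; ring).
            set (e' := 4 * a' * d' + 3 * a' + d') in *.
            assert (Dy : (4 | y)).
            { apply (Z.gauss 4 (2 * e' + 1)); [|apply Z.bezout_1_gcd; exists (- (e' * e' + e')), (2 * e' + 1); ring].
              exists (3 * v). rewrite El in Hv. lia. }
            destruct Dy as [y' Hy']. exists (w + y'). lia.
          + right. assert (El : l = 4 * (4 * a' * d' + a' + 3 * d') + 3) by (rewrite <- Hald, Qa, Qd; ring).
            set (e' := 4 * a' * d' + a' + 3 * d') in *.
            assert (Dy : (4 | y)).
            { apply (Z.gauss 4 (2 * e' + 1)); [|apply Z.bezout_1_gcd; exists (- (e' * e' + e')), (2 * e' + 1); ring].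
              exists (3 * v). rewrite El in Hv. lia. }
            destruct Dy as [y' Hy']. exists (w + y'). lia.
          + left. exists (a' - d' + m * 2 * (4 * a' * d' + 3 * a' + 3 * d' + 2)). rewrite <- Hald, Qa, Qd, Hm. ring. }
      destruct EE as [[z2 Z2] [[z4 Z4]|[k4 K4]]].
      * rewrite Z4. unfold kd. destruct (even_ex _ Ok) as [k ->].
        exists ((k + deltaZ N r) * z4). ring.
      * rewrite Z2, K4. exists (k4 * z2). ring.
  - assert (El : Z.even l = true) by (rewrite <- Z.negb_odd, Ol; reflexivity).
    destruct (even_l_divide El) as [Dx Dy].
    destruct (Nat.even N) eqn:EN.
    + replace (kd * (al - 1) + (- kd * (al - 1) - Z.of_nat N * kd * (1 + delta1Z N r l) * be)) with
       (- (Z.of_nat N * kd * (1 + delta1Z N r l) * be)) by ring.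
      apply Z.divide_opp_r, Z.divide_mul_l, even_level_divide; try easy.
      apply Nat.even_spec in EN. destruct EN as [m Hm]. apply Z.even_spec. exists (Z.of_nat m). lia.
    + assert (ON : Z.odd (Z.of_nat N) = true).
      { rewrite <- Nat.negb_odd in EN. apply negb_false_iff, Nat.odd_spec in EN. destruct EN as [m Hm].
        apply odd_intro; exists (Z.of_nat m). lia. }
      destruct (k2_delta_odd N r HN ON) as [w Hw]. fold kd y in Hw. destruct Dy as [y' Hy'].
      destruct (odd_ex _ Oa) as [a' ->].
      exists (a' * (w + 2 * y')). replace kd with (4 * (w + 2 * y')) by lia. ring.
Qed.

(* Compares [24] times the exponents of the two sides of [weight_identity] below. *)
Lemma weight_congruence :
  (24 | (j * x - de * r' * y) - (s * (q * x - r' * y) + 3 * (s - 1) * k2 N r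
          + 6 * k2 N r * (1 - gauss r' s) + 6 * (1 - gauss vp s))
        - (6 * (1 - kron al vp) + 6 * k2 N r * (1 - kron (- NZ * be) g) - be * de * x + 3 * psiZ N r l al be)).
Proof.
  destruct additive_part as [u Hu].
  (* Apart from the additive part every term carries a factor 3, so the rest need only vanish modulo
     8. It is grouped into the symbols of the level, the symbols of half-integral weight, and
     [psiZ]. *)
  assert (D : (8 | ((s - 1) * k2 N r + 2 * (1 - gauss vp s) + 2 * (1 - kron al vp))
    + (2 * k2 N r * (1 - gauss r' s) + 2 * k2 N r * (1 - kron (- NZ * be) g)) + psiZ N r l al be)).
  { destruct (bool_dec (Z.odd al) true) as [Oa|Oa]; [|apply not_true_is_false in Oa].
    - destruct (level_part_odd Oa) as [a1 A1]. destruct (symbol_part_odd Oa) as [a2 A2].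
      destruct (psi_part_odd Oa) as [a3 A3]. exists (a1 + a2 + a3). lia.
    - destruct (level_part_even Oa) as [a1 A1]. 
      assert (Ea : Z.even al = true) by (rewrite <- Z.negb_odd, Oa; reflexivity).
      assert (El : Z.even l = true) by (rewrite <- Hald, Z.even_mul, Ea; reflexivity).
      assert (ON : Nat.even N = false).
      { destruct (Nat.even N) eqn:E; [|easy]. apply Nat.even_spec in E. destruct E as [m Hm].
        apply Z.even_spec in Ea. destruct Ea as [k Hk].
        assert (D : (2 | Z.gcd al (Z.of_nat N))) by (apply Z.gcd_greatest; [exists k|exists (Z.of_nat m)]; lia).
        rewrite HgN in D. destruct D; lia. }
      assert (ON' : Z.odd (Z.of_nat N) = true).
      { rewrite <- Nat.negb_odd in ON. apply negb_false_iff, Nat.odd_spec in ON. destruct ON as [m Hm].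
        apply odd_intro; exists (Z.of_nat m). lia. }
      unfold psiZ. rewrite <- Z.negb_even, El, ON. simpl negb. cbv iota.
      destruct (even_l_divide El) as [_ [y' Hy']]. destruct (k2_delta_odd N r HN ON') as [w Hw]. fold y in Hw.
      assert (Hk : k2 N r = 2 * (2 * w + 4 * y' - deltaZ N r)) by lia.
      set (k := 2 * w + 4 * y' - deltaZ N r) in *.
      rewrite Z.add_0_r. apply Z.divide_add_r; [now exists a1|]. rewrite Hk.
      destruct (gauss_pm r' s) as [-> | ->], (kron_pm _ _ (gcd_pos_l al de Hal) kron_beta_coprime : kron (- NZ * be) g = 1 \/ kron (- NZ * be) g = -1) as [-> | ->];
        [exists 0|exists k|exists k|exists (2 * k)]; ring. }
  destruct D as [v Hv]. exists (u - v). unfold q in *. lia.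
Qed.

End WeightCongruence.

(** * The character in terms of Jacobi symbols *)

Lemma e_eq (x : R) : e x = (cos (2 * PI * x), sin (2 * PI * x)).
Proof. unfold e, cexp. simpl. rewrite exp_0. f_equal; ring. Qed.

Lemma e_plus (x y : R) : e (x + y) = Cmult (e x) (e y).
Proof.
  rewrite !e_eq. unfold Cmult. simpl. rewrite Rmult_plus_distr_l, cos_plus, sin_plus.
  f_equal; ring.
Qed.

Lemma e_0 : e 0 = RtoC 1.
Proof. rewrite e_eq, Rmult_0_r, cos_0, sin_0. reflexivity. Qed.

Lemma e_neg (x : R) : Cmult (e x) (e (- x)) = RtoC 1.
Proof. rewrite <- e_plus, Rplus_opp_r. apply e_0. Qed.

Lemma e_neq_0 (x : R) : e x <> RtoC 0.
Proof.
  intros H. pose proof (e_neg x) as E. rewrite H, Cmult_0_l in E.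
  apply RtoC_inj in E. lra.
Qed.

Lemma e_1 : e 1 = RtoC 1.
Proof. rewrite e_eq, Rmult_1_r, cos_2PI, sin_2PI. reflexivity. Qed.

Lemma e_half : e (1 / 2) = RtoC (-1).
Proof. rewrite e_eq. replace (2 * PI * (1 / 2))%R with PI by field. rewrite cos_PI, sin_PI. reflexivity. Qed.

Lemma e_Z (n : Z) : e (IZR n) = RtoC 1.
Proof.
  assert (P : forall m, 0 <= m -> e (IZR m) = RtoC 1).
  { apply upto_ind; [apply e_0|]. intros m _ IH.
    rewrite plus_IZR, e_plus, IH, e_1. apply Cmult_1_l. }
  destruct (Z.le_gt_cases 0 n) as [H|H]; [now apply P|].
  pose proof (e_neg (IZR n)) as E. rewrite <- opp_IZR, (P (- n)), Cmult_1_r in E by lia. exact E.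
Qed.

Definition e24 (n : Z) : C := e (IZR n / 24).

Lemma e24_plus a b : e24 (a + b) = Cmult (e24 a) (e24 b).
Proof. unfold e24. rewrite <- e_plus, plus_IZR. f_equal. field. Qed.

Lemma e24_eq a b : (24 | a - b) -> e24 a = e24 b.
Proof.
  intros [k Hk]. replace a with (b + k * 24) by lia. rewrite e24_plus.
  unfold e24 at 2. rewrite mult_IZR. replace (IZR k * 24 / 24)%R with (IZR k) by field.
  now rewrite e_Z, Cmult_1_r.
Qed.

Lemma e24_neq_0 a : e24 a <> RtoC 0.
Proof. apply e_neq_0. Qed.

Lemma e24_0 : e24 0 = RtoC 1.
Proof. unfold e24. replace (0 / 24)%R with 0%R by field. apply e_0. Qed.

Lemma e24_12 : e24 12 = RtoC (-1).
Proof. unfold e24. replace (12 / 24)%R with (1 / 2)%R by field. apply e_half. Qed.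

Lemma sign_e24 g : g = 1 \/ g = -1 -> RtoC (IZR g) = e24 (6 * (1 - g)).
Proof. intros [-> | ->]; [symmetry; exact e24_0|symmetry; exact e24_12]. Qed.

Lemma sign_pow_e24 g k : g = 1 \/ g = -1 -> RtoC (powerRZ (IZR g) k) = e24 (6 * k * (1 - g)).
Proof.
  intros Hg. assert (N0 : IZR g <> 0%R) by (apply eq_IZR_contrapositive; lia).
  assert (St : forall n, RtoC (powerRZ (IZR g) (n + 1)) = Cmult (RtoC (powerRZ (IZR g) n)) (e24 (6 * (1 - g)))).
  { intros n. rewrite powerRZ_add by easy. rewrite powerRZ_1, RtoC_mult. now rewrite <- sign_e24. }
  revert k. apply Z.peano_ind.
  - simpl. rewrite e24_0. reflexivity.
  - intros n IH. unfold Z.succ. rewrite St, IH, <- e24_plus. f_equal. ring.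
  - intros n IH. pose proof (St (Z.pred n)) as H. replace (Z.pred n + 1) with n in H by lia.
    rewrite IH in H. replace (6 * n * (1 - g)) with (6 * Z.pred n * (1 - g) + 6 * (1 - g)) in H by lia.
    rewrite e24_plus in H.
    assert (E : forall u v w : C, w <> RtoC 0 -> Cmult u w = Cmult v w -> u = v).
    { intros u v w Hw Huv. replace u with (Cdiv (Cmult u w) w) by (field; easy). rewrite Huv. field. easy. }
    symmetry. exact (E _ _ _ (e24_neq_0 _) H).
Qed.

Lemma Q2R_inject n : Q2R (inject_Z n) = IZR n.
Proof. unfold Q2R, inject_Z. simpl. field. Qed.

Lemma Q2R_div_Z a c : c <> 0 -> Q2R (inject_Z a / inject_Z c) = (IZR a / IZR c)%R.
Proof.
  intros Hc. rewrite Q2R_div, !Q2R_inject; [reflexivity|].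
  intros H. apply Hc. unfold Qeq, inject_Z in H. simpl in H. lia.
Qed.

Lemma saw_R u c : 0 < c -> u mod c <> 0 -> Q2R (saw u c) = (IZR (u mod c) / IZR c - 1 / 2)%R.
Proof.
  intros Hc Hu. unfold saw. destruct (Z.eqb_spec (u mod c) 0); [easy|].
  rewrite Q2R_minus, Q2R_div_Z by lia. f_equal.
Qed.

(** The factor [4 c^2] clears the denominators of each product of sawtooth values; the sum of the
    residues [h x mod c] is known because they permute the nonzero residues. *)
Lemma dedekind_R h c : 0 < c -> Z.gcd h c = 1 ->
  (12 * IZR c * Q2R (dedekind h c))%R = IZR (dedZ h c).
Proof.
  intros Hc Hg. unfold dedekind.
  assert (Rc : IZR c <> 0%R) by (apply eq_IZR_contrapositive; lia).
  replace (map Z.of_nat (seq 0 (Z.to_nat c))) with (0 :: upto (c - 1)).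
  2:{ unfold upto. replace (Z.to_nat c) with (S (Z.to_nat (c - 1))) by lia. reflexivity. }
  set (F := fun x => (saw x c * saw (h * x) c)%Q).
  assert (P : forall l, (forall x, In x l -> 1 <= x < c) ->
    (4 * IZR c * IZR c * Q2R (Qsum l F))%R = IZR (Zsum l (fun x => (2 * x - c) * (2 * ((h * x) mod c) - c)))).
  { induction l as [|x l IH]; intros Hl.
    - unfold Qsum, Zsum. simpl. unfold Q2R. simpl. ring.
    - rewrite Zsum_cons, plus_IZR, <- IH by (intros; apply Hl; now right).
      change (Qsum (x :: l) F) with (F x + Qsum l F)%Q. rewrite Q2R_plus. unfold F at 1.
      specialize (Hl x (or_introl eq_refl)).
      rewrite Q2R_mult, !saw_R; try easy.
      + rewrite (Z.mod_small x) by lia. rewrite mult_IZR, !minus_IZR, !mult_IZR. field. easy.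
      + intros E. apply (not_divide_lt h c x); [easy|lia|]. apply Z.mod_divide; lia.
      + rewrite Z.mod_small; lia. }
  change (Qsum (0 :: upto (c - 1)) F) with (F 0%Z + Qsum (upto (c - 1)) F)%Q.
  replace (Q2R (F 0%Z + Qsum (upto (c - 1)) F)) with (Q2R (Qsum (upto (c - 1)) F)).
  2:{ rewrite Q2R_plus. unfold F at 2, saw. rewrite Z.mod_0_l by lia. simpl Z.eqb. cbv iota.
      rewrite Q2R_mult. unfold Q2R at 2. simpl. ring. }
  apply (Rmult_eq_reg_l (IZR c)); [|easy].
  replace (IZR c * (12 * IZR c * Q2R (Qsum (upto (c - 1)) F)))%R with (3 * (4 * IZR c * IZR c * Q2R (Qsum (upto (c - 1)) F)))%R by ring.
  rewrite P by (intros x; rewrite in_upto; lia).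
  rewrite <- !mult_IZR. f_equal.
  rewrite (Zsum_ext _ _ (fun x => (4 * h * (x * x) + - (4 * c) * (x * (h * x / c))) + (- (2 * c) * x + - (2 * c) * ((h * x) mod c) + c * c))).
  2:{ intros x _. rewrite Z.mod_eq by lia. ring. }
  rewrite !Zsum_plus, !Zsum_scal, Zsum_upto_const by lia.
  pose proof (Zsum_perm _ _ (fun x => x) (residue_perm h c Hc Hg)) as E. rewrite Zsum_map in E. rewrite E.
  pose proof (Zsum_upto_sq (c - 1) ltac:(lia)). pose proof (Zsum_upto_id (c - 1) ltac:(lia)).
  unfold dedZ. change (Zsum (upto (c - 1)) (fun x => x * (h * x / c))) with (flsum h c).
  set (A := flsum h c). set (S1 := Zsum _ (fun x => x)) in *. set (S2 := Zsum _ (fun x => x * x)) in *.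
  replace (c - 1 + 1) with c in * by ring.
  assert (h * (6 * S2) = h * ((c - 1) * c * (2 * (c - 1) + 1))) by now rewrite H.
  assert (c * (2 * S1) = c * ((c - 1) * c)) by now rewrite H0.
  lia.
Qed.

Lemma Psi_R a b c d : 0 < c -> Z.gcd d c = 1 ->
  (IZR c * Q2R (Psi a b c d))%R = IZR (a + d - dedZ d c - 3 * c).
Proof.
  intros Hc Hg. unfold Psi. destruct (Z.ltb_spec 0 c); [|lia].
  assert (Rc : IZR c <> 0%R) by (apply eq_IZR_contrapositive; lia).
  rewrite Q2R_minus, Q2R_plus, Q2R_mult, Q2R_div_Z by lia.
  assert (Hg' : Z.gcd (- d) c = 1) by now rewrite Z.gcd_opp_l.
  pose proof (dedekind_R (- d) c Hc Hg') as E. rewrite dedZ_opp in E by easy.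
  rewrite !minus_IZR, opp_IZR, mult_IZR in *.
  replace (Q2R 12) with 12%R by (unfold Q2R; simpl; field).
  replace (Q2R 3) with 3%R by (unfold Q2R; simpl; field).
  transitivity (IZR (a + d) + 12 * IZR c * Q2R (dedekind (- d) c) - 3 * IZR c)%R; [field; easy|].
  rewrite E. ring.
Qed.

(** The lower right entry is 1 modulo [c], so every floor in the Dedekind sum is exactly [b x]. *)
Lemma Psi_unip b c : 0 < c -> Q2R (Psi 1 b c (1 + b * c)) = IZR (b - c).
Proof.
  intros Hc. assert (Rc : IZR c <> 0%R) by (apply eq_IZR_contrapositive; lia).
  apply (Rmult_eq_reg_l (IZR c)); [|easy]. rewrite Psi_R; [|easy|].
  - rewrite <- mult_IZR. f_equal. unfold dedZ, flsum.
    rewrite (Zsum_ext _ _ (fun x => b * (x * x))).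
    + rewrite Zsum_scal. pose proof (Zsum_upto_sq (c - 1) ltac:(lia)). set (S := Zsum _ _) in *.
      assert (b * (6 * S) = b * ((c - 1) * (c - 1 + 1) * (2 * (c - 1) + 1))) by now rewrite H.
      lia.
    + intros x Hx. rewrite in_upto in Hx.
      replace ((1 + b * c) * x) with (x + (b * x) * c) by ring.
      rewrite Z.div_add, Z.div_small by lia. ring.
  - apply Z.bezout_1_gcd. exists 1, (- b). ring.
Qed.

(** Reciprocity replaces the sum modulo [c] by one modulo [d]: [d Psi = b - c + dedZ c d]. As [d]
    squares to 1 modulo 24, [Psi] is [d] times the right side; modulo 8 use [dedZ_mod8], and modulo
    3 [dedZ c d] vanishes. *)
Lemma Psi_nice a b c d : 0 < c -> 0 < d -> Z.gcd d 6 = 1 -> a * d - b * c = 1 ->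
  exists t, Q2R (Psi a b c d) = IZR (d * (b - c) + 3 * (d - 1) + 6 * (1 - gauss c d) + 24 * t).
Proof.
  intros Hc Hd H6 Hdet. assert (Rc : IZR c <> 0%R) by (apply eq_IZR_contrapositive; lia).
  destruct (gcd6 d H6) as (Od & [w3 W3] & [w8 W8] & N3).
  assert (Gdc : Z.gcd d c = 1) by (apply Z.bezout_1_gcd; exists a, (- b); lia).
  assert (Gcd : Z.gcd c d = 1) by now rewrite Z.gcd_comm.
  pose proof (Psi_R a b c d Hc Gdc) as EY. set (Y := a + d - dedZ d c - 3 * c) in *.
  set (X := b - c + dedZ c d).
  assert (EXY : d * Y = c * X).
  { pose proof (dedZ_reciprocity c d Hc Hd Gcd). unfold X, Y.
    replace (d * (a + d - dedZ d c - 3 * c)) with (a * d + d * d - d * dedZ d c - 3 * c * d) by ring.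
    replace (a * d) with (1 + b * c) by lia. replace (d * dedZ d c) with (c * c + d * d + 1 - 3 * c * d - c * dedZ c d) by lia. ring. }
  (* From [d Y = c X] and [a d - b c = 1] this integer is both [Y / c] and [X / d], so [Psi] is an
     integer. *)
  set (P := - b * Y + a * X).
  assert (EP : Q2R (Psi a b c d) = IZR P /\ d * P = X).
  { assert (E1 : c * P = Y) by (unfold P; replace (c * (- b * Y + a * X)) with (- b * c * Y + a * (c * X)) by ring; rewrite <- EXY; replace (- b * c * Y + a * (d * Y)) with ((a * d - b * c) * Y) by ring; rewrite Hdet; ring).
    split.
    - apply (Rmult_eq_reg_l (IZR c)); [|easy]. rewrite EY, <- mult_IZR, E1. reflexivity.
    - apply (Z.mul_reg_l _ _ c); [lia|]. rewrite <- EXY, <- E1. ring. }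
  destruct EP as [EP EX]. clearbody P.
  assert (D : (24 | P - (d * (b - c) + 3 * (d - 1) + 6 * (1 - gauss c d)))).
  { apply divide_24.
    - destruct (dedZ_mod8 c d Hd Od Gcd) as [u Hu].
      assert (E : P = d * (b - c + (d + 1 - 2 * gauss c d)) + 8 * (d * u - w8 * P)).
      { replace (d * (b - c + (d + 1 - 2 * gauss c d)) + 8 * (d * u - w8 * P)) with
          (d * (b - c + (d + 1 - 2 * gauss c d + u * 8)) - (w8 * 8) * P) by ring.
        rewrite <- W8. replace (d + 1 - 2 * gauss c d + u * 8) with (dedZ c d) by lia. fold X. rewrite <- EX. ring. }
      rewrite E. pose proof Od as Od'. destruct (odd_ex _ Od') as [m Hm].
      assert (exists n, m * (m - 1) = 2 * n) as [n Hn].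
      { destruct (Z.Even_or_Odd m) as [[i ->]|[i ->]]; [exists (i * (2 * i - 1))|exists ((2 * i + 1) * i)]; ring. }
      destruct (gauss_pm c d) as [-> | ->].
      + exists (d * u - w8 * P + n).
        assert ((d - 1) * (d - 3) = 4 * (m * (m - 1))) by (rewrite Hm; ring). lia.
      + exists (d * u - w8 * P + w8 - 1). lia.
    - assert (exists u, dedZ c d = 3 * u) as [u Hu].
      { unfold dedZ. assert (d mod 3 = 1 \/ d mod 3 = 2) as [E|E].
        { pose proof (Z.mod_pos_bound d 3). assert (d mod 3 <> 0) by (intro K; apply N3, Z.mod_divide; lia). lia. }
        - pose proof (Z.div_mod d 3 ltac:(lia)). rewrite E in *. set (k := d / 3) in *.
          exists (2 * c * k * (2 * d - 1) - 4 * flsum c d - d * (d - 1)). replace (2 * c * (d - 1)) with (2 * c * (3 * k)) by lia. ring.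
        - pose proof (Z.div_mod d 3 ltac:(lia)). rewrite E in *. set (k := d / 3) in *.
          exists (2 * c * (d - 1) * (2 * k + 1) - 4 * flsum c d - d * (d - 1)). replace (2 * d - 1) with (3 * (2 * k + 1)) by lia. ring. }
      exists (d * u - w3 * P - (d - 1) - 2 * (1 - gauss c d)).
      assert (E : P = d * X - (w3 * 3) * P) by (rewrite <- W3, <- EX; ring).
      rewrite E at 1. unfold X. rewrite Hu. ring. }
  destruct D as [t Ht]. exists t. rewrite EP. f_equal. lia.
Qed.

Lemma Qsum_mod24 (l : list nat) (r : nat -> Z) (F : nat -> Q) (P : nat -> Z) :
  (forall n, In n l -> exists t, Q2R (F n) = IZR (P n + 24 * t)) ->
  exists T, Q2R (Qsum l (fun n => inject_Z (r n) * F n)%Q) = IZR (Zsum l (fun n => r n * P n) + 24 * T).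
Proof.
  induction l as [|n l IH]; intros H.
  - exists 0. unfold Qsum, Zsum, Q2R. simpl. ring.
  - destruct IH as [T HT]; [intros; apply H; now right|].
    destruct (H n (or_introl eq_refl)) as [t Ht].
    exists (r n * t + T). change (Qsum (n :: l) (fun n => inject_Z (r n) * F n)%Q) with
      (inject_Z (r n) * F n + Qsum l (fun n => inject_Z (r n) * F n))%Q.
    rewrite Q2R_plus, Q2R_mult, Q2R_inject, Ht, HT, Zsum_cons, <- mult_IZR, <- plus_IZR. f_equal. ring.
Qed.

Lemma chi_e24 N r a b c d (P : nat -> Z) :
  (forall n, In n (divs N) -> exists t, Q2R (Psi a (b * Z.of_nat n) (c / Z.of_nat n) d) = IZR (P n + 24 * t)) ->
  chi N r a b c d 1 = e24 (Zsum (divs N) (fun n => r n * P n)).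
Proof.
  intros H. unfold chi. rewrite powerRZ_R1, Cmult_1_l, Q2R_mult.
  destruct (Qsum_mod24 (divs N) r (fun n => Psi a (b * Z.of_nat n) (c / Z.of_nat n) d) P H) as [T HT].
  rewrite HT. rewrite <- (e24_eq (Zsum (divs N) (fun n => r n * P n) + 24 * T)) by (exists T; ring).
  unfold e24. f_equal. unfold Q2R. simpl. field.
Qed.

Lemma level_div N n c : (0 < N)%nat -> In n (divs N) -> exists m, 0 < m /\ Z.of_nat (N / n) = m /\
  Z.of_nat N = Z.of_nat n * m /\ Z.of_nat N * c / Z.of_nat n = m * c.
Proof.
  intros HN Hn. apply in_divs in Hn. destruct Hn as [m (N1 & N2 & -> & N4)]. specialize (N4 HN).
  exists (Z.of_nat m). split; [lia|]. split; [easy|]. split; [lia|].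
  replace (Z.of_nat N * c) with (Z.of_nat m * c * Z.of_nat n) by lia. apply Z.div_mul. lia.
Qed.

(** The character on matrices with upper left entry 1, the left factors in [weight_identity]; their
    lower right entry may share factors with 6. *)
Lemma chi_unip N r j c : (0 < N)%nat -> 0 < c ->
  chi N r 1 j (Z.of_nat N * c) (1 + j * (Z.of_nat N * c)) 1 = e24 (j * xN N r - c * yN N r).
Proof.
  intros HN Hc. rewrite (chi_e24 N r _ _ _ _ (fun n => j * Z.of_nat n - Z.of_nat (N / n) * c)).
  - f_equal. unfold xN, yN. rewrite <- !Zsum_scal.
    replace (Zsum (divs N) (fun a => j * (Z.of_nat a * r a)) - Zsum (divs N) (fun a => c * (Z.of_nat (N / a) * r a)))
      with (Zsum (divs N) (fun a => j * (Z.of_nat a * r a)) + -1 * Zsum (divs N) (fun a => c * (Z.of_nat (N / a) * r a))) by ring.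
    rewrite <- Zsum_scal, <- Zsum_plus. apply Zsum_ext. intros n _. ring.
  - intros n Hn. destruct (level_div N n c HN Hn) as [m (M1 & -> & M3 & ->)]. exists 0.
    rewrite Z.mul_0_r, Z.add_0_r. rewrite <- Psi_unip by nia. f_equal. f_equal. rewrite M3. ring.
Qed.

(** The symbol of [(N/n) c] splits modulo 24 into that of [c], which occurs with total multiplicity
    [k2], and that of [N/n], which [gauss_Zprod] collects into the symbol of [varpi]. *)
Lemma chi_nice N r a b c d : (0 < N)%nat -> 0 < c -> 0 < d -> Z.gcd d 6 = 1 ->
  a * d - b * (Z.of_nat N * c) = 1 ->
  chi N r a b (Z.of_nat N * c) d 1 =
  e24 (d * (b * xN N r - c * yN N r) + 3 * (d - 1) * k2 N r + 6 * k2 N r * (1 - gauss c d)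
       + 6 * (1 - gauss (varpi N r) d)).
Proof.
  intros HN Hc Hd H6 Hdet. destruct (gcd6 d H6) as (Od & _ & _ & _).
  assert (Gc : Z.gcd c d = 1) by (apply Z.bezout_1_gcd; exists (- b * Z.of_nat N), a; lia).
  rewrite (chi_e24 N r _ _ _ _ (fun n => d * (b * Z.of_nat n - Z.of_nat (N / n) * c) + 3 * (d - 1)
     + 6 * ((1 - gauss c d) + (1 - gauss (Z.of_nat (N / n)) d)))).
  - apply e24_eq.
    destruct (gauss_Zprod r (fun n => Z.of_nat (N / n)) (divs N) d Hd Od) as [[u Hu] _].
    { intros n Hn. destruct (level_div N n c HN Hn) as [m (M1 & -> & M3 & _)].
      apply Z.bezout_1_gcd. exists (- b * Z.of_nat n * c), a. rewrite M3 in Hdet. lia. }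
    fold (varpi N r) in Hu. set (S := Zsum _ _) in Hu.
    exists (- u).
    rewrite (Zsum_ext _ _ (fun n => (d * b) * (Z.of_nat n * r n) + ((- (d * c)) * (Z.of_nat (N / n) * r n)
      + ((3 * (d - 1) + 6 * (1 - gauss c d)) * r n + 6 * (r n * (1 - gauss (Z.of_nat (N / n)) d)))))) by (intros; ring).
    rewrite !Zsum_plus, !Zsum_scal. fold (xN N r) (yN N r) (k2 N r) S. lia.
  - intros n Hn. destruct (level_div N n c HN Hn) as [m (M1 & -> & M3 & ->)].
    assert (Hdet' : a * d - b * Z.of_nat n * (m * c) = 1) by (rewrite M3 in Hdet; lia).
    destruct (Psi_nice a (b * Z.of_nat n) (m * c) d ltac:(nia) Hd H6 Hdet') as [t Ht].
    assert (Gm : Z.gcd m d = 1) by (apply Z.bezout_1_gcd; exists (- b * Z.of_nat n * c), a; lia).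
    rewrite gauss_mul in Ht by easy. rewrite Ht.
    destruct (gauss_pm c d) as [-> | ->], (gauss_pm m d) as [-> | ->]; [exists t|exists t|exists t|exists (t - 1)]; f_equal; ring.
Qed.

Lemma in_divsZ l a : 0 < l -> In a (divsZ l) -> 0 < a /\ a * (l / a) = l.
Proof.
  unfold divsZ. intros Hl H. apply filter_In in H. destruct H as [H1 H2].
  apply in_map_iff in H1. destruct H1 as [n [<- Hn]]. apply in_seq in Hn.
  apply Z.eqb_eq in H2. split; [lia|]. symmetry. apply Z.div_exact; lia.
Qed.

Lemma psi_lr_e24 N r l al be : psi_lr N r l al be = e24 (3 * psiZ N r l al be).
Proof.
  assert (Ed : delta N r = IZR (deltaZ N r)) by (unfold delta, deltaZ; destruct (_ =? _); reflexivity).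
  assert (Ed1 : delta1 N r l = IZR (delta1Z N r l)) by (unfold delta1, delta1Z; destruct (_ && _)%bool; reflexivity).
  unfold psi_lr, psiZ, wt. rewrite Ed, Ed1, INR_IZR_INZ.
  destruct (Z.odd l).
  - unfold e24. f_equal. repeat rewrite ?mult_IZR, ?minus_IZR, ?plus_IZR. field.
  - destruct (Nat.even N).
    + unfold e24. f_equal. repeat rewrite ?mult_IZR, ?minus_IZR, ?plus_IZR, ?opp_IZR. field.
    + symmetry; exact e24_0.
Qed.

(* The matrices are the factors of [(1 0; 0 l) (al q; N r' s) = (1 j; de N r' d1) (al be; 0 de)]. *)
Lemma weight_identity N r l al be : (0 < N)%nat -> in_Lf N r l -> In al (divsZ l) ->
  Z.gcd al (Z.of_nat N) = 1 -> 0 <= be -> Z.gcd (Z.gcd al be) (l / al) = 1 ->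
  let de := l / al in
  exists j r' s, let q := be + de * j in let c := Z.of_nat N * r' in
    al * s - q * c = 1 /\ 1 * (al * s - be * c) - j * (de * c) = 1 /\
    chi N r 1 j (de * c) (al * s - be * c) 1 =
    Cmult (chi N r al q c s 1)
      (Cmult (RtoC (IZR (kron al (varpi N r))))
        (Cmult (Cmult (RtoC (powerRZ (IZR (kron (- Z.of_nat N * be) (Z.gcd al de))) (k2 N r)))
                      (e24 (- (be * de * xN N r)))) (psi_lr N r l al be))).
Proof.
  intros HN Hl Hal HgN Hbe Hg3 de. assert (Hl0 : 0 < l) by (destruct Hl; lia).
  destruct (in_divsZ l al Hl0 Hal) as [Pal El]. fold de in El, Hg3.
  assert (Pde : 0 < de) by nia.
  destruct (coset_rep_exists al be de (Z.of_nat N) Pal Pde Hbe ltac:(lia) Hg3 HgN)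
    as [j [r' [s (Hj & Hq & Hr & Hs & Hdet & H6 & H8 & H3)]]].
  exists j, r', s. cbv zeta. split; [exact Hdet|]. split; [lia|].
  replace (al * s - be * (Z.of_nat N * r')) with (1 + j * (Z.of_nat N * (de * r'))) by lia.
  replace (de * (Z.of_nat N * r')) with (Z.of_nat N * (de * r')) by ring.
  rewrite chi_unip, chi_nice, psi_lr_e24 by (easy || nia).
  rewrite sign_e24, sign_pow_e24.
  - rewrite <- !e24_plus. apply e24_eq.
    destruct (weight_congruence N r l al de be j r' s HN Hl El Pal Pde HgN Hg3 Hq Hr Hs Hdet H6 H8 H3) as [u Hu].
    exists u. lia.
  - apply kron_pm.
    + now apply gcd_pos_l.
    + apply (kron_beta_coprime N al de be HgN Hg3).
  - apply kron_pm; [now apply varpi_facts|now apply varpi_coprime].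
Qed.

Close Scope Z_scope.
Open Scope R_scope.

(** * Complex series *)

(** Series lemmas leave equations over the carrier of a normed module; stating them over [C] lets
    [ring] and [field] recognise the structure. *)
Ltac eqC := match goal with |- @eq _ ?x ?y => change (@eq C x y) end.

Lemma Re_sum_n (a : nat -> C) n : Re (sum_n a n) = sum_n (fun k => Re (a k)) n.
Proof. induction n as [|n IH]; [now rewrite !sum_O|]. rewrite !sum_Sn, <- IH. reflexivity. Qed.

Lemma Im_sum_n (a : nat -> C) n : Im (sum_n a n) = sum_n (fun k => Im (a k)) n.
Proof. induction n as [|n IH]; [now rewrite !sum_O|]. rewrite !sum_Sn, <- IH. reflexivity. Qed.

Lemma Cis_series_iff (a : nat -> C) (l : C) :
  is_series a l <-> is_series (fun n => Re (a n)) (Re l) /\ is_series (fun n => Im (a n)) (Im l).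
Proof.
  unfold is_series. split.
  - intros H. pose proof (proj1 (filterlim_locally (U := C_UniformSpace) (sum_n a) l) H) as H'.
    split; apply (filterlim_locally (U := R_UniformSpace)); intros eps; destruct (H' eps) as [n0 Hn];
    exists n0; intros n Hn0; specialize (Hn n Hn0); destruct Hn as [H1 H2].
    + rewrite <- Re_sum_n. exact H1.
    + rewrite <- Im_sum_n. exact H2.
  - intros [H1 H2]. apply (filterlim_locally (U := C_UniformSpace)). intros eps.
    destruct (proj1 (filterlim_locally (U := R_UniformSpace) _ _) H1 eps) as [n1 N1].
    destruct (proj1 (filterlim_locally (U := R_UniformSpace) _ _) H2 eps) as [n2 N2].
    exists (max n1 n2). intros n Hn. split.
    + change (ball (Re l) eps (Re (sum_n a n))). rewrite Re_sum_n. apply N1. lia.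
    + change (ball (Im l) eps (Im (sum_n a n))). rewrite Im_sum_n. apply N2. lia.
Qed.

Lemma Cis_series_unique (a : nat -> C) (l l' : C) : is_series a l -> is_series a l' -> l = l'.
Proof.
  rewrite !Cis_series_iff. intros [H1 H2] [H1' H2'].
  apply is_series_unique in H1, H2, H1', H2'. destruct l, l'. simpl in *. congruence.
Qed.

Lemma Rabs_Re_le (z : C) : Rabs (Re z) <= Cmod z.
Proof.
  eapply Rle_trans; [|apply Rmax_Cmod]. apply Rmax_l.
Qed.

Lemma Rabs_Im_le (z : C) : Rabs (Im z) <= Cmod z.
Proof.
  eapply Rle_trans; [|apply Rmax_Cmod]. apply Rmax_r.
Qed.

Lemma ex_series_abs_le (a b : nat -> R) :
  (forall n, Rabs (a n) <= b n) -> ex_series b -> ex_series (fun n => Rabs (a n)).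
Proof.
  intros H Hb. apply (ex_series_le (K := R_AbsRing) (V := R_CompleteNormedModule) _ b); [|easy].
  intros n. change (Rabs (Rabs (a n)) <= b n). now rewrite Rabs_Rabsolu.
Qed.

Lemma Cex_series (a : nat -> C) : ex_series (fun n => Cmod (a n)) -> exists l : C, is_series a l.
Proof.
  intros H.
  assert (H1 : ex_series (fun n => Re (a n))).
  { apply ex_series_Rabs, (ex_series_abs_le _ (fun n => Cmod (a n))); [|easy]. intros; apply Rabs_Re_le. }
  assert (H2 : ex_series (fun n => Im (a n))).
  { apply ex_series_Rabs, (ex_series_abs_le _ (fun n => Cmod (a n))); [|easy]. intros; apply Rabs_Im_le. }
  exists (Series (fun n => Re (a n)), Series (fun n => Im (a n))).
  apply Cis_series_iff. split; now apply Series_correct.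
Qed.

Lemma Cseries_mult (a b : nat -> C) (la lb : C) : is_series a la -> is_series b lb ->
  ex_series (fun n => Cmod (a n)) -> ex_series (fun n => Cmod (b n)) ->
  is_series (fun n => sum_n (fun k => Cmult (a k) (b (n - k)%nat)) n) (Cmult la lb).
Proof.
  rewrite !Cis_series_iff. intros [A1 A2] [B1 B2] Ha Hb.
  assert (XR : forall c : nat -> C, ex_series (fun n => Cmod (c n)) -> ex_series (fun n => Rabs (Re (c n)))).
  { intros c Hc. apply (ex_series_abs_le _ (fun n => Cmod (c n))); [|easy]. intros; apply Rabs_Re_le. }
  assert (XI : forall c : nat -> C, ex_series (fun n => Cmod (c n)) -> ex_series (fun n => Rabs (Im (c n)))).
  { intros c Hc. apply (ex_series_abs_le _ (fun n => Cmod (c n))); [|easy]. intros; apply Rabs_Im_le. }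
  pose proof (is_series_mult _ _ _ _ A1 B1 (XR a Ha) (XR b Hb)) as M1.
  pose proof (is_series_mult _ _ _ _ A2 B2 (XI a Ha) (XI b Hb)) as M2.
  pose proof (is_series_mult _ _ _ _ A1 B2 (XR a Ha) (XI b Hb)) as M3.
  pose proof (is_series_mult _ _ _ _ A2 B1 (XI a Ha) (XR b Hb)) as M4.
  split.
  - eapply is_series_ext; [|exact (is_series_minus _ _ _ _ M1 M2)].
    intros n. rewrite Re_sum_n, sum_n_Reals. symmetry. apply minus_sum.
  - eapply is_series_ext; [|exact (is_series_plus _ _ _ _ M3 M4)].
    intros n. rewrite Im_sum_n, sum_n_Reals. symmetry. apply plus_sum.
Qed.

(** Puts [u n] at index [A + B n] and 0 elsewhere, the effect on coefficients of a substitution by a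
    power and a shift. It brings series in different fractional powers of q onto one grid. *)
Definition spread (A B : nat) (u : nat -> C) (t : nat) : C :=
  if andb (Nat.leb A t) (Nat.eqb ((t - A) mod B) 0) then u ((t - A) / B)%nat else RtoC 0.

Lemma sum_n_spread A B u : (0 < B)%nat -> forall T, 
  sum_n (spread A B u) (A + T) = sum_n u (T / B).
Proof.
  intros HB T. induction T as [|T IH].
  - rewrite Nat.add_0_r, Nat.Div0.div_0_l, sum_O.
    assert (L : forall t, (t <= A)%nat -> sum_n (spread A B u) t = if Nat.eqb t A then u O else RtoC 0).
    { induction t as [|t IHt]; intros Ht.
      - rewrite sum_O. unfold spread. destruct A; simpl.
        + rewrite Nat.Div0.mod_0_l, Nat.Div0.div_0_l. reflexivity.
        + reflexivity.
      - rewrite sum_Sn, IHt by lia. unfold spread.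
        destruct (Nat.eqb_spec t A); [lia|]. destruct (Nat.eqb_spec (S t) A) as [<-|].
        + rewrite Nat.leb_refl, Nat.sub_diag, Nat.Div0.mod_0_l, Nat.Div0.div_0_l. simpl. apply Cplus_0_l.
        + destruct (Nat.leb_spec A (S t)); [lia|]. simpl. apply Cplus_0_l. }
    rewrite L by lia. now rewrite Nat.eqb_refl.
  - rewrite Nat.add_succ_r, sum_Sn, IH. unfold spread.
    assert (Es : (S (A + T) - A = S T)%nat) by lia. rewrite Es.
    destruct (Nat.leb_spec A (S (A + T))); [|lia]. cbn [andb].
    pose proof (Nat.div_mod_eq T B). pose proof (Nat.div_mod_eq (S T) B).
    pose proof (Nat.mod_upper_bound T B). pose proof (Nat.mod_upper_bound (S T) B).
    destruct (Nat.eqb_spec (S T mod B) 0) as [E|E].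
    + assert (D : (S T / B = S (T / B))%nat) by nia. rewrite D, sum_Sn. reflexivity.
    + assert (D : (S T / B = T / B)%nat) by nia. rewrite D. apply Cplus_0_r.
Qed.

Lemma is_series_spread A B u (l : C) : (0 < B)%nat -> is_series u l -> is_series (spread A B u) l.
Proof.
  intros HB H. unfold is_series in *. intros P HP. specialize (H P HP).
  destruct H as [n0 Hn]. exists (A + n0 * B)%nat. intros t Ht.
  replace t with (A + (t - A))%nat by lia. rewrite sum_n_spread by easy. apply Hn.
  apply Nat.div_le_lower_bound; lia.
Qed.

Lemma Cis_series_0 : is_series (fun _ : nat => RtoC 0) (RtoC 0).
Proof.
  apply Cis_series_iff. split; apply is_series_Reals; intros eps He; exists O; intros n _;
  simpl Re; simpl Im; rewrite sum_eq_R0 by easy; rewrite Rdist_eq; lra.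
Qed.

Lemma Cis_series_single k (v : C) : is_series (fun j => if Nat.eqb j k then v else RtoC 0) v.
Proof.
  apply (is_series_ext (spread k 1 (fun j => if Nat.eqb j 0 then v else RtoC 0))).
  - intros j. unfold spread. rewrite Nat.mod_1_r, Nat.div_1_r. simpl.
    destruct (Nat.leb_spec k j), (Nat.eqb_spec j k); simpl; try lia; try reflexivity.
    + subst. now rewrite Nat.sub_diag.
    + destruct (Nat.eqb_spec (j - k) 0); [lia|reflexivity].
  - apply is_series_spread; [lia|]. apply is_series_decr_1. simpl.
    change (is_series (fun _ : nat => RtoC 0) (Cplus v (Copp v))).
    replace (Cplus v (Copp v)) with (RtoC 0) by ring. apply Cis_series_0.
Qed.

(** Absolute convergence provides some sum [L], and removing the first term gives [L = 1 + w L]. *)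
Lemma Cis_series_geom (w : C) : Cmod w < 1 -> is_series (fun k => Cpow w k) (Cinv (Cminus (RtoC 1) w)).
Proof.
  intros Hw. assert (N1 : Cminus (RtoC 1) w <> RtoC 0).
  { intros E. assert (w = RtoC 1) by (replace w with (Cminus (RtoC 1) (Cminus (RtoC 1) w)) by ring; rewrite E; ring).
    subst. rewrite Cmod_1 in Hw. lra. }
  destruct (Cex_series (fun k => Cpow w k)) as [L HL].
  { eapply ex_series_ext; [|apply ex_series_geom; rewrite (Rabs_pos_eq (Cmod w)); [exact Hw|apply Cmod_ge_0]].
    intros n. now rewrite Cmod_pow. }
  assert (E : L = Cplus (RtoC 1) (Cmult w L)).
  { apply (Cis_series_unique _ _ _ HL). apply is_series_decr_1.
    change (is_series (fun k => Cmult w (Cpow w k)) (Cplus (Cplus 1 (Cmult w L)) (Copp 1))).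
    replace (Cplus (Cplus 1 (Cmult w L)) (Copp 1)) with (Cmult w L) by ring.
    exact (is_series_scal w _ _ HL). }
  replace (Cinv (Cminus (RtoC 1) w)) with L; [exact HL|].
  transitivity (Cmult (Cminus L (Cmult w L)) (Cinv (Cminus (RtoC 1) w))); [field; easy|].
  rewrite E at 1. field. easy.
Qed.

(** * Evaluation of formal power series *)

(** Absolute convergence is part of the predicate so that it survives Cauchy products. *)
Definition psval (p : nat -> Z) (z v : C) : Prop :=
  is_series (fun j => Cmult (RtoC (IZR (p j))) (Cpow z j)) v /\
  ex_series (fun j => Rabs (IZR (p j)) * Cmod z ^ j).

Lemma Zsum_seq_S n F : Zsum (seq 0 (S n)) F = (Zsum (seq 0 n) F + F n)%Z.
Proof. rewrite seq_S, Zsum_app. simpl. unfold Zsum at 2. simpl. lia. Qed.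

Lemma ps_mul_sum (F : nat -> Z) (w : C) n :
  Cmult (RtoC (IZR (Zsum (seq 0 (S n)) F))) w = sum_n (fun k => Cmult (RtoC (IZR (F k))) w) n.
Proof.
  induction n as [|n IH].
  - rewrite sum_O. unfold Zsum. simpl. now rewrite Z.add_0_r.
  - rewrite sum_Sn, <- IH, Zsum_seq_S, plus_IZR, RtoC_plus. apply Cmult_plus_distr_r.
Qed.

Lemma Cmod_term (p : nat -> Z) (z : C) j :
  Cmod (Cmult (RtoC (IZR (p j))) (Cpow z j)) = Rabs (IZR (p j)) * Cmod z ^ j.
Proof. now rewrite Cmod_mult, Cmod_R, Cmod_pow. Qed.

Lemma Rabs_IZR_Zsum n F : Rabs (IZR (Zsum (seq 0 (S n)) F)) <= sum_f_R0 (fun k => Rabs (IZR (F k))) n.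
Proof.
  induction n as [|n IH].
  - unfold Zsum. simpl. rewrite Z.add_0_r. lra.
  - rewrite Zsum_seq_S, plus_IZR. simpl sum_f_R0. eapply Rle_trans; [apply Rabs_triang|]. lra.
Qed.

Lemma psval_mul p q z v w : psval p z v -> psval q z w -> psval (ps_mul p q) z (Cmult v w).
Proof.
  intros [P1 P2] [Q1 Q2]. split.
  - eapply is_series_ext; [|apply (Cseries_mult _ _ _ _ P1 Q1)].
    + intros j. symmetry. unfold ps_mul. rewrite ps_mul_sum. apply sum_n_ext_loc. intros k Hk.
      replace (Cpow z j) with (Cmult (Cpow z k) (Cpow z (j - k))) by (rewrite <- Cpow_add_r; f_equal; lia).
      rewrite mult_IZR, RtoC_mult. eqC. ring.
    + eapply ex_series_ext; [|exact P2]. intros; symmetry; apply Cmod_term.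
    + eapply ex_series_ext; [|exact Q2]. intros; symmetry; apply Cmod_term.
  - assert (N : forall (p : nat -> Z) n, 0 <= Rabs (IZR (p n)) * Cmod z ^ n).
    { intros p' n. apply Rmult_le_pos; [apply Rabs_pos|]. apply pow_le, Cmod_ge_0. }
    pose proof (is_series_mult_pos _ _ _ _ (Series_correct _ P2) (Series_correct _ Q2) (N p) (N q)) as M.
    apply (ex_series_le (K := R_AbsRing) (V := R_CompleteNormedModule) _
      (fun n => sum_f_R0 (fun k => Rabs (IZR (p k)) * Cmod z ^ k * (Rabs (IZR (q (n - k)%nat)) * Cmod z ^ (n - k))) n));
      [|now eexists; exact M].
    intros n. change (Rabs (Rabs (IZR (ps_mul p q n)) * Cmod z ^ n) <=
      sum_f_R0 (fun k => Rabs (IZR (p k)) * Cmod z ^ k * (Rabs (IZR (q (n - k)%nat)) * Cmod z ^ (n - k))) n).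
    rewrite Rabs_pos_eq by apply N.
    eapply Rle_trans; [apply Rmult_le_compat_r; [apply pow_le, Cmod_ge_0|apply Rabs_IZR_Zsum]|].
    rewrite Rmult_comm, scal_sum. right. apply sum_eq. intros k Hk.
    rewrite mult_IZR, Rabs_mult. replace (Cmod z ^ n) with (Cmod z ^ k * Cmod z ^ (n - k)) by (rewrite <- pow_add; f_equal; lia). ring.
Qed.

Lemma psval_of_finite p z v : (exists n0, forall j, (n0 < j)%nat -> p j = 0%Z) ->
  is_series (fun j => Cmult (RtoC (IZR (p j))) (Cpow z j)) v -> psval p z v.
Proof.
  intros [n0 H] Hs. split; [easy|].
  apply (ex_series_incr_n _ (S n0)). exists 0. eapply is_series_ext; [|].
  2:{ apply is_series_Reals. intros eps He. exists O. intros n _. rewrite (sum_eq_R0 (fun _ => 0)) by easy. rewrite Rdist_eq. lra. }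
  intros n. simpl. rewrite H by lia. rewrite Rabs_R0. ring.
Qed.

Lemma psval_one z : psval ps_one z (RtoC 1).
Proof.
  apply psval_of_finite.
  - exists O. intros [|j] Hj; [lia|reflexivity].
  - eapply is_series_ext; [|apply (Cis_series_single 0 (RtoC 1))].
    intros [|j]; simpl; unfold ps_one; simpl; eqC; ring.
Qed.

Lemma psval_one_minus s z : (0 < s)%nat -> psval (ps_one_minus s) z (Cminus (RtoC 1) (Cpow z s)).
Proof.
  intros Hs. apply psval_of_finite.
  - exists s. intros j Hj. unfold ps_one_minus. destruct (Nat.eqb_spec j 0); [lia|]. destruct (Nat.eqb_spec j s); [lia|easy].
  - eapply is_series_ext; [|exact (is_series_minus _ _ _ _ (Cis_series_single 0 (RtoC 1)) (Cis_series_single s (Cpow z s)))].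
    intros j. unfold ps_one_minus. change (Cplus (if Nat.eqb j 0 then RtoC 1 else RtoC 0) (Copp (if Nat.eqb j s then Cpow z s else RtoC 0))
      = Cmult (RtoC (IZR (if Nat.eqb j 0 then 1 else if Nat.eqb j s then -1 else 0))) (Cpow z j)).
    destruct (Nat.eqb_spec j 0) as [->|]; [destruct (Nat.eqb_spec 0 s); [lia|]; simpl; ring|].
    destruct (Nat.eqb_spec j s) as [->|]; [|ring].
    replace (RtoC (IZR (-1))) with (Copp (RtoC 1)) by (rewrite <- RtoC_opp; f_equal). ring.
Qed.

Lemma Cmod_pow_lt1 z s : (0 < s)%nat -> Cmod z < 1 -> Cmod (Cpow z s) < 1.
Proof.
  intros Hs Hz. rewrite Cmod_pow. apply pow_lt_1_compat; [|easy]. split; [apply Cmod_ge_0|easy].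
Qed.

Lemma psval_geom s z : (0 < s)%nat -> Cmod z < 1 -> psval (ps_geom s) z (Cinv (Cminus (RtoC 1) (Cpow z s))).
Proof.
  intros Hs Hz. split.
  - eapply is_series_ext; [|apply (is_series_spread 0 s), Cis_series_geom; [easy|now apply Cmod_pow_lt1]].
    intros j. unfold spread, ps_geom. rewrite Nat.sub_0_r. simpl Nat.leb. simpl andb.
    destruct (Nat.eqb_spec (j mod s) 0) as [E|E]; [|eqC; ring].
    rewrite <- Cpow_mult_r. apply Nat.Div0.div_exact in E. rewrite <- E. eqC; ring.
  - apply (ex_series_le (K := R_AbsRing) (V := R_CompleteNormedModule) _ (fun j => Cmod z ^ j)).
    + intros j. change (Rabs (Rabs (IZR (ps_geom s j)) * Cmod z ^ j) <= Cmod z ^ j).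
      assert (0 <= Cmod z ^ j) by apply pow_le, Cmod_ge_0.
      unfold ps_geom. destruct (Nat.eqb _ 0); rewrite ?Rabs_R1, ?Rabs_R0, ?Rmult_1_l, ?Rmult_0_l, ?Rabs_R0; try lra.
      rewrite Rabs_pos_eq; lra.
    + apply ex_series_geom. rewrite Rabs_pos_eq; [easy|apply Cmod_ge_0].
Qed.

Lemma psval_pow p z v n : psval p z v -> psval (ps_pow p n) z (Cpow v n).
Proof.
  intros H. induction n as [|n IH]; [apply psval_one|]. simpl ps_pow. rewrite Cpow_S. now apply psval_mul.
Qed.

Lemma one_minus_neq_0 z : Cmod z < 1 -> Cminus (RtoC 1) z <> RtoC 0.
Proof.
  intros Hw E. assert (z = RtoC 1) by (replace z with (Cminus (RtoC 1) (Cminus (RtoC 1) z)) by ring; rewrite E; ring).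
  subst. rewrite Cmod_1 in Hw. lra.
Qed.

Lemma psval_factor s k z : (0 < s)%nat -> Cmod z < 1 ->
  psval (ps_factor s k) z (Cpowz (Cminus (RtoC 1) (Cpow z s)) k).
Proof.
  intros Hs Hz. unfold ps_factor. destruct k as [|k|k]; simpl Z.leb; cbv iota.
  - apply psval_one.
  - change (Z.to_nat (Zpos k)) with (Pos.to_nat k). simpl Cpowz. apply psval_pow, psval_one_minus. easy.
  - change (Z.to_nat (- Zneg k)) with (Pos.to_nat k). simpl Cpowz.
    rewrite <- Cpow_inv by (apply one_minus_neq_0, Cmod_pow_lt1; easy).
    apply psval_pow, psval_geom; easy.
Qed.

(** * The infinite product and its power series *)

Definition eta_factors (N : nat) (r : nat -> Z) (M : nat) : nat -> Z :=
  fold_right ps_mul ps_one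
    (flat_map (fun n => map (fun m => ps_factor (n * m) (r n)) (seq 1 M)) (divs N)).

Definition eta_trunc (N : nat) (r : nat -> Z) (M : nat) (z : C) : C :=
  Cprod (divs N) (fun n => Cprod (seq 1 M) (fun m => Cpowz (Cminus (RtoC 1) (Cpow z (n * m))) (r n))).

Lemma Cprod_cons {A} (a : A) l F : Cprod (a :: l) F = Cmult (F a) (Cprod l F).
Proof. reflexivity. Qed.

Lemma divs_pos N n : In n (divs N) -> (0 < n)%nat.
Proof. intros H. apply in_divs in H. destruct H as [m [H _]]. exact H. Qed.

Lemma psval_fold {A} (g : A -> nat -> Z) (v : A -> C) p0 v0 z (ms : list A) : psval p0 z v0 ->
  (forall m, In m ms -> psval (g m) z (v m)) ->
  psval (fold_right ps_mul p0 (map g ms)) z (Cmult (Cprod ms v) v0).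
Proof.
  intros H0. induction ms as [|m ms IH]; intros H.
  - unfold Cprod. simpl. now rewrite Cmult_1_l.
  - simpl map. simpl fold_right. rewrite Cprod_cons, <- Cmult_assoc.
    apply psval_mul; [apply H; now left|]. apply IH. intros; apply H; now right.
Qed.

Lemma eta_factors_val N r M z : Cmod z < 1 -> psval (eta_factors N r M) z (eta_trunc N r M z).
Proof.
  intros Hz. unfold eta_factors, eta_trunc.
  assert (Hp := divs_pos N). induction (divs N) as [|n l IH]; [apply psval_one|].
  simpl flat_map. rewrite fold_right_app, Cprod_cons.
  apply psval_fold.
  - apply IH. intros; apply Hp; now right.
  - intros m Hm. apply in_seq in Hm. specialize (Hp n (or_introl eq_refl)).
    apply psval_factor; [nia|easy].
Qed.

Definition ps_agree (J : nat) (p q : nat -> Z) : Prop := forall j, (j <= J)%nat -> p j = q j.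

Lemma ps_mul_agree J p p' q q' : ps_agree J p p' -> ps_agree J q q' ->
  ps_agree J (ps_mul p q) (ps_mul p' q').
Proof.
  intros Hp Hq j Hj. unfold ps_mul. apply Zsum_ext. intros i Hi. apply in_seq in Hi.
  rewrite Hp, Hq by lia. reflexivity.
Qed.

Lemma ps_mul_one_l q j : ps_mul ps_one q j = q j.
Proof.
  unfold ps_mul. change (seq 0 (S j)) with (0%nat :: seq 1 j). rewrite Zsum_cons, Nat.sub_0_r.
  rewrite (Zsum_ext _ _ (fun _ => 0%Z)).
  - assert (Z0 : forall l : list nat, Zsum l (fun _ => 0%Z) = 0%Z)
      by (induction l as [|a l IH]; [reflexivity|now rewrite Zsum_cons, IH]).
    rewrite Z0. change (ps_one 0) with 1%Z. lia.
  - intros [|i] Hi; [apply in_seq in Hi; lia|reflexivity].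
Qed.

Lemma ps_pow_agree_one J p n : ps_agree J p ps_one -> ps_agree J (ps_pow p n) ps_one.
Proof.
  intros H. induction n as [|n IH]; [easy|]. intros j Hj. simpl.
  rewrite (ps_mul_agree J _ ps_one _ ps_one H IH) by easy. now rewrite ps_mul_one_l.
Qed.

Lemma ps_factor_agree_one J s k : (J < s)%nat -> ps_agree J (ps_factor s k) ps_one.
Proof.
  intros Hs. unfold ps_factor. destruct (Z.leb 0 k); apply ps_pow_agree_one; intros j Hj.
  - unfold ps_one_minus, ps_one. destruct (Nat.eqb_spec j 0); [easy|]. destruct (Nat.eqb_spec j s); [lia|easy].
  - unfold ps_geom, ps_one. now rewrite Nat.mod_small by lia.
Qed.

Lemma fold_ps_mul_agree J (l : list (nat -> Z)) p q : ps_agree J p q ->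
  ps_agree J (fold_right ps_mul p l) (fold_right ps_mul q l).
Proof.
  intros H. induction l as [|g l IH]; [easy|]. simpl. now apply ps_mul_agree.
Qed.

Lemma fold_ps_mul_agree_one J (l : list (nat -> Z)) p : (forall g, In g l -> ps_agree J g ps_one) ->
  ps_agree J (fold_right ps_mul p l) p.
Proof.
  induction l as [|g l IH]; intros H; [easy|]. simpl. intros j Hj.
  rewrite (ps_mul_agree J g ps_one (fold_right ps_mul p l) p);
    [apply ps_mul_one_l|apply H; now left|apply IH; intros; apply H; now right|easy].
Qed.

(** A factor with [m > J] is 1 up to degree [J], so the coefficient no longer changes once [M]
    reaches [J]. *)
Lemma eta_factors_stable N r J M : (J <= M)%nat -> eta_factors N r M J = eta_coef N r J.
Proof.
  intros HJ. unfold eta_coef. change (fold_right ps_mul ps_one _ J) with (eta_factors N r J J).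
  enough (H : ps_agree J (eta_factors N r M) (eta_factors N r J)) by now apply H.
  unfold eta_factors. pose proof (divs_pos N) as Hp.
  induction (divs N) as [|n l IH]; [easy|]. simpl flat_map. rewrite !fold_right_app.
  assert (IH' := IH (fun k Hk => Hp k (or_intror Hk))). clear IH. revert IH'.
  set (p := fold_right ps_mul ps_one (flat_map _ l)).
  set (q := fold_right ps_mul ps_one (flat_map _ l)). intros IH'. clearbody p q.
  assert (Es : seq 1 M = seq 1 J ++ seq (1 + J) (M - J)) by (rewrite <- seq_app; f_equal; lia).
  rewrite Es, map_app, fold_right_app. apply fold_ps_mul_agree. intros j Hj.
  rewrite (fold_ps_mul_agree_one J); [now apply IH'| |easy].
  intros g Hg. apply in_map_iff in Hg. destruct Hg as [m [<- Hm]]. apply in_seq in Hm.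
  apply ps_factor_agree_one. specialize (Hp n (or_introl eq_refl)). nia.
Qed.

Definition ps_dom (p q : nat -> Z) : Prop := forall j, (Z.abs (p j) <= q j)%Z.

Lemma Zsum_dom {A} (l : list A) F G : (forall a, In a l -> (Z.abs (F a) <= G a)%Z) ->
  (Z.abs (Zsum l F) <= Zsum l G)%Z.
Proof.
  induction l as [|a l IH]; intros H; [easy|]. rewrite !Zsum_cons.
  pose proof (H a (or_introl eq_refl)). assert (Z.abs (Zsum l F) <= Zsum l G)%Z by (apply IH; intros; apply H; now right). lia.
Qed.

Lemma ps_mul_dom p p' q q' : ps_dom p p' -> ps_dom q q' -> ps_dom (ps_mul p q) (ps_mul p' q').
Proof.
  intros Hp Hq j. apply Zsum_dom. intros i _. rewrite Z.abs_mul. specialize (Hp i). specialize (Hq (j - i)%nat).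
  apply Z.mul_le_mono_nonneg; lia.
Qed.

Lemma ps_one_dom : ps_dom ps_one ps_one.
Proof. intros j. unfold ps_one. destruct (Nat.eqb j 0); lia. Qed.

Lemma ps_pow_dom p q n : ps_dom p q -> ps_dom (ps_pow p n) (ps_pow q n).
Proof. intros H. induction n as [|n IH]; [apply ps_one_dom|]. simpl. now apply ps_mul_dom. Qed.

(** The geometric series majorises both itself and [1 - q^s]. Replacing each exponent by minus its
    absolute value thus gives a majorant with nonnegative coefficients. *)
Lemma ps_factor_dom s k : (0 < s)%nat -> ps_dom (ps_factor s k) (ps_factor s (- Z.abs k)).
Proof.
  intros Hs. unfold ps_factor. destruct k as [|k|k]; simpl; try apply ps_one_dom; apply ps_pow_dom; intros j.
  - unfold ps_one_minus, ps_geom. destruct (Nat.eqb_spec j 0) as [->|]; [rewrite Nat.Div0.mod_0_l; simpl; lia|].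
    destruct (Nat.eqb_spec j s) as [->|]; [rewrite Nat.Div0.mod_same; simpl; lia|]. destruct (Nat.eqb _ 0); simpl; lia.
  - unfold ps_geom. destruct (Nat.eqb _ 0); simpl; lia.
Qed.

Lemma eta_factors_dom N r M : ps_dom (eta_factors N r M) (eta_factors N (fun n => - Z.abs (r n))%Z M).
Proof.
  unfold eta_factors. pose proof (divs_pos N) as Hp.
  induction (divs N) as [|n l IH]; [apply ps_one_dom|]. simpl flat_map. rewrite !fold_right_app.
  assert (IH' := IH (fun k Hk => Hp k (or_intror Hk))). clear IH.
  revert IH'. set (p := fold_right ps_mul ps_one (flat_map _ l)).
  set (q := fold_right ps_mul ps_one (flat_map _ l)). intros IH'. clearbody p q.
  assert (Hs : forall m, In m (seq 1 M) -> (0 < n * m)%nat).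
  { intros m Hm. apply in_seq in Hm. specialize (Hp n (or_introl eq_refl)). nia. }
  induction (seq 1 M) as [|m ms IHm]; [easy|]. simpl. apply ps_mul_dom.
  - apply ps_factor_dom, Hs. now left.
  - apply IHm. intros; apply Hs; now right.
Qed.

Lemma pow_decr x a b : 0 <= x <= 1 -> (a <= b)%nat -> x ^ b <= x ^ a.
Proof.
  intros Hx Hab. replace b with (a + (b - a))%nat by lia. rewrite pow_add.
  assert (0 <= x ^ a) by (apply pow_le; lra).
  assert (x ^ (b - a) <= 1) by (rewrite <- (pow1 (b - a)); apply pow_incr; lra).
  rewrite <- (Rmult_1_r (x ^ a)) at 2. now apply Rmult_le_compat_l.
Qed.

(** With [u = x^(n m)], use [1 / (1 - u) = 1 + u / (1 - u)] and [1 + t <= exp t]. The exponents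
    obtained are summable over [m], which gives [eta_trunc_bound] uniformly in [M]. *)
Lemma inv_one_minus_bound x n m : 0 < x < 1 -> (0 < n)%nat -> (0 < m)%nat ->
  0 < 1 - x ^ (n * m) /\ / (1 - x ^ (n * m)) <= exp (x ^ m / (1 - x)).
Proof.
  intros Hx Hn Hm. assert (H1 : x ^ m <= x) by (rewrite <- (pow_1 x) at 2; apply pow_decr; lra || lia).
  assert (H2 : x ^ (n * m) <= x ^ m) by (apply pow_decr; lra || nia).
  assert (H3 : 0 < x ^ (n * m)) by (apply pow_lt; lra). set (u := x ^ (n * m)) in *.
  split; [lra|]. eapply Rle_trans; [|apply exp_ineq1_le].
  assert (H4 : / (1 - u) <= / (1 - x)) by (apply Rinv_le_contravar; lra).
  assert (H5 : 0 < / (1 - u)) by (apply Rinv_0_lt_compat; lra).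
  replace (/ (1 - u)) with (1 + u * / (1 - u)) by (field; lra).
  apply Rplus_le_compat_l. unfold Rdiv. apply Rmult_le_compat; lra.
Qed.

Lemma geom_sum_bound x M : 0 < x < 1 ->
  fold_right Rplus 0 (map (fun m => x ^ m) (seq 1 M)) <= / (1 - x).
Proof.
  intros Hx. assert (E : forall k M, (1 - x) * fold_right Rplus 0 (map (fun m => x ^ m) (seq k M)) = x ^ k - x ^ (k + M)).
  { intros k M'. revert k. induction M' as [|M' IH]; intros k; simpl.
    - rewrite Nat.add_0_r. ring.
    - rewrite Rmult_plus_distr_l, IH. rewrite Nat.add_succ_r. simpl. ring. }
  specialize (E 1%nat M). assert (0 < x ^ (1 + M)) by (apply pow_lt; lra). rewrite pow_1 in E.
  apply (Rmult_le_reg_l (1 - x)); [lra|]. rewrite E, Rinv_r by lra. lra.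
Qed.

Lemma Cmod_one_minus_real x s : 0 < 1 - x ^ s -> Cmod (Cminus (RtoC 1) (Cpow (RtoC x) s)) = 1 - x ^ s.
Proof.
  intros H. rewrite <- RtoC_pow, <- RtoC_minus, Cmod_R. apply Rabs_pos_eq. lra.
Qed.

Lemma Cmod_Cpowz_neg w k : w <> RtoC 0 -> Cmod (Cpowz w (- Z.abs k)) = (/ Cmod w) ^ Z.to_nat (Z.abs k).
Proof.
  intros Hw. assert (Cmod w <> 0) by (intros E; now apply Hw, Cmod_eq_0).
  destruct k as [|k|k]; simpl; try (rewrite Cmod_inv by (now apply Cpow_nz); rewrite Cmod_pow, pow_inv; reflexivity).
  apply Cmod_1.
Qed.

Lemma exp_INR_mult t n : exp (INR n * t) = exp t ^ n.
Proof.
  induction n as [|n IH]; [simpl; now rewrite Rmult_0_l, exp_0|].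
  rewrite S_INR, Rmult_plus_distr_r, exp_plus, IH, Rmult_1_l. simpl. ring.
Qed.

Lemma eta_trunc_bound N r x : 0 < x < 1 -> exists K, 0 < K /\ forall M,
  Cmod (eta_trunc N (fun n => - Z.abs (r n))%Z M (RtoC x)) <= K.
Proof.
  intros Hx. unfold eta_trunc. pose proof (divs_pos N) as Hp.
  induction (divs N) as [|n l IH].
  - exists 1. split; [lra|]. intros M. unfold Cprod. simpl. rewrite Cmod_1. lra.
  - destruct IH as [K [HK IH]]; [intros; apply Hp; now right|].
    specialize (Hp n (or_introl eq_refl)).
    set (c := INR (Z.to_nat (Z.abs (r n)))).
    exists (exp (c * / (1 - x) * / (1 - x)) * K). split; [apply Rmult_lt_0_compat; [apply exp_pos|easy]|].
    intros M. rewrite Cprod_cons, Cmod_mult. apply Rmult_le_compat; [apply Cmod_ge_0|apply Cmod_ge_0| |apply IH].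
    assert (Hi : 0 < / (1 - x)) by (apply Rinv_0_lt_compat; lra).
    apply (Rle_trans _ (exp (c * / (1 - x) * fold_right Rplus 0 (map (fun m => x ^ m) (seq 1 M))))).
    + assert (Hs : forall m, In m (seq 1 M) -> (0 < m)%nat) by (intros m Hm; apply in_seq in Hm; lia).
      induction (seq 1 M) as [|m ms IHm].
      * unfold Cprod. simpl. rewrite Cmod_1, Rmult_0_r, exp_0. lra.
      * rewrite Cprod_cons, Cmod_mult. simpl map. simpl fold_right. rewrite Rmult_plus_distr_l, exp_plus.
        apply Rmult_le_compat; [apply Cmod_ge_0|apply Cmod_ge_0| |apply IHm; intros; apply Hs; now right].
        specialize (Hs m (or_introl eq_refl)).
        destruct (inv_one_minus_bound x n m Hx Hp Hs) as [B1 B2].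
        rewrite Cmod_Cpowz_neg.
        -- rewrite Cmod_one_minus_real by easy.
           eapply Rle_trans; [apply pow_incr; split; [left; now apply Rinv_0_lt_compat|exact B2]|].
           rewrite <- exp_INR_mult. right. f_equal. unfold c, Rdiv. ring.
        -- intros E. apply (f_equal Cmod) in E. rewrite Cmod_one_minus_real, Cmod_0 in E by easy. lra.
    + destruct (Req_dec (c * / (1 - x) * fold_right Rplus 0 (map (fun m => x ^ m) (seq 1 M))) (c * / (1 - x) * / (1 - x))) as [->|Ne]; [lra|].
      left. apply exp_increasing. destruct (Rle_lt_or_eq_dec (c * / (1 - x) * fold_right Rplus 0 (map (fun m => x ^ m) (seq 1 M))) (c * / (1 - x) * / (1 - x))) as [|]; try easy.
      apply Rmult_le_compat_l; [|now apply geom_sum_bound].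
      apply Rmult_le_pos; [apply pos_INR|lra].
Qed.

Lemma series_term_le (a : nat -> R) l j : is_series a l -> (forall n, 0 <= a n) -> a j <= l.
Proof.
  intros H Ha. apply is_series_Reals in H. eapply Rle_trans; [|apply (sum_incr a j l H Ha)].
  destruct j as [|j]; [simpl; lra|]. simpl. pose proof (cond_pos_sum a j Ha). lra.
Qed.

Lemma series_abs_bound (a b : nat -> R) l B : is_series a l -> (forall n, Rabs (a n) <= b n) ->
  is_series b B -> Rabs l <= B.
Proof.
  intros Ha Hab Hb. rewrite <- (is_series_unique _ _ Ha), <- (is_series_unique _ _ Hb).
  assert (Eb : ex_series b) by (now exists B).
  eapply Rle_trans; [apply Series_Rabs; now apply (ex_series_abs_le _ b)|].
  apply Series_le; [|easy]. intros n. split; [apply Rabs_pos|apply Hab].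
Qed.

(** A coefficient estimate of Cauchy type: a single term of the nonnegative majorant at [x] is at
    most its whole sum, which is bounded independently of [M]. *)
Lemma eta_factors_bound N r x : 0 < x < 1 -> exists K, 0 < K /\ forall M j,
  Rabs (IZR (eta_factors N r M j)) * x ^ j <= K.
Proof.
  intros Hx. destruct (eta_trunc_bound N r x Hx) as [K [HK B]]. exists K. split; [easy|]. intros M j.
  assert (Hz : Cmod (RtoC x) < 1) by (rewrite Cmod_R, Rabs_pos_eq; lra).
  destruct (eta_factors_val N (fun n => - Z.abs (r n))%Z M (RtoC x) Hz) as [V _].
  apply Cis_series_iff in V. destruct V as [V _].
  set (v := eta_trunc _ _ _ _) in V.
  apply (Rle_trans _ (IZR (eta_factors N (fun n => - Z.abs (r n))%Z M j) * x ^ j)).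
  - apply Rmult_le_compat_r; [apply pow_le; lra|]. rewrite <- abs_IZR. apply IZR_le, eta_factors_dom.
  - apply (Rle_trans _ (Re v)).
    + apply (series_term_le (fun j => IZR (eta_factors N (fun n => - Z.abs (r n))%Z M j) * x ^ j)).
      * eapply is_series_ext; [|exact V]. intros n. simpl. rewrite <- RtoC_pow. simpl. ring.
      * intros n. apply Rmult_le_pos; [|apply pow_le; lra]. apply IZR_le.
        pose proof (eta_factors_dom N r M n). lia.
    + eapply Rle_trans; [apply Rle_abs|]. eapply Rle_trans; [apply Rabs_Re_le|]. apply B.
Qed.

Lemma is_lim_seq_geom_bound (u : nat -> R) (l c s : R) : 0 <= s < 1 ->
  (forall n, Rabs (u n - l) <= c * s ^ n) -> is_lim_seq u l.
Proof.
  intros Hs H.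
  assert (G : is_lim_seq (fun n => c * s ^ n) 0).
  { replace (Finite 0) with (Rbar_mult c 0) by (simpl; f_equal; ring).
    apply is_lim_seq_scal_l, is_lim_seq_geom. rewrite Rabs_pos_eq; lra. }
  apply (is_lim_seq_le_le (fun n => l - c * s ^ n) _ (fun n => l + c * s ^ n)).
  - intros n. specialize (H n). apply Rabs_le_between in H. lra.
  - replace (Finite l) with (Finite (l - 0)) by (f_equal; ring). apply is_lim_seq_minus'; [apply is_lim_seq_const|easy].
  - replace (Finite l) with (Finite (l + 0)) by (f_equal; ring). apply is_lim_seq_plus'; [apply is_lim_seq_const|easy].
Qed.

(** Componentwise, because [eta] is defined from separate limits of real and imaginary parts. *)
Definition Clim (u : nat -> C) (l : C) : Prop :=
  is_lim_seq (fun n => Re (u n)) (Re l) /\ is_lim_seq (fun n => Im (u n)) (Im l).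

(** The truncated product and the full series share their coefficients up to degree [M], and the
    uniform coefficient bound makes the difference of the tails geometrically small in [M]. *)
Lemma eta_trunc_lim N r z : Cmod z < 1 -> exists S : C,
  is_series (fun j => Cmult (RtoC (IZR (eta_coef N r j))) (Cpow z j)) S /\
  Clim (fun M => eta_trunc N r M z) S.
Proof.
  intros Hz. pose proof (Cmod_ge_0 z) as Hz0.
  set (x := (1 + Cmod z) / 2). assert (Hx : 0 < x < 1) by (unfold x; lra).
  destruct (eta_factors_bound N r x Hx) as [K [HK B]].
  (* Terms decay like [rho^j = s^j s^j]: for [j > M] one factor is at most [s^M] and gives the rate,
     the other makes the sum over [j] converge. *)
  set (rho := Cmod z / x). assert (Hrho : 0 <= rho < 1).
  { unfold rho. split; [apply Rdiv_le_0_compat; lra|]. apply (Rmult_lt_reg_r x); [lra|].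
    unfold Rdiv. rewrite Rmult_assoc, Rinv_l by lra. unfold x. lra. }
  set (s := sqrt rho). assert (Hs : 0 <= s < 1).
  { split; [apply sqrt_pos|]. unfold s. rewrite <- sqrt_1. apply sqrt_lt_1; lra. }
  assert (Es : s * s = rho) by (apply sqrt_sqrt; lra).
  assert (Bz : forall M j, Rabs (IZR (eta_factors N r M j)) * Cmod z ^ j <= K * (s ^ j * s ^ j)).
  { intros M j. rewrite <- Rpow_mult_distr, Es. replace (Cmod z) with (x * rho) by (unfold rho; field; lra).
    rewrite Rpow_mult_distr, <- Rmult_assoc. apply Rmult_le_compat_r; [apply pow_le; lra|apply B]. }
  assert (Be : forall j, Rabs (IZR (eta_coef N r j)) * Cmod z ^ j <= K * (s ^ j * s ^ j)).
  { intros j. rewrite <- (eta_factors_stable N r j j) by lia. apply Bz. }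
  destruct (Cex_series (fun j => Cmult (RtoC (IZR (eta_coef N r j))) (Cpow z j))) as [S HS].
  { apply (ex_series_le (K := R_AbsRing) (V := R_CompleteNormedModule) _ (fun j => K * (s * s) ^ j)).
    - intros j. change (Rabs (Cmod (Cmult (RtoC (IZR (eta_coef N r j))) (Cpow z j))) <= K * (s * s) ^ j).
      rewrite Rabs_pos_eq by apply Cmod_ge_0. rewrite Cmod_term, Rpow_mult_distr. apply Be.
    - apply (ex_series_scal_l (K := R_AbsRing) (V := R_NormedModule) K (fun j => (s * s) ^ j)), ex_series_geom. rewrite Es, Rabs_pos_eq; lra. }
  exists S. split; [exact HS|].
  assert (D : forall M, let v := Cminus (eta_trunc N r M z) S in
     Rabs (Re v) <= 2 * K * s ^ M * / (1 - s) /\ Rabs (Im v) <= 2 * K * s ^ M * / (1 - s)).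
  { intros M v.
    destruct (eta_factors_val N r M z Hz) as [V _].
    set (d := fun j => Cminus (Cmult (RtoC (IZR (eta_factors N r M j))) (Cpow z j))
                             (Cmult (RtoC (IZR (eta_coef N r j))) (Cpow z j))).
    assert (W : is_series d v) by exact (is_series_minus _ _ _ _ V HS).
    assert (Hd : forall j, Cmod (d j) <= 2 * K * s ^ M * s ^ j).
    { intros j. assert (P : 0 <= 2 * K * s ^ M * s ^ j) by (repeat apply Rmult_le_pos; try lra; apply pow_le; lra).
      destruct (Nat.le_gt_cases j M) as [Hj|Hj].
      - replace (d j) with (RtoC 0); [now rewrite Cmod_0|].
        unfold d. rewrite (eta_factors_stable N r j M Hj). ring.
      - unfold d. eapply Rle_trans.
        { unfold Cminus. eapply Rle_trans; [apply Cmod_triangle|]. rewrite Cmod_opp. apply Rle_refl. }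
        rewrite !Cmod_term. pose proof (Bz M j). pose proof (Be j).
        assert (s ^ j <= s ^ M) by (apply pow_decr; lra || lia).
        assert (0 <= s ^ j) by (apply pow_le; lra).
        assert (K * (s ^ j * s ^ j) <= K * (s ^ M * s ^ j)) by (apply Rmult_le_compat_l; [lra|]; now apply Rmult_le_compat_r).
        lra. }
    assert (Hb : is_series (fun j => 2 * K * s ^ M * s ^ j) (2 * K * s ^ M * / (1 - s))).
    { apply (is_series_scal_l (K := R_AbsRing) (V := R_NormedModule) (2 * K * s ^ M) (fun j => s ^ j)), is_series_geom. rewrite Rabs_pos_eq; lra. }
    apply Cis_series_iff in W. destruct W as [W1 W2].
    split; eapply series_abs_bound; [exact W1| |exact Hb|exact W2| |exact Hb].
    - intros j. eapply Rle_trans; [apply Rabs_Re_le|apply Hd].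
    - intros j. eapply Rle_trans; [apply Rabs_Im_le|apply Hd]. }
  split; apply (is_lim_seq_geom_bound _ _ (2 * K * / (1 - s)) s Hs); intros M; destruct (D M) as [D1 D2].
  - eapply Rle_trans; [|eapply Rle_trans; [exact D1|]]; [right; reflexivity|right; ring].
  - eapply Rle_trans; [|eapply Rle_trans; [exact D2|]]; [right; reflexivity|right; ring].
Qed.

Lemma Clim_unique u l l' : Clim u l -> Clim u l' -> l = l'.
Proof.
  intros [H1 H2] [H1' H2']. apply is_lim_seq_unique in H1, H2, H1', H2'.
  rewrite H1 in H1'. rewrite H2 in H2'. injection H1' as E1. injection H2' as E2.
  destruct l, l'. simpl in *. congruence.
Qed.

Lemma Clim_ext u v l : (forall n, u n = v n) -> Clim u l -> Clim v l.
Proof.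
  intros E [H1 H2]. split; [apply (is_lim_seq_ext (fun n => Re (u n)))|apply (is_lim_seq_ext (fun n => Im (u n)))];
  try easy; intros n; now rewrite E.
Qed.

Lemma Clim_const c : Clim (fun _ => c) c.
Proof. split; apply is_lim_seq_const. Qed.

Lemma Clim_mult u v l m : Clim u l -> Clim v m -> Clim (fun n => Cmult (u n) (v n)) (Cmult l m).
Proof.
  intros [U1 U2] [V1 V2]. split; simpl.
  - apply is_lim_seq_minus'; now apply is_lim_seq_mult'.
  - apply is_lim_seq_plus'; now apply is_lim_seq_mult'.
Qed.

Lemma Clim_inv u l : l <> RtoC 0 -> Clim u l -> Clim (fun n => Cinv (u n)) (Cinv l).
Proof.
  intros Hl [U1 U2].
  assert (D : is_lim_seq (fun n => Re (u n) ^ 2 + Im (u n) ^ 2) (Re l ^ 2 + Im l ^ 2)).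
  { replace (Re l ^ 2 + Im l ^ 2) with (Re l * Re l + Im l * Im l) by ring.
    apply (is_lim_seq_ext (fun n => Re (u n) * Re (u n) + Im (u n) * Im (u n))); [intros; ring|].
    apply is_lim_seq_plus'; now apply is_lim_seq_mult'. }
  assert (N0 : Re l ^ 2 + Im l ^ 2 <> 0).
  { intros E. apply Hl. destruct l as [a b]. simpl in *. assert (a = 0 /\ b = 0) as [-> ->] by nra. reflexivity. }
  split; simpl.
  - apply is_lim_seq_div'; easy.
  - apply is_lim_seq_div'; try easy. now apply (is_lim_seq_opp _ (Im l)).
Qed.

Lemma Clim_pow u l k : Clim u l -> Clim (fun n => Cpow (u n) k) (Cpow l k).
Proof. intros H. induction k as [|k IH]; [apply Clim_const|]. simpl. now apply Clim_mult. Qed.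

Lemma Clim_powz u l k : l <> RtoC 0 -> Clim u l -> Clim (fun n => Cpowz (u n) k) (Cpowz l k).
Proof.
  intros Hl H. destruct k as [|k|k]; simpl; [apply Clim_const|now apply Clim_pow|].
  apply Clim_inv; [now apply Cpow_nz|now apply Clim_pow].
Qed.

Lemma Clim_Cprod {A} (l : list A) (u : A -> nat -> C) v : (forall a, In a l -> Clim (u a) (v a)) ->
  Clim (fun n => Cprod l (fun a => u a n)) (Cprod l v).
Proof.
  induction l as [|a l IH]; intros H; [apply Clim_const|].
  rewrite Cprod_cons. apply (Clim_mult (u a) (fun n => Cprod l (fun a => u a n))).
  - apply H. now left.
  - apply IH. intros; apply H; now right.
Qed.

Lemma Cprod_ext {A} (l : list A) F G : (forall a, In a l -> F a = G a) -> Cprod l F = Cprod l G.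
Proof.
  induction l as [|a l IH]; intros H; [reflexivity|]. rewrite !Cprod_cons, (H a), IH; auto with datatypes.
Qed.

Lemma Cprod_mult {A} (l : list A) F G : Cprod l (fun a => Cmult (F a) (G a)) = Cmult (Cprod l F) (Cprod l G).
Proof. induction l as [|a l IH]; [unfold Cprod; simpl; ring|]. rewrite !Cprod_cons, IH. ring. Qed.

Lemma Cprod_neq_0 {A} (l : list A) F : (forall a, In a l -> F a <> RtoC 0) -> Cprod l F <> RtoC 0.
Proof.
  induction l as [|a l IH]; intros H; [intros E; apply RtoC_inj in E; lra|].
  rewrite Cprod_cons. apply Cmult_neq_0; [apply H; now left|apply IH; intros; apply H; now right].
Qed.

Lemma Cpowz_mult a b k : a <> RtoC 0 -> b <> RtoC 0 -> Cpowz (Cmult a b) k = Cmult (Cpowz a k) (Cpowz b k).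
Proof.
  intros Ha Hb. destruct k as [|k|k]; simpl; [ring|apply Cpow_mult_l|].
  rewrite Cpow_mult_l. field. split; now apply Cpow_nz.
Qed.

Lemma Cpowz_neq_0 a k : a <> RtoC 0 -> Cpowz a k <> RtoC 0.
Proof.
  intros Ha. assert (P : forall n, Cpow a n <> RtoC 0) by (intros; now apply Cpow_nz).
  destruct k as [|k|k]; simpl; [intros E; apply RtoC_inj in E; lra|easy|].
  intros E. apply (P (Pos.to_nat k)). rewrite <- (Cmult_1_r (Cpow a _)).
  rewrite <- (Cmult_1_l (Cmult _ _)). rewrite <- (Cinv_r (Cpow a (Pos.to_nat k))) at 1 by easy.
  rewrite E. ring.
Qed.

Lemma Cpowz_1_l k : Cpowz (RtoC 1) k = RtoC 1.
Proof.
  destruct k as [|k|k]; simpl; [easy|apply Cpow_1_l|]. rewrite Cpow_1_l. rewrite <- RtoC_inv, Rinv_1; lra || easy.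
Qed.

Lemma Cpowz_Cprod {A} (l : list A) F k : (forall a, In a l -> F a <> RtoC 0) ->
  Cpowz (Cprod l F) k = Cprod l (fun a => Cpowz (F a) k).
Proof.
  induction l as [|a l IH]; intros H; [apply Cpowz_1_l|].
  rewrite !Cprod_cons, Cpowz_mult, IH; [reflexivity| | |].
  - intros; apply H; now right.
  - apply H. now left.
  - apply Cprod_neq_0. intros; apply H; now right.
Qed.

(** * The exponential, nonvanishing of eta, and the q-expansion *)

Lemma cexp_plus a b : cexp (Cplus a b) = Cmult (cexp a) (cexp b).
Proof.
  unfold cexp, Cmult, Cplus. destruct a as [a1 a2], b as [b1 b2]. simpl.
  rewrite exp_plus, cos_plus, sin_plus. f_equal; ring.
Qed.

Lemma Cmod_cexp a : Cmod (cexp a) = exp (Re a).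
Proof.
  destruct a as [x y]. unfold Cmod, cexp. simpl.
  transitivity (sqrt (Rsqr (exp x))); [|apply sqrt_Rsqr; left; apply exp_pos].
  f_equal. pose proof (sin2_cos2 y) as H. unfold Rsqr in *.
  transitivity (exp x * exp x * (sin y * sin y + cos y * cos y)); [ring|].
  rewrite H. ring.
Qed.

Lemma ec_plus a b : ec (Cplus a b) = Cmult (ec a) (ec b).
Proof. unfold ec. rewrite <- cexp_plus. f_equal. ring. Qed.

Lemma ec_R x : ec (RtoC x) = e x.
Proof. unfold ec, e. f_equal. unfold Cmult, RtoC, Ci. simpl. f_equal; ring. Qed.

Lemma ec_0 : ec (RtoC 0) = RtoC 1.
Proof. rewrite ec_R. apply e_0. Qed.

Lemma Cmod_ec z : Cmod (ec z) = exp (- (2 * PI * Im z)).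
Proof.
  unfold ec. rewrite Cmod_cexp. f_equal. destruct z as [a b]. unfold Cmult, RtoC, Ci. simpl. ring.
Qed.

Lemma ec_neq_0 z : ec z <> RtoC 0.
Proof.
  intros E. apply (f_equal Cmod) in E. rewrite Cmod_ec, Cmod_0 in E.
  pose proof (exp_pos (- (2 * PI * Im z))). lra.
Qed.

Lemma ec_pow z n : Cpow (ec z) n = ec (Cmult (RtoC (INR n)) z).
Proof.
  induction n as [|n IH].
  - simpl. rewrite Cmult_0_l, ec_0. reflexivity.
  - rewrite Cpow_S, IH, <- ec_plus, S_INR, RtoC_plus. f_equal. ring.
Qed.

Lemma ec_powz z k : Cpowz (ec z) k = ec (Cmult (RtoC (IZR k)) z).
Proof.
  destruct k as [|k|k]; simpl Cpowz.
  - rewrite Cmult_0_l, ec_0. reflexivity.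
  - rewrite ec_pow, INR_IZR_INZ, positive_nat_Z. reflexivity.
  - rewrite ec_pow, INR_IZR_INZ, positive_nat_Z.
    assert (E : Cmult (ec (Cmult (RtoC (IZR (Zneg k))) z)) (ec (Cmult (RtoC (IZR (Zpos k))) z)) = RtoC 1).
    { rewrite <- ec_plus, <- Cmult_plus_distr_r, <- RtoC_plus, <- plus_IZR.
      replace (Zneg k + Zpos k)%Z with 0%Z by lia. rewrite Cmult_0_l. apply ec_0. }
    set (w := ec (Cmult (RtoC (IZR (Zpos k))) z)) in *. assert (w <> RtoC 0) by apply ec_neq_0.
    rewrite <- (Cmult_1_l (Cinv w)), <- E. field. easy.
Qed.

Lemma ec_lt1 tau : upper tau -> Cmod (ec tau) < 1.
Proof.
  unfold upper. intros H. rewrite Cmod_ec, <- exp_0. apply exp_increasing.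
  assert (0 < 2 * PI * Im tau); [|lra]. apply Rmult_lt_0_compat; [|easy]. pose proof PI_RGT_0. lra.
Qed.

(** The product of the inverse factors converges as well (exponent -1 at level 1), and the two
    limits multiply to 1, so neither is 0. *)
Lemma euler_product_lim z : Cmod z < 1 -> exists P : C, P <> RtoC 0 /\
  Clim (fun M => Cprod (seq 1 M) (fun m => Cminus (RtoC 1) (Cpow z m))) P.
Proof.
  intros Hz. destruct (eta_trunc_lim 1 (fun _ => 1%Z) z Hz) as [P [_ HP]].
  destruct (eta_trunc_lim 1 (fun _ => (-1)%Z) z Hz) as [P' [_ HP']].
  assert (NZ : forall M m, In m (seq 1 M) -> Cminus (RtoC 1) (Cpow z m) <> RtoC 0).
  { intros M m Hm. apply in_seq in Hm. apply one_minus_neq_0, Cmod_pow_lt1; [lia|easy]. }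
  assert (E1 : Clim (fun M => Cprod (seq 1 M) (fun m => Cminus (RtoC 1) (Cpow z m))) P).
  { eapply Clim_ext; [|exact HP]. intros M. unfold eta_trunc. change (divs 1) with [1%nat].
    rewrite Cprod_cons. unfold Cprod at 2. simpl fold_right. rewrite Cmult_1_r.
    apply Cprod_ext. intros m _. rewrite Nat.mul_1_l. simpl. ring. }
  exists P. split; [|exact E1]. intros E0.
  assert (E : Cmult P P' = RtoC 1).
  { apply (Clim_unique (fun M => Cmult (Cprod (seq 1 M) (fun m => Cminus (RtoC 1) (Cpow z m))) (eta_trunc 1 (fun _ => (-1)%Z) M z))).
    - now apply Clim_mult.
    - eapply Clim_ext; [|apply Clim_const]. intros M. unfold eta_trunc. change (divs 1) with [1%nat].
      rewrite Cprod_cons. unfold Cprod at 3. simpl fold_right. rewrite Cmult_1_r.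
      rewrite <- Cpowz_Cprod.
      + rewrite (Cprod_ext _ (fun m => Cminus (RtoC 1) (Cpow z (1 * m))) (fun m => Cminus (RtoC 1) (Cpow z m)))
          by (intros; now rewrite Nat.mul_1_l).
        simpl. rewrite Cmult_1_r, Cinv_r; [reflexivity|]. apply Cprod_neq_0, NZ.
      + intros m Hm. rewrite Nat.mul_1_l. now apply (NZ M). }
  rewrite E0, Cmult_0_l in E. apply RtoC_inj in E. lra.
Qed.

Lemma eta_eq tau : upper tau -> exists P : C, P <> RtoC 0 /\ eta tau = Cmult (ec (Cdiv tau (RtoC 24))) P /\
  Clim (fun M => Cprod (seq 1 M) (fun m => Cminus (RtoC 1) (Cpow (ec tau) m))) P.
Proof.
  intros Ht. destruct (euler_product_lim (ec tau) (ec_lt1 tau Ht)) as [P [NP HP]].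
  exists P. split; [easy|]. split; [|easy]. unfold eta. f_equal.
  assert (HP' : Clim (fun M => eta_partial M tau) P).
  { eapply Clim_ext; [|exact HP]. intros M. unfold eta_partial. apply Cprod_ext. intros m _. now rewrite ec_pow. }
  destruct HP' as [H1 H2]. apply is_lim_seq_unique in H1, H2. rewrite H1, H2. now destruct P.
Qed.

Lemma upper_scal n tau : (0 < n)%nat -> upper tau -> upper (Cmult (RtoC (INR n)) tau).
Proof.
  unfold upper. intros Hn Ht. destruct tau as [a b]. simpl in *.
  assert (0 < INR n) by (apply lt_0_INR; lia). nra.
Qed.

Lemma eta_neq_0 tau : upper tau -> eta tau <> RtoC 0.
Proof.
  intros Ht. destruct (eta_eq tau Ht) as [P (NP & -> & _)]. apply Cmult_neq_0; [apply ec_neq_0|easy].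
Qed.

Lemma eta_quot_neq_0 N r tau : upper tau -> eta_quot N r tau <> RtoC 0.
Proof.
  intros Ht. apply Cprod_neq_0. intros n Hn. apply Cpowz_neq_0, eta_neq_0, upper_scal; [|easy].
  now apply divs_pos in Hn.
Qed.

(** Choice over a finite list, by recursion with decidable equality; [b0] is the value off the
    list. *)
Lemma list_choice {A B} (l : list A) (P : A -> B -> Prop) (b0 : B) (dec : forall a b : A, {a = b} + {a <> b}) :
  (forall a, In a l -> exists b, P a b) -> exists f, forall a, In a l -> P a (f a).
Proof.
  induction l as [|a l IH]; intros H; [now exists (fun _ => b0)|].
  destruct IH as [f Hf]; [intros; apply H; now right|]. destruct (H a (or_introl eq_refl)) as [b Hb].
  exists (fun x => if dec x a then b else f x). intros x Hx. destruct (dec x a) as [->|Nx]; [easy|].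
  apply Hf. destruct Hx as [<-|]; easy.
Qed.

(** The truncated products have two limits to be identified: the power series of [eta_trunc_lim],
    and the product of the limits belonging to the single divisors, raised to the powers [r n]. *)
Lemma eta_quot_power_series N r tau : upper tau -> exists S : C,
  is_series (fun j => Cmult (RtoC (IZR (eta_coef N r j))) (Cpow (ec tau) j)) S /\
  eta_quot N r tau = Cmult (ec (Cmult (RtoC (IZR (xN N r) / 24)) tau)) S.
Proof.
  intros Ht. destruct (eta_trunc_lim N r (ec tau) (ec_lt1 tau Ht)) as [S [HS HL]].
  exists S. split; [exact HS|].
  destruct (list_choice (divs N) (fun n P => P <> RtoC 0 /\
     eta (Cmult (RtoC (INR n)) tau) = Cmult (ec (Cdiv (Cmult (RtoC (INR n)) tau) (RtoC 24))) P /\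
     Clim (fun M => Cprod (seq 1 M) (fun m => Cminus (RtoC 1) (Cpow (ec tau) (n * m)))) P) (RtoC 0) Nat.eq_dec) as [P HP].
  { intros n Hn. apply divs_pos in Hn.
    destruct (eta_eq _ (upper_scal n tau Hn Ht)) as [P (P1 & P2 & P3)]. exists P. split; [easy|]. split; [easy|].
    eapply Clim_ext; [|exact P3]. intros M. apply Cprod_ext. intros m _.
    now rewrite <- ec_pow, <- Cpow_mult_r. }
  assert (ES : S = Cprod (divs N) (fun n => Cpowz (P n) (r n))).
  { apply (Clim_unique _ _ _ HL).
    eapply Clim_ext; [|apply (Clim_Cprod (divs N) (fun n M => Cpowz (Cprod (seq 1 M) (fun m => Cminus (RtoC 1) (Cpow (ec tau) (n * m)))) (r n)) (fun n => Cpowz (P n) (r n)))].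
    - intros M. unfold eta_trunc. apply Cprod_ext. intros n Hn. apply Cpowz_Cprod. intros m Hm.
      apply in_seq in Hm. apply divs_pos in Hn. apply one_minus_neq_0, Cmod_pow_lt1; [nia|now apply ec_lt1].
    - intros n Hn. destruct (HP n Hn) as (P1 & _ & P3). now apply Clim_powz. }
  unfold eta_quot. rewrite ES.
  transitivity (Cprod (divs N) (fun n => Cmult (ec (Cmult (RtoC (IZR (Z.of_nat n * r n) / 24)) tau)) (Cpowz (P n) (r n)))).
  - apply Cprod_ext. intros n Hn. destruct (HP n Hn) as (P1 & -> & _).
    rewrite Cpowz_mult by (easy || apply ec_neq_0). f_equal. rewrite ec_powz. f_equal.
    rewrite mult_IZR, <- INR_IZR_INZ. unfold Rdiv. rewrite !RtoC_mult, RtoC_inv by lra. unfold Cdiv. ring.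
  - rewrite Cprod_mult. f_equal. unfold xN.
    clear. induction (divs N) as [|n l IH].
    + unfold Cprod, Zsum. simpl. replace (0 / 24) with 0 by field. rewrite Cmult_0_l, ec_0. reflexivity.
    + rewrite Cprod_cons, Zsum_cons, IH, <- ec_plus. f_equal. rewrite plus_IZR.
      unfold Rdiv. rewrite Rmult_plus_distr_r, RtoC_plus. ring.
Qed.

Lemma eta_quot_series N r tau : upper tau ->
  is_series (fun j => Cmult (RtoC (IZR (eta_coef N r j)))
     (ec (Cmult (RtoC (IZR (xN N r + 24 * Z.of_nat j) / 24)) tau))) (eta_quot N r tau).
Proof.
  intros Ht. destruct (eta_quot_power_series N r tau Ht) as [S [HS ->]].
  eapply is_series_ext; [|exact (is_series_scal (ec (Cmult (RtoC (IZR (xN N r) / 24)) tau)) _ _ HS)].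
  intros j. match goal with |- ?a = ?b => change (Cmult (ec (Cmult (RtoC (IZR (xN N r) / 24)) tau)) (Cmult (RtoC (IZR (eta_coef N r j))) (Cpow (ec tau) j)) = b) end.
  rewrite ec_pow. replace (IZR (xN N r + 24 * Z.of_nat j) / 24)%R with (IZR (xN N r) / 24 + INR j)%R.
  - rewrite RtoC_plus, Cmult_plus_distr_r, ec_plus. eqC. ring.
  - rewrite plus_IZR, mult_IZR, <- INR_IZR_INZ. field.
Qed.

Lemma eta_coef_0 N r : eta_coef N r 0 = 1%Z.
Proof.
  unfold eta_coef. simpl seq. simpl map.
  induction (divs N) as [|n l IH]; [reflexivity|]. simpl flat_map. exact IH.
Qed.

(** * Moebius transformations and the invariant quotient *)

Definition den (c d : Z) (tau : C) : C := Cplus (Cmult (RtoC (IZR c)) tau) (RtoC (IZR d)).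

Lemma den_neq_0 c d tau : upper tau -> (c <> 0 \/ d <> 0)%Z -> den c d tau <> RtoC 0.
Proof.
  unfold upper, den. destruct tau as [x y]. simpl. intros Hy H E. unfold Cplus, Cmult, RtoC in E. simpl in E.
  injection E as E1 E2. ring_simplify in E1. ring_simplify in E2.
  assert (IZR c = 0) by (apply Rmult_integral in E2; lra). apply eq_IZR in H0. subst c.
  assert (IZR d = 0) by lra. apply eq_IZR in H0. lia.
Qed.

Lemma mob_den a b c d tau : mob a b c d tau = Cdiv (den a b tau) (den c d tau).
Proof. reflexivity. Qed.

Lemma upper_mob a b c d tau : (0 < a * d - b * c)%Z -> upper tau -> upper (mob a b c d tau).
Proof.
  intros Hdet Ht. assert (N0 : den c d tau <> RtoC 0) by (apply den_neq_0; [easy|nia]).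
  unfold upper in *. rewrite mob_den. unfold den in *. destruct tau as [x y]. simpl in *.
  set (u := IZR c * x - 0 * y + IZR d). set (v := IZR c * y + 0 * x + 0).
  assert (Hn : 0 < u * (u * 1) + v * (v * 1)).
  { assert (P : 0 <= u * (u * 1) + v * (v * 1)) by nra. destruct P as [P|P]; [easy|]. exfalso. apply N0.
    assert (u = 0 /\ v = 0) as [E1 E2] by nra. unfold Cplus, Cmult, RtoC. simpl. fold u v. now rewrite E1, E2. }
  match goal with |- 0 < ?t => replace t with (IZR (a * d - b * c) * y / (u * (u * 1) + v * (v * 1))) end.
  - apply Rdiv_lt_0_compat; [|easy]. apply Rmult_lt_0_compat; [|easy]. now apply IZR_lt.
  - rewrite minus_IZR, !mult_IZR. field_simplify; try lra. f_equal. unfold u, v. ring.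
Qed.

Lemma mob_comp a b c d a' b' c' d' tau : upper tau -> (0 < a' * d' - b' * c')%Z -> (0 < a * d - b * c)%Z ->
  mob a b c d (mob a' b' c' d' tau) = mob (a * a' + b * c') (a * b' + b * d') (c * a' + d * c') (c * b' + d * d') tau.
Proof.
  intros Ht D' D. assert (N1 : den c' d' tau <> RtoC 0) by (apply den_neq_0; [easy|nia]).
  assert (N2 : den (c * a' + d * c') (c * b' + d * d') tau <> RtoC 0).
  { apply den_neq_0; [easy|]. destruct (Z.eq_dec (c * a' + d * c') 0) as [E1|]; [|now left].
    destruct (Z.eq_dec (c * b' + d * d') 0) as [E2|]; [|now right]. exfalso.
    assert (c * (a' * d' - b' * c') = 0)%Z by (replace (c * (a' * d' - b' * c'))%Z with (d' * (c * a' + d * c') - c' * (c * b' + d * d'))%Z by ring; rewrite E1, E2; ring).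
    assert (d * (a' * d' - b' * c') = 0)%Z by (replace (d * (a' * d' - b' * c'))%Z with (a' * (c * b' + d * d') - b' * (c * a' + d * c'))%Z by ring; rewrite E1, E2; ring).
    assert (c = 0)%Z by (apply Z.mul_eq_0 in H; lia). assert (d = 0)%Z by (apply Z.mul_eq_0 in H0; lia). subst. lia. }
  rewrite !mob_den. unfold den in *.
  assert (E2 : Cplus (Cmult (RtoC (IZR c)) (Cplus (Cmult (RtoC (IZR a')) tau) (RtoC (IZR b')))) (Cmult (RtoC (IZR d)) (Cplus (Cmult (RtoC (IZR c')) tau) (RtoC (IZR d')))) <> RtoC 0).
  { intros E. apply N2. rewrite <- E. rewrite !plus_IZR, !mult_IZR, !RtoC_plus, !RtoC_mult. ring. }
  rewrite !plus_IZR, !mult_IZR, !RtoC_plus, !RtoC_mult. field. split; [|easy].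
  intros E. apply N2. rewrite <- E. rewrite !plus_IZR, !mult_IZR, !RtoC_plus, !RtoC_mult. ring.
Qed.

Lemma csqrt_neq_0 z : z <> RtoC 0 -> csqrt z <> RtoC 0.
Proof.
  intros Hz E. apply Hz. apply Cmod_eq_0. unfold csqrt in E. injection E as E1 E2.
  assert (B := Rabs_Re_le z). apply Rabs_le_between in B.
  assert (E2' : sqrt ((Cmod z - Re z) / 2) = 0) by (destruct (Rlt_dec (Im z) 0); lra).
  apply sqrt_eq_0 in E1, E2'; lra.
Qed.

(** Positive scaling does not change the branch. This is the compatibility of the root used in
    [hquot_rep] and [hecke_term_qexp]. *)
Lemma csqrt_scal t z : 0 < t -> csqrt (Cmult (RtoC t) z) = Cmult (RtoC (sqrt t)) (csqrt z).
Proof.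
  intros Ht. unfold csqrt. rewrite Cmod_mult, Cmod_R, Rabs_pos_eq by lra.
  replace (Re (Cmult (RtoC t) z)) with (t * Re z) by (destruct z; simpl; ring).
  replace (Im (Cmult (RtoC t) z)) with (t * Im z) by (destruct z; simpl; ring).
  replace ((t * Cmod z + t * Re z) / 2) with (t * ((Cmod z + Re z) / 2)) by field.
  replace ((t * Cmod z - t * Re z) / 2) with (t * ((Cmod z - Re z) / 2)) by field.
  rewrite !sqrt_mult_alt by lra. unfold Cmult, RtoC. simpl.
  destruct (Rlt_dec (t * Im z) 0), (Rlt_dec (Im z) 0); try (exfalso; nra); f_equal; ring.
Qed.

Lemma Cpowz_sqrt t k : 0 < t -> Cpowz (RtoC (sqrt t)) k = RtoC (Rpower t (IZR k / 2)).
Proof.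
  intros Ht. assert (Hs : 0 < sqrt t) by now apply sqrt_lt_R0.
  assert (P : forall n, Cpow (RtoC (sqrt t)) n = RtoC (Rpower t (INR n / 2))).
  { intros n. rewrite <- RtoC_pow, <- Rpower_pow by easy. rewrite <- Rpower_sqrt by easy.
    rewrite Rpower_mult. f_equal. f_equal. field. }
  destruct k as [|k|k]; simpl Cpowz.
  - replace (0 / 2) with 0 by field. now rewrite Rpower_O.
  - rewrite P, INR_IZR_INZ, positive_nat_Z. reflexivity.
  - rewrite P, INR_IZR_INZ, positive_nat_Z, <- RtoC_inv by (apply Rgt_not_eq, exp_pos).
    rewrite <- Rpower_Ropp. f_equal. f_equal. change (Zneg k) with (- Zpos k)%Z. rewrite opp_IZR. field.
Qed.

Lemma Cpowz_opp a k : a <> RtoC 0 -> Cmult (Cpowz a (- k)) (Cpowz a k) = RtoC 1.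
Proof.
  intros Ha. assert (P : forall n, Cpow a n <> RtoC 0) by (intros; now apply Cpow_nz).
  destruct k as [|k|k]; simpl; [ring|now apply Cinv_l|now apply Cinv_r].
Qed.

(** The automorphy factor; [k] is twice the weight. *)
Definition Jfac (k c d : Z) (tau : C) : C := Cpowz (csqrt (den c d tau)) k.

Lemma Jfac_neq_0 k c d tau : upper tau -> (c <> 0 \/ d <> 0)%Z -> Jfac k c d tau <> RtoC 0.
Proof. intros. now apply Cpowz_neq_0, csqrt_neq_0, den_neq_0. Qed.

Lemma mod_form_transform N r cusp g a b c d tau : is_mod_form N (k2 N r) (chi N r) cusp g ->
  (a * d - b * c = 1)%Z -> (Z.of_nat N | c)%Z -> upper tau ->
  g (mob a b c d tau) = Cmult (Cmult (chi N r a b c d 1) (Jfac (k2 N r) c d tau)) (g tau).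
Proof.
  intros (_ & H & _) Hdet Hc Ht. specialize (H a b c d 1%Z Hdet Hc (or_introl eq_refl) tau Ht).
  unfold slash in H. rewrite Cmult_1_l in H. fold (den c d tau) in H.
  assert (N0 : csqrt (den c d tau) <> RtoC 0) by (apply csqrt_neq_0, den_neq_0; [easy|nia]).
  pose proof (Cpowz_opp _ (k2 N r) N0) as E. unfold Jfac.
  transitivity (Cmult (Cmult (Cpowz (csqrt (den c d tau)) (- k2 N r)) (Cpowz (csqrt (den c d tau)) (k2 N r))) (g (mob a b c d tau))).
  - rewrite E. ring.
  - replace (Cmult (Cmult (Cpowz (csqrt (den c d tau)) (- k2 N r)) (Cpowz (csqrt (den c d tau)) (k2 N r))) (g (mob a b c d tau)))
      with (Cmult (Cpowz (csqrt (den c d tau)) (k2 N r)) (Cmult (Cpowz (csqrt (den c d tau)) (- k2 N r)) (g (mob a b c d tau)))) by ring.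
    rewrite H. ring.
Qed.

Lemma upper_plus_R tau x : upper tau -> upper (Cplus tau (RtoC x)).
Proof. unfold upper. destruct tau. simpl. lra. Qed.

Lemma eta_quot_shift N r tau b : upper tau ->
  eta_quot N r (Cplus tau (RtoC (IZR b))) = Cmult (e24 (b * xN N r)) (eta_quot N r tau).
Proof.
  intros Ht. eapply Cis_series_unique; [apply eta_quot_series; now apply upper_plus_R|].
  eapply is_series_ext; [|exact (is_series_scal (e24 (b * xN N r)) _ _ (eta_quot_series N r tau Ht))].
  intros j. match goal with |- _ = ?t => change (Cmult (e24 (b * xN N r)) (Cmult (RtoC (IZR (eta_coef N r j)))
     (ec (Cmult (RtoC (IZR (xN N r + 24 * Z.of_nat j) / 24)) tau))) = t) end.
  rewrite Cmult_plus_distr_l, ec_plus, <- RtoC_mult, ec_R.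
  replace (e (IZR (xN N r + 24 * Z.of_nat j) / 24 * IZR b)) with (e24 (b * xN N r)); [eqC; ring|].
  rewrite <- (e24_eq (b * (xN N r + 24 * Z.of_nat j))) by (exists (b * Z.of_nat j)%Z; ring).
  unfold e24. f_equal. rewrite mult_IZR. field.
Qed.

Lemma in_Lf_pos N r l : in_Lf N r l -> (0 < l)%Z.
Proof. intros [H _]. lia. Qed.

Section Invariance.
Variables (N : nat) (r : nat -> Z) (l : Z) (cusp : bool).
Hypothesis HN : (0 < N)%nat.
Hypothesis Hl : in_Lf N r l.
Hypothesis Hf : is_mod_form N (k2 N r) (chi N r) cusp (eta_quot N r).

(* [hecke / eta_quot] is the trace of [hquot] from [l | b] to the whole of [Gamma_0(N)]. *)
Definition hquot (tau : C) : C := Cdiv (eta_quot N r (mob 1 0 0 l tau)) (eta_quot N r tau).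

Lemma RtoC_neq_0 x : x <> 0 -> RtoC x <> RtoC 0.
Proof. intros H E. apply RtoC_inj in E. easy. Qed.

Lemma hquot_shift tau i : upper tau -> hquot (Cplus tau (RtoC (IZR (l * i)))) = hquot tau.
Proof.
  intros Ht. pose proof (in_Lf_pos N r l Hl) as Pl. assert (L0 : RtoC (IZR l) <> RtoC 0) by (apply RtoC_neq_0, eq_IZR_contrapositive; lia).
  unfold hquot.
  replace (mob 1 0 0 l (Cplus tau (RtoC (IZR (l * i))))) with (Cplus (mob 1 0 0 l tau) (RtoC (IZR i))).
  2:{ unfold mob. rewrite mult_IZR, RtoC_mult. simpl. field. intros E. apply L0. rewrite <- E. ring. }
  rewrite !eta_quot_shift; [|easy|apply upper_mob; [lia|easy]].
  replace (e24 (l * i * xN N r)) with (e24 (i * xN N r)).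
  - field. split; [now apply eta_quot_neq_0|apply e24_neq_0].
  - apply e24_eq. destruct (in_Lf_divide N r l Hl) as [[u Hu] _]. exists (- i * u)%Z.
    replace (i * xN N r - l * i * xN N r)%Z with (- i * (xN N r * (l - 1)))%Z by ring. rewrite Hu. ring.
Qed.

(** The additive parts of the two exponents differ by multiples of [x (l - 1)] and [y (l - 1)]. The
    symbols differ by that of [l] over [d]: it is 1 if [l] is a square, and otherwise enters with an
    even multiple of 6 times a difference of signs. *)
Lemma chi_conjugate a b c d : (0 < c)%Z -> (0 < d)%Z -> Z.gcd d 6 = 1%Z ->
  (a * d - (l * b) * (Z.of_nat N * c) = 1)%Z ->
  chi N r a b (Z.of_nat N * (l * c)) d 1 = chi N r a (l * b) (Z.of_nat N * c) d 1.
Proof.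
  intros Hc Hd H6 Hdet. pose proof (in_Lf_pos N r l Hl) as Pl. destruct (gcd6 d H6) as (Od & _).
  rewrite !chi_nice by (easy || nia). apply e24_eq.
  assert (Gc : Z.gcd c d = 1%Z) by (apply Z.bezout_1_gcd; exists (- l * b * Z.of_nat N)%Z, a; lia).
  assert (Gl : Z.gcd l d = 1%Z) by (apply Z.bezout_1_gcd; exists (- b * Z.of_nat N * c)%Z, a; lia).
  rewrite gauss_mul by easy.
  destruct (in_Lf_divide N r l Hl) as [[u Hu] [v Hv]].
  assert (K : exists w, (6 * k2 N r * (gauss c d - gauss l d * gauss c d) = 24 * w)%Z).
  { destruct (Z.odd (k2 N r)) eqn:Ok.
    - destruct Hl as (_ & _ & Hsq). destruct (Hsq Ok) as [t Ht].
      assert (Gt : Z.gcd t d = 1%Z).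
      { rewrite Z.gcd_comm. apply (gcd_divide_1 _ l); [now rewrite Z.gcd_comm|now exists t]. }
      rewrite Ht, gauss_sq by easy. exists 0%Z. ring.
    - destruct (even_ex _ Ok) as [k ->].
      destruct (gauss_pm c d) as [-> | ->], (gauss_pm l d) as [-> | ->]; [exists 0%Z|exists k|exists 0%Z|exists (- k)%Z]; ring. }
  destruct K as [w Hw]. exists (- d * b * u - d * c * v + w)%Z.
  replace ((- d * b * u - d * c * v + w) * 24)%Z with (- d * b * (u * 24) - d * c * (v * 24) + 24 * w)%Z by ring.
  rewrite <- Hu, <- Hv, <- Hw. ring.
Qed.

Lemma hquot_invariant_nice a b c d tau : (0 < c)%Z -> (0 < d)%Z -> Z.gcd d 6 = 1%Z ->
  (a * d - (l * b) * (Z.of_nat N * c) = 1)%Z -> upper tau ->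
  hquot (mob a (l * b) (Z.of_nat N * c) d tau) = hquot tau.
Proof.
  intros Hc Hd H6 Hdet Ht. pose proof (in_Lf_pos N r l Hl) as Pl. unfold hquot.
  assert (L0 : RtoC (IZR l) <> RtoC 0) by (apply RtoC_neq_0, eq_IZR_contrapositive; lia).
  assert (E : mob 1 0 0 l (mob a (l * b) (Z.of_nat N * c) d tau) = mob a b (Z.of_nat N * (l * c)) d (mob 1 0 0 l tau)).
  { rewrite !mob_comp by (easy || lia).
    assert (N1 : den (Z.of_nat N * c) d tau <> RtoC 0) by (apply den_neq_0; [easy|lia]).
    rewrite !mob_den. unfold den in *. 
    replace (1 * a + 0 * (Z.of_nat N * c))%Z with a by ring. replace (1 * (l * b) + 0 * d)%Z with (l * b)%Z by ring.
    replace (0 * a + l * (Z.of_nat N * c))%Z with (l * (Z.of_nat N * c))%Z by ring.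
    replace (0 * (l * b) + l * d)%Z with (l * d)%Z by ring.
    replace (a * 1 + b * 0)%Z with a by ring. replace (a * 0 + b * l)%Z with (l * b)%Z by ring.
    replace (Z.of_nat N * (l * c) * 1 + d * 0)%Z with (l * (Z.of_nat N * c))%Z by ring.
    replace (Z.of_nat N * (l * c) * 0 + d * l)%Z with (l * d)%Z by ring. reflexivity. }
  rewrite E. assert (Um : upper (mob 1 0 0 l tau)) by (apply upper_mob; [lia|easy]).
  rewrite (mod_form_transform N r cusp (eta_quot N r) a b (Z.of_nat N * (l * c)) d _ Hf ltac:(lia) (Z.divide_factor_l _ _) Um).
  rewrite (mod_form_transform N r cusp (eta_quot N r) a (l * b) (Z.of_nat N * c) d tau Hf Hdet (Z.divide_factor_l _ _) Ht).
  rewrite chi_conjugate by easy.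
  (* [N l c (tau / l) + d = N c tau + d], so the two square roots are the same number and cancel
     whatever the branch. *)
  replace (Jfac (k2 N r) (Z.of_nat N * (l * c)) d (mob 1 0 0 l tau)) with (Jfac (k2 N r) (Z.of_nat N * c) d tau).
  2:{ unfold Jfac. f_equal. f_equal. unfold den, mob. rewrite !mult_IZR, !RtoC_mult. simpl. field. intros E'. apply L0. rewrite <- E'. ring. }
  assert (X0 : chi N r a (l * b) (Z.of_nat N * c) d 1 <> RtoC 0).
  { rewrite chi_nice by easy. apply e24_neq_0. }
  assert (J0 : Jfac (k2 N r) (Z.of_nat N * c) d tau <> RtoC 0) by (apply Jfac_neq_0; [easy|lia]).
  field. repeat split; try assumption; now apply eta_quot_neq_0.
Qed.

Lemma mob_opp a b c d tau : upper tau -> (a * d - b * c = 1)%Z -> mob (- a) (- b) (- c) (- d) tau = mob a b c d tau.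
Proof.
  intros Ht Hdet. assert (N1 : den c d tau <> RtoC 0) by (apply den_neq_0; [easy|nia]).
  unfold den in N1. unfold mob. rewrite !opp_IZR, !RtoC_opp. field. split; [easy|].
  intros E. apply N1. replace (RtoC 0) with (Copp (RtoC 0)) by ring. rewrite <- E. ring.
Qed.

Lemma mob_translate b tau : mob 1 b 0 1 tau = Cplus tau (RtoC (IZR b)).
Proof.
  unfold mob, Cdiv. replace (Cinv (Cplus (Cmult (RtoC 0) tau) (RtoC 1))) with (RtoC 1); [ring|].
  rewrite Cmult_0_l, Cplus_0_l, <- RtoC_inv, Rinv_1; [reflexivity|lra].
Qed.

(** For [c > 0], a translation by a multiple of [l], under which [hquot] is invariant, changes [d]
    by a multiple of [c l] and so reaches the case already treated. For [c < 0] negate the matrix;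
    for [c = 0] it acts as such a translation. *)
Lemma hquot_invariant a b c d tau : (a * d - b * c = 1)%Z -> (Z.of_nat N | c)%Z -> (l | b)%Z ->
  upper tau -> hquot (mob a b c d tau) = hquot tau.
Proof.
  intros Hdet HNc Hlb Ht. pose proof (in_Lf_pos N r l Hl) as Pl.
  assert (P : forall a b c d, (a * d - b * c = 1)%Z -> (Z.of_nat N | c)%Z -> (l | b)%Z -> (0 < c)%Z ->
    hquot (mob a b c d tau) = hquot tau).
  { clear a b c d Hdet HNc Hlb. intros a b c d Hdet [c' Hc'] [b' Hb'] Hc.
    (* The fixed shift by [|d| + 1] steps makes the entry positive; the further [i0] steps make it
       prime to 6. *)
    destruct (coprime_shift 6 ltac:(lia) (d + c * l * (Z.abs d + 1))%Z (c * l)%Z) as [i0 [Hi0 Gi]].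
    { replace (Z.gcd (d + c * l * (Z.abs d + 1)) (c * l)) with 1%Z; [reflexivity|]. symmetry.
      apply Z.bezout_1_gcd. exists a, (- b' - a * (Z.abs d + 1))%Z. rewrite <- Hdet, Hb'. ring. }
    set (i := (Z.abs d + 1 + i0)%Z).
    assert (Ei : (d + c * l * (Z.abs d + 1) + c * l * i0 = d + c * (l * i))%Z) by (unfold i; ring). rewrite Ei in Gi.
    assert (Pd : (0 < d + c * (l * i))%Z).
    { unfold i. assert (1 <= c * l)%Z by nia. nia. }
    set (tau' := Cplus tau (RtoC (IZR (l * (- i))))).
    assert (Ht' : upper tau') by now apply upper_plus_R.
    assert (Es : tau = Cplus tau' (RtoC (IZR (l * i)))).
    { unfold tau'. replace (l * - i)%Z with (- (l * i))%Z by ring. rewrite opp_IZR, RtoC_opp. ring. }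
    rewrite <- (hquot_shift tau (- i)) by easy. fold tau'.
    rewrite <- (hquot_invariant_nice a (b' + a * i) c' (d + c * (l * i)) tau'); try easy; try nia.
    - f_equal. replace (Z.of_nat N * c')%Z with c by lia.
      transitivity (mob a b c d (mob 1 (l * i) 0 1 tau')).
      + rewrite mob_translate, <- Es. reflexivity.
      + rewrite mob_comp by (easy || lia). f_equal; rewrite ?Hb'; ring. }
  destruct (Z.lt_trichotomy c 0) as [Hc|[Hc|Hc]]; [| |now apply P].
  - rewrite <- mob_opp by easy. apply P; try lia; now apply Z.divide_opp_r.
  - destruct Hlb as [b' Hb']. rewrite Hc in *. assert (a = 1 /\ d = 1 \/ a = -1 /\ d = -1)%Z as [[-> ->]|[-> ->]].
    { assert (E : (a * d = 1)%Z) by lia. apply Z.eq_mul_1 in E as E'. destruct E' as [-> | ->]; lia. }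
    + rewrite <- (hquot_shift tau b') by easy. f_equal. rewrite Hb', mob_translate, Z.mul_comm. reflexivity.
    + rewrite <- mob_opp by (easy || lia). rewrite <- (hquot_shift tau (- b')) by easy. f_equal.
      rewrite Hb'. change (- (-1))%Z with 1%Z. change (- (0))%Z with 0%Z. rewrite mob_translate. f_equal. f_equal. f_equal. ring.
Qed.

(** The first matrix times the inverse of the second has upper right entry [b a' - a b']. So only
    the top row modulo [l], up to proportionality, matters: a point of the projective line modulo
    [l]. *)
Lemma hquot_coset a b c d a' b' c' d' tau : (a * d - b * c = 1)%Z -> (a' * d' - b' * c' = 1)%Z ->
  (Z.of_nat N | c)%Z -> (Z.of_nat N | c')%Z -> (l | a * b' - a' * b)%Z -> upper tau ->
  hquot (mob a b c d tau) = hquot (mob a' b' c' d' tau).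
Proof.
  intros D D' Hc Hc' Hd Ht.
  assert (Ut : upper (mob a' b' c' d' tau)) by (apply upper_mob; [lia|easy]).
  rewrite <- (hquot_invariant (a * d' - b * c') (- a * b' + b * a') (c * d' - d * c') (- c * b' + d * a') (mob a' b' c' d' tau)); try easy.
  - f_equal. rewrite mob_comp; try lia; try easy.
    + f_equal.
      * replace ((a * d' - b * c') * a' + (- a * b' + b * a') * c')%Z with (a * (a' * d' - b' * c'))%Z by ring. rewrite D'. ring.
      * replace ((a * d' - b * c') * b' + (- a * b' + b * a') * d')%Z with (b * (a' * d' - b' * c'))%Z by ring. rewrite D'. ring.
      * replace ((c * d' - d * c') * a' + (- c * b' + d * a') * c')%Z with (c * (a' * d' - b' * c'))%Z by ring. rewrite D'. ring.
      * replace ((c * d' - d * c') * b' + (- c * b' + d * a') * d')%Z with (d * (a' * d' - b' * c'))%Z by ring. rewrite D'. ring.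
    + replace ((a * d' - b * c') * (- c * b' + d * a') - (- a * b' + b * a') * (c * d' - d * c'))%Z
        with ((a * d - b * c) * (a' * d' - b' * c'))%Z by ring. rewrite D, D'. lia.
  - replace ((a * d' - b * c') * (- c * b' + d * a') - (- a * b' + b * a') * (c * d' - d * c'))%Z
        with ((a * d - b * c) * (a' * d' - b' * c'))%Z by ring. rewrite D, D'. reflexivity.
  - apply Z.divide_sub_r; [now apply Z.divide_mul_l|now apply Z.divide_mul_r].
  - replace (- a * b' + b * a')%Z with (- (a * b' - a' * b))%Z by ring. now apply Z.divide_opp_r.
Qed.

End Invariance.

(** * Cosets and the Hecke-type sum *)

Lemma Csum_cons {A} (a : A) l F : Csum (a :: l) F = Cplus (F a) (Csum l F).
Proof. reflexivity. Qed.

Lemma Csum_app {A} (l1 l2 : list A) F : Csum (l1 ++ l2) F = Cplus (Csum l1 F) (Csum l2 F).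
Proof.
  induction l1 as [|a l1 IH]; [unfold Csum at 2; simpl; ring|]. simpl app. rewrite !Csum_cons, IH. ring.
Qed.

Lemma Csum_ext {A} (l : list A) F G : (forall a, In a l -> F a = G a) -> Csum l F = Csum l G.
Proof.
  induction l as [|a l IH]; intros H; [reflexivity|]. rewrite !Csum_cons, (H a), IH; auto with datatypes.
Qed.

Lemma Csum_scal {A} (l : list A) c F : Csum l (fun a => Cmult c (F a)) = Cmult c (Csum l F).
Proof. induction l as [|a l IH]; [unfold Csum; simpl; ring|]. rewrite !Csum_cons, IH. ring. Qed.

Lemma Csum_map {A B} (g : A -> B) l F : Csum (map g l) F = Csum l (fun a => F (g a)).
Proof. unfold Csum. now rewrite map_map. Qed.

Lemma Csum_flat_map {A B} (g : A -> list B) l F : Csum (flat_map g l) F = Csum l (fun a => Csum (g a) F).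
Proof. induction l as [|a l IH]; [reflexivity|]. simpl flat_map. now rewrite Csum_app, Csum_cons, IH. Qed.

Lemma Csum_perm {A} (l l' : list A) F : Permutation l l' -> Csum l F = Csum l' F.
Proof.
  induction 1; rewrite ?Csum_cons.
  - reflexivity.
  - now rewrite IHPermutation.
  - ring.
  - now rewrite IHPermutation1.
Qed.

Definition coset_a (N : nat) (l : Z) : list Z :=
  filter (fun a => Z.eqb (Z.gcd a (Z.of_nat N)) 1) (divsZ l).
Definition coset_b (l a : Z) : list Z :=
  filter (fun b => Z.eqb (Z.gcd (Z.gcd a b) (l / a)) 1) (map Z.of_nat (seq 0 (Z.to_nat (l / a)))).
Definition cosets (N : nat) (l : Z) : list (Z * Z) :=
  flat_map (fun a => map (fun b => (a, b)) (coset_b l a)) (coset_a N l).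

Lemma in_cosets N l a b : (0 < l)%Z -> In (a, b) (cosets N l) <->
  (In a (divsZ l) /\ 0 < a /\ a * (l / a) = l /\ Z.gcd a (Z.of_nat N) = 1 /\ 0 <= b < l / a /\ Z.gcd (Z.gcd a b) (l / a) = 1)%Z.
Proof.
  intros Hl. unfold cosets. rewrite in_flat_map. split.
  - intros [a' [Ha Hb]]. apply in_map_iff in Hb. destruct Hb as [b' [E Hb]]. injection E as -> ->.
    apply filter_In in Ha, Hb. destruct Ha as [Ha1 Ha2], Hb as [Hb1 Hb2]. apply Z.eqb_eq in Ha2, Hb2.
    destruct (in_divsZ l a Hl Ha1) as [P E]. apply in_map_iff in Hb1. destruct Hb1 as [n [<- Hn]]. apply in_seq in Hn.
    repeat split; try easy; lia.
  - intros (H0 & H1 & H2 & H3 & H4 & H5). exists a. split.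
    + apply filter_In. split; [easy|]. now apply Z.eqb_eq.
    + apply in_map_iff. exists b. split; [easy|]. apply filter_In. split; [|now apply Z.eqb_eq].
      apply in_map_iff. exists (Z.to_nat b). split; [lia|]. apply in_seq. lia.
Qed.

Lemma NoDup_flat_map_pairs {A B} (l : list A) (g : A -> list B) : NoDup l -> (forall a, In a l -> NoDup (g a)) ->
  NoDup (flat_map (fun a => map (fun b => (a, b)) (g a)) l).
Proof.
  induction l as [|a l IH]; intros Hl Hg; [constructor|]. simpl. inversion Hl; subst.
  apply NoDup_app.
  - apply FinFun.Injective_map_NoDup; [now intros x y E; injection E|]. apply Hg. now left.
  - apply IH; [easy|]. intros; apply Hg; now right.
  - intros [x y] Hx Hy. apply in_map_iff in Hx. destruct Hx as [b [E _]]. injection E as -> ->.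
    apply in_flat_map in Hy. destruct Hy as [a' [Ha' Hy]]. apply in_map_iff in Hy. destruct Hy as [b' [E _]].
    injection E as -> ->. easy.
Qed.

Lemma NoDup_cosets N l : NoDup (cosets N l).
Proof.
  assert (S : forall k n, NoDup (map Z.of_nat (seq k n))).
  { intros. apply FinFun.Injective_map_NoDup; [intros x y; lia|apply seq_NoDup]. }
  apply NoDup_flat_map_pairs.
  - apply NoDup_filter, NoDup_filter, S.
  - intros. apply NoDup_filter, S.
Qed.

Lemma in_divsZ_iff l a : (0 < l)%Z -> (0 < a)%Z -> (a | l)%Z -> In a (divsZ l).
Proof.
  intros Hl Ha D. unfold divsZ. apply filter_In. split.
  - apply in_map_iff. exists (Z.to_nat a). split; [lia|]. apply in_seq. apply Z.divide_pos_le in D; lia.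
  - apply Z.eqb_eq. apply Z.mod_divide; [lia|easy].
Qed.

(** Normal form of the top row: [al] is the gcd of [a] and [l], and with [a = a1 al] the residue
    [be] solves [a1 be = b] modulo [l / al]. Any [j] is allowed because [a (l / al)] is a multiple
    of [l]. *)
Lemma coset_cover N l a b c d : (0 < l)%Z -> (a * d - b * c = 1)%Z -> (Z.of_nat N | c)%Z ->
  exists al be, In (al, be) (cosets N l) /\ forall j, (l | a * (be + l / al * j) - al * b)%Z.
Proof.
  intros Hl Hdet [c' Hc']. set (al := Z.gcd a l). 
  assert (Pal : (0 < al)%Z) by (unfold al; rewrite Z.gcd_comm; now apply gcd_pos_l).
  destruct (Z.gcd_divide_l a l) as [a1 Ea]. destruct (Z.gcd_divide_r a l) as [de Ed]. fold al in Ea, Ed.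
  assert (Pde : (0 < de)%Z) by nia.
  assert (Eld : (l / al = de)%Z) by (rewrite Ed at 1; apply Z.div_mul; lia).
  assert (G : Z.gcd a1 de = 1%Z).
  { assert (E : Z.gcd (a1 * al) (de * al) = al) by (rewrite <- Ea, <- Ed; reflexivity).
    rewrite Z.gcd_mul_mono_r_nonneg in E by lia. nia. }
  destruct (Z.gcd_bezout _ _ _ G) as [u [v Euv]].
  (* [u] is the inverse of [a1] modulo [de]. *)
  set (be := ((u * b) mod de)%Z).
  pose proof (Z.mod_pos_bound (u * b) de Pde) as Hbe. fold be in Hbe.
  assert (Eb : (u * b = de * (u * b / de) + be)%Z) by (apply Z.div_mod; lia).
  set (t := (u * b / de)%Z) in *.
  assert (Kb : (a1 * be - b = de * (- v * b - a1 * t))%Z).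
  { replace be with (u * b - de * t)%Z by lia.
    replace (a1 * (u * b - de * t) - b)%Z with (b * (u * a1 - 1) - a1 * de * t)%Z by ring.
    replace (u * a1 - 1)%Z with (- v * de)%Z by lia. ring. }
  clearbody al. exists al, be. rewrite in_cosets by easy. rewrite Eld. split.
  - repeat split; try lia.
    + apply in_divsZ_iff; try easy. exists de. lia.
    + apply Z.bezout_1_gcd. exists (a1 * d)%Z, (- b * c')%Z. rewrite <- Hdet, Ea, Hc'. ring.
    + set (g := Z.gcd (Z.gcd al be) de).
      assert (G1 : (g | Z.gcd al be)%Z) by apply Z.gcd_divide_l.
      assert (G2 : (g | de)%Z) by apply Z.gcd_divide_r.
      assert (G3 : (g | al)%Z) by (eapply Z.divide_trans; [exact G1|apply Z.gcd_divide_l]).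
      assert (G4 : (g | be)%Z) by (eapply Z.divide_trans; [exact G1|apply Z.gcd_divide_r]).
      assert (D : (g | 1)%Z).
      { rewrite <- Hdet. apply Z.divide_sub_r.
        - apply Z.divide_mul_l. rewrite Ea. now apply Z.divide_mul_r.
        - apply Z.divide_mul_l. replace b with (a1 * be - de * (- v * b - a1 * t))%Z by lia.
          apply Z.divide_sub_r; [now apply Z.divide_mul_r|now apply Z.divide_mul_l]. }
      apply Z.divide_1_r_nonneg in D; [easy|apply Z.gcd_nonneg].
  - intros j. exists (- v * b - a1 * t + a1 * j)%Z. rewrite Ea at 1.
    replace (a1 * al * (be + de * j) - al * b)%Z with (al * (a1 * be - b) + a1 * al * de * j)%Z by ring.
    rewrite Kb, Ed. ring.
Qed.

(** Coprimality of each row makes [al] and [al'] divide each other; then the second entries agree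
    modulo [l / al], and both residues are reduced. *)
Lemma coset_inj N l al be al' be' j j' : (0 < l)%Z -> In (al, be) (cosets N l) -> In (al', be') (cosets N l) ->
  Z.gcd (be + l / al * j) al = 1%Z -> Z.gcd (be' + l / al' * j') al' = 1%Z ->
  (l | al * (be' + l / al' * j') - al' * (be + l / al * j))%Z -> (al, be) = (al', be').
Proof.
  intros Hl H H' G G' D. apply in_cosets in H, H'; [|easy|easy].
  destruct H as (_ & P1 & P2 & _ & P4 & _). destruct H' as (_ & P1' & P2' & _ & P4' & _).
  set (q := (be + l / al * j)%Z) in *. set (q' := (be' + l / al' * j')%Z) in *.
  assert (D1 : (al | al')%Z).
  { apply (coprime_mul_divide q); [easy|]. destruct D as [k Hk].
    exists (q' - k * (l / al))%Z. replace ((q' - k * (l / al)) * al)%Z with (al * q' - k * (al * (l / al)))%Z by ring. rewrite P2. lia. }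
  assert (D2 : (al' | al)%Z).
  { apply (coprime_mul_divide q'); [easy|]. destruct D as [k Hk].
    exists (q + k * (l / al'))%Z. replace ((q + k * (l / al')) * al')%Z with (al' * q + k * (al' * (l / al')))%Z by ring. rewrite P2'. lia. }
  apply Z.divide_pos_le in D1, D2; try easy. assert (al' = al) by lia. subst al'.
  f_equal. destruct D as [k Hk]. unfold q, q' in Hk. set (de := (l / al)%Z) in *.
  assert (E : (be' - be = de * (k - j' + j))%Z).
  { apply (Z.mul_reg_l _ _ al); [lia|]. rewrite <- P2 in Hk. lia. }
  assert (k - j' + j = 0)%Z by nia. nia.
Qed.

(** The coefficient of [lhs] without [a^k], including the part [e(-b d x_N / 24)] of the
    exponential, which does not depend on [n]. *)
Definition weight (N : nat) (r : nat -> Z) (l : Z) (i : Z * Z) : C :=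
  let (al, be) := i in
  Cmult (RtoC (IZR (kron al (varpi N r))))
        (Cmult (Cmult (RtoC (powerRZ (IZR (kron (- Z.of_nat N * be) (Z.gcd al (l / al)))) (k2 N r)))
                      (e24 (- (be * (l / al) * xN N r)))) (psi_lr N r l al be)).

(** Without the constant [l^(-k/2)] of [lhs], which is restored in [hecke_coefficients]. *)
Definition hecke (N : nat) (r : nat -> Z) (l : Z) (tau : C) : C :=
  Csum (cosets N l) (fun i =>
    Cmult (Cmult (weight N r l i) (RtoC (Rpower (IZR (fst i)) (wt N r))))
          (eta_quot N r (mob (fst i) (snd i) 0 (l / fst i) tau))).

Section Hecke.
Variables (N : nat) (r : nat -> Z) (l : Z) (cusp : bool).
Hypothesis HN : (0 < N)%nat.
Hypothesis Hl : in_Lf N r l.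
Hypothesis Hf : is_mod_form N (k2 N r) (chi N r) cusp (eta_quot N r).

Let f := eta_quot N r.

(* [(al q; c s)] represents the coset of [(al be; 0 de)]. *)
Definition is_rep (i : Z * Z) (t : Z * Z * Z) : Prop :=
  let '(al, be) := i in let '(j, c, s) := t in let de := (l / al)%Z in let q := (be + de * j)%Z in
  (al * s - q * c = 1)%Z /\ (Z.of_nat N | c)%Z /\ (1 * (al * s - be * c) - j * (de * c) = 1)%Z /\
  chi N r 1 j (de * c) (al * s - be * c) 1 = Cmult (chi N r al q c s 1) (weight N r l i).

Lemma chi_neq_0 a b c d : (a * d - b * c = 1)%Z -> (Z.of_nat N | c)%Z -> chi N r a b c d 1 <> RtoC 0.
Proof.
  intros Hdet Hc E. assert (Ht : upper Ci) by (unfold upper, Ci; simpl; lra).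
  pose proof (mod_form_transform N r cusp _ a b c d Ci Hf Hdet Hc Ht) as H.
  rewrite E, !Cmult_0_l in H. revert H. apply eta_quot_neq_0, upper_mob; [lia|easy].
Qed.

Lemma reps_exist : exists rep, forall i, In i (cosets N l) -> is_rep i (rep i).
Proof.
  apply list_choice; [exact (0, 0, 0)%Z| |].
  - intros [a b] [c d]. destruct (Z.eq_dec a c) as [->|]; [destruct (Z.eq_dec b d) as [->|]|];
    [now left|right; congruence|right; congruence].
  - intros [al be] Hi. pose proof (in_Lf_pos N r l Hl) as Pl. apply in_cosets in Hi; [|easy].
    destruct Hi as (H0 & H1 & H2 & H3 & H4 & H5).
    destruct (weight_identity N r l al be HN Hl H0 H3 ltac:(lia) H5) as [j [r' [s (W1 & W2 & W3)]]].
    exists (j, Z.of_nat N * r', s)%Z. split; [exact W1|]. split; [apply Z.divide_factor_l|]. split; [exact W2|exact W3].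
Qed.

(** Both numerator and denominator of [hquot] at the representative are transformed back by the law
    for [f]; the quotient of the two characters is the weight, by [is_rep]. *)
Lemma hquot_rep al be j c s tau : In (al, be) (cosets N l) -> is_rep (al, be) (j, c, s) -> upper tau ->
  Cmult (Cmult (weight N r l (al, be)) (RtoC (Rpower (IZR al) (wt N r)))) (f (mob al be 0 (l / al) tau))
  = Cmult (f tau) (hquot N r l (mob al (be + l / al * j) c s tau)).
Proof.
  intros Hi (R1 & R2 & R3 & R4) Ht. pose proof (in_Lf_pos N r l Hl) as Pl. apply in_cosets in Hi; [|easy].
  destruct Hi as (_ & H1 & H2 & H3 & H4 & H5). set (de := (l / al)%Z) in *. set (q := (be + de * j)%Z) in *.
  assert (Pde : (0 < de)%Z) by nia.
  assert (Ur : upper (mob al be 0 de tau)) by (apply upper_mob; [nia|easy]).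
  unfold hquot.
  assert (E : mob 1 0 0 l (mob al q c s tau) = mob 1 j (de * c) (al * s - be * c) (mob al be 0 de tau)).
  { rewrite !mob_comp by (easy || nia). f_equal; rewrite <- ?H2; unfold q; ring. }
  rewrite E.
  rewrite (mod_form_transform N r cusp _ 1 j (de * c) (al * s - be * c) _ Hf R3 (Z.divide_mul_r _ _ _ R2) Ur).
  rewrite (mod_form_transform N r cusp _ al q c s tau Hf R1 R2 Ht).
  (* At the point [(al tau + be) / de] the lower row takes the value [al (c tau + s)]; the positive
     factor [al] leaves the root and yields [al^k]. *)
  replace (Jfac (k2 N r) (de * c) (al * s - be * c) (mob al be 0 de tau)) with
    (Cmult (RtoC (Rpower (IZR al) (wt N r))) (Jfac (k2 N r) c s tau)).
  2:{ unfold Jfac, wt. assert (Pa : 0 < IZR al) by now apply IZR_lt. rewrite <- Cpowz_sqrt by easy.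
      rewrite <- Cpowz_mult, <- csqrt_scal.
      - f_equal. f_equal. unfold den, mob. rewrite !minus_IZR, !mult_IZR, !RtoC_minus, !RtoC_mult. simpl. field.
        intros E0. apply (RtoC_neq_0 (IZR de)); [apply eq_IZR_contrapositive; lia|]. rewrite <- E0. ring.
      - easy.
      - apply RtoC_neq_0, Rgt_not_eq, sqrt_lt_R0. easy.
      - apply csqrt_neq_0, den_neq_0; [easy|nia]. }
  rewrite R4. fold q f. change (l / al)%Z with de. unfold f.
  assert (X0 : chi N r al q c s 1 <> RtoC 0) by now apply chi_neq_0.
  assert (J0 : Jfac (k2 N r) c s tau <> RtoC 0) by (apply Jfac_neq_0; [easy|nia]).
  pose proof (eta_quot_neq_0 N r tau Ht) as F0.
  field. repeat split; assumption.
Qed.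

(** Transitivity of proportionality modulo [l] through a primitive row: multiply by the Bezout
    combination of its entries. *)
Lemma coset_cross u1 u2 v1 v2 w1 w2 : Z.gcd w1 w2 = 1%Z -> (l | u1 * w2 - w1 * u2)%Z -> (l | v1 * w2 - w1 * v2)%Z ->
  (l | u1 * v2 - v1 * u2)%Z.
Proof.
  intros G [k Hk] [m Hm]. destruct (Z.gcd_bezout _ _ _ G) as [x [y E]].
  exists (x * (v1 * k - u1 * m) + y * (v2 * k - u2 * m))%Z.
  replace (u1 * v2 - v1 * u2)%Z with ((x * w1 + y * w2) * (u1 * v2 - v1 * u2))%Z by (rewrite E; ring).
  replace ((x * (v1 * k - u1 * m) + y * (v2 * k - u2 * m)) * l)%Z with
    (x * (v1 * (k * l) - u1 * (m * l)) + y * (v2 * (k * l) - u2 * (m * l)))%Z by ring.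
  rewrite <- Hk, <- Hm. ring.
Qed.

Lemma hecke_invariant a b c d tau : (a * d - b * c = 1)%Z -> (Z.of_nat N | c)%Z -> upper tau ->
  Cmult (f tau) (hecke N r l (mob a b c d tau)) = Cmult (f (mob a b c d tau)) (hecke N r l tau).
Proof.
  intros Hdet Hc Ht. pose proof (in_Lf_pos N r l Hl) as Pl.
  destruct reps_exist as [rep Hrep].
  set (G := fun i : Z * Z => let '(al, be) := i in let '(j, c, s) := rep i in fun t => hquot N r l (mob al (be + l / al * j) c s t)).
  assert (FG : forall t, upper t -> hecke N r l t = Cmult (f t) (Csum (cosets N l) (fun i => G i t))).
  { intros t Hu. unfold hecke. rewrite <- Csum_scal. apply Csum_ext. intros [al be] Hi. simpl fst. simpl snd.
    unfold G. specialize (Hrep _ Hi). destruct (rep (al, be)) as [[j c'] s]. now apply hquot_rep. }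
  assert (Um : upper (mob a b c d tau)) by (apply upper_mob; [lia|easy]).
  rewrite !FG by easy.
  set (row1 := fun i : Z * Z => let '(al, be) := i in let '(j, _, _) := rep i in (be + l / al * j)%Z).
  (* [sg] maps a coset to the one containing its representative multiplied on the right by the given
     matrix, recognised by the top row. *)
  destruct (list_choice (cosets N l) (fun i i' => In i' (cosets N l) /\
     (l | (fst i * a + row1 i * c) * row1 i' - fst i' * (fst i * b + row1 i * d))%Z) (0, 0)%Z) as [sg Hsg].
  { intros [x y] [z t]. destruct (Z.eq_dec x z) as [->|]; [destruct (Z.eq_dec y t) as [->|]|];
    [now left|right; congruence|right; congruence]. }
  { intros [al be] Hi. pose proof (Hrep _ Hi) as Ri. unfold row1. destruct (rep (al, be)) as [[j c'] s].
    destruct Ri as (R1 & R2 & R3 & R4). simpl fst.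
    destruct (coset_cover N l (al * a + (be + l / al * j) * c) (al * b + (be + l / al * j) * d) (c' * a + s * c) (c' * b + s * d) Pl) as [al' [be' [I' D']]].
    - transitivity ((al * s - (be + l / al * j) * c') * (a * d - b * c))%Z; [ring|]. rewrite R1, Hdet. reflexivity.
    - apply Z.divide_add_r; [now apply Z.divide_mul_l|now apply Z.divide_mul_r].
    - exists (al', be'). split; [easy|]. destruct (rep (al', be')) as [[j' c''] s']. apply D'. }
  assert (Gq : forall i, In i (cosets N l) -> Z.gcd (row1 i) (fst i) = 1%Z).
  { intros [al be] Hi. pose proof (Hrep _ Hi) as Ri. unfold row1. destruct (rep (al, be)) as [[j c'] s].
    destruct Ri as (R1 & _). apply Z.bezout_1_gcd. exists (- c')%Z, s. simpl fst. lia. }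
  assert (Pm : Permutation (map sg (cosets N l)) (cosets N l)).
  { apply NoDup_Permutation_bis.
    - apply FinFun.Injective_map_NoDup_in; [|apply NoDup_cosets].
      intros i i' Hi Hi' E. destruct (Hsg i Hi) as [S1 S2]. destruct (Hsg i' Hi') as [S1' S2']. rewrite <- E in S2'.
      (* Equal images have proportional top rows after the multiplication, hence before it, the
         matrix having determinant 1. *)
      assert (D : (l | fst i * row1 i' - fst i' * row1 i)%Z).
      { pose proof (coset_cross _ _ _ _ _ _ ltac:(rewrite Z.gcd_comm; apply (Gq _ S1)) S2 S2') as D.
        replace (fst i * row1 i' - fst i' * row1 i)%Z with ((fst i * row1 i' - fst i' * row1 i) * (a * d - b * c))%Z by (rewrite Hdet; ring).
        destruct D as [k Hk]. exists k. rewrite <- Hk. ring. }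
      pose proof (Gq i Hi) as G1. pose proof (Gq i' Hi') as G1'.
      destruct i as [al be], i' as [al' be']. unfold row1 in D, G1, G1'. simpl fst in *.
      destruct (rep (al, be)) as [[j c'] s], (rep (al', be')) as [[j' c''] s'].
      now apply (coset_inj N l al be al' be' j j').
    - rewrite length_map. lia.
    - intros x Hx. apply in_map_iff in Hx. destruct Hx as [i [<- Hi]]. now apply Hsg. }
  assert (E : Csum (cosets N l) (fun i => G i (mob a b c d tau)) = Csum (cosets N l) (fun i => G i tau)).
  { rewrite <- (Csum_perm _ _ (fun i => G i tau) Pm), Csum_map. apply Csum_ext. intros i Hi.
    destruct (Hsg i Hi) as [S1 S2]. set (i' := sg i) in *. clearbody i'.
    pose proof (Hrep _ Hi) as Ri. pose proof (Hrep _ S1) as Ri'. unfold row1 in S2. unfold G.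
    destruct i as [al be], i' as [al' be']. simpl fst in S2.
    destruct (rep (al, be)) as [[j c'] s], (rep (al', be')) as [[j' c''] s'].
    destruct Ri as (R1 & R2 & _). destruct Ri' as (R1' & R2' & _).
    rewrite mob_comp by (easy || lia). apply (hquot_coset N r l cusp); try easy.
    - transitivity ((al * s - (be + l / al * j) * c') * (a * d - b * c))%Z; [ring|]. rewrite R1, Hdet. reflexivity.
    - apply Z.divide_add_r; [now apply Z.divide_mul_l|now apply Z.divide_mul_r]. }
  rewrite E. ring.
Qed.

End Hecke.

(** * Expansions at the cusps *)

Definition qexp_at (h : nat) (cc : nat -> C) (u : C -> C) : Prop :=
  forall tau, upper tau ->
    is_series (fun m => Cmult (cc m) (ec (Cdiv (Cmult (RtoC (INR m)) tau) (RtoC (INR h))))) (u tau).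

Definition has_qexp (cusp : bool) (u : C -> C) : Prop :=
  exists h : nat, (0 < h)%nat /\ exists cc : nat -> C, (cusp = true -> cc O = RtoC 0) /\ qexp_at h cc u.

Lemma INR_neq_0 h : (0 < h)%nat -> RtoC (INR h) <> RtoC 0.
Proof. intros H. apply RtoC_neq_0, not_0_INR. lia. Qed.

Lemma qexp_ext cusp u v : (forall tau, upper tau -> u tau = v tau) -> has_qexp cusp u -> has_qexp cusp v.
Proof.
  intros E [h [Hh [cc [H0 H]]]]. exists h. split; [easy|]. exists cc. split; [easy|].
  intros tau Ht. rewrite <- E by easy. now apply H.
Qed.

Lemma qexp_scal cusp k u : has_qexp cusp u -> has_qexp cusp (fun tau => Cmult k (u tau)).
Proof.
  intros [h [Hh [cc [H0 H]]]]. exists h. split; [easy|]. exists (fun m => Cmult k (cc m)). split.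
  - intros E. rewrite H0 by easy. ring.
  - intros tau Ht. eapply is_series_ext; [|exact (is_series_scal k _ _ (H tau Ht))].
    intros m. match goal with |- _ = ?t => change (Cmult k (Cmult (cc m) (ec (Cdiv (Cmult (RtoC (INR m)) tau) (RtoC (INR h))))) = t) end. ring.
Qed.

(** [q^(m/h)] becomes [q^(A m / (D h))] times the constant [e(m B / (D h))]; index 0 stays in place,
    so cuspidality is kept. *)
Lemma qexp_at_subst h cc u (A D : nat) (B : R) : (0 < h)%nat -> (0 < A)%nat -> (0 < D)%nat -> qexp_at h cc u ->
  qexp_at (D * h) (spread 0 A (fun m => Cmult (cc m) (e (INR m * B / (INR D * INR h)))))
    (fun tau => u (Cdiv (Cplus (Cmult (RtoC (INR A)) tau) (RtoC B)) (RtoC (INR D)))).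
Proof.
  intros Hh HA HD H tau Ht.
  pose proof (INR_neq_0 h Hh) as h0. pose proof (INR_neq_0 D HD) as D0.
  assert (RD : 0 < INR D) by (apply lt_0_INR; lia). assert (RA : 0 < INR A) by (apply lt_0_INR; lia).
  assert (Rh : 0 < INR h) by (apply lt_0_INR; lia).
  assert (Ut : upper (Cdiv (Cplus (Cmult (RtoC (INR A)) tau) (RtoC B)) (RtoC (INR D)))).
  { unfold upper in *. unfold Cdiv. rewrite <- RtoC_inv by lra. destruct tau as [x y]. simpl in *.
    assert (0 < / INR D) by now apply Rinv_0_lt_compat. assert (0 < INR A * y) by now apply Rmult_lt_0_compat. nra. }
  eapply is_series_ext; [|exact (is_series_spread 0 A _ _ HA (H _ Ut))].
  intros t. unfold spread. rewrite Nat.sub_0_r. simpl Nat.leb. simpl andb.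
  destruct (Nat.eqb_spec (t mod A) 0) as [E|E]; [|eqC; ring].
  apply Nat.Div0.div_exact in E. set (m := (t / A)%nat) in *. rewrite E, !mult_INR, !RtoC_mult.
  eqC. rewrite <- Cmult_assoc. f_equal. rewrite <- ec_R, <- ec_plus. f_equal.
  unfold Rdiv. rewrite !RtoC_mult, RtoC_inv, RtoC_mult by nra. field. split; assumption.
Qed.

Lemma spread_0 A u : spread 0 A u 0 = u O.
Proof. unfold spread. simpl. now rewrite Nat.Div0.mod_0_l, Nat.Div0.div_0_l. Qed.

Lemma qexp_subst cusp u (A B D : Z) : (0 < A)%Z -> (0 < D)%Z -> has_qexp cusp u ->
  has_qexp cusp (fun tau => u (mob A B 0 D tau)).
Proof.
  intros HA HD [h [Hh [cc [H0 H]]]].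
  pose proof (qexp_at_subst h cc u (Z.to_nat A) (Z.to_nat D) (IZR B) Hh ltac:(lia) ltac:(lia) H) as H'.
  exists (Z.to_nat D * h)%nat. split; [nia|]. eexists. split; [|intros tau Ht].
  2:{ pose proof (H' tau Ht) as K. replace (mob A B 0 D tau) with (Cdiv (Cplus (Cmult (RtoC (INR (Z.to_nat A))) tau) (RtoC (IZR B))) (RtoC (INR (Z.to_nat D)))).
      - exact K.
      - unfold mob. rewrite !INR_IZR_INZ, !Z2Nat.id by lia. f_equal. rewrite Cmult_0_l, Cplus_0_l. reflexivity. }
  intros E. rewrite spread_0, H0 by easy. ring.
Qed.

Lemma qexp_refine h cc u (K : nat) : (0 < h)%nat -> (0 < K)%nat -> qexp_at h cc u -> qexp_at (K * h) (spread 0 K cc) u.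
Proof.
  intros Hh HK H tau Ht. pose proof (INR_neq_0 h Hh) as h0. pose proof (INR_neq_0 K HK) as K0.
  eapply is_series_ext; [|exact (is_series_spread 0 K _ _ HK (H tau Ht))].
  intros t. unfold spread. rewrite Nat.sub_0_r. simpl Nat.leb. simpl andb.
  destruct (Nat.eqb_spec (t mod K) 0) as [E|E]; [|eqC; ring].
  apply Nat.Div0.div_exact in E. set (m := (t / K)%nat) in *. rewrite E, !mult_INR, !RtoC_mult.
  f_equal. f_equal. eqC. field. split; assumption.
Qed.

Lemma qexp_plus cusp u v : has_qexp cusp u -> has_qexp cusp v -> has_qexp cusp (fun tau => Cplus (u tau) (v tau)).
Proof.
  intros [h [Hh [cc [H0 H]]]] [h' [Hh' [cc' [H0' H']]]].
  pose proof (qexp_refine h cc u h' Hh Hh' H) as K. pose proof (qexp_refine h' cc' v h Hh' Hh H') as K'.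
  rewrite Nat.mul_comm in K'. exists (h' * h)%nat. split; [nia|].
  exists (fun t => Cplus (spread 0 h' cc t) (spread 0 h cc' t)). split.
  - intros E. rewrite !spread_0, H0, H0' by easy. ring.
  - intros tau Ht. eapply is_series_ext; [|exact (is_series_plus _ _ _ _ (K tau Ht) (K' tau Ht))].
    intros t. set (E := ec (Cdiv (Cmult (RtoC (INR t)) tau) (RtoC (INR (h' * h))))).
    change (Cplus (Cmult (spread 0 h' cc t) E) (Cmult (spread 0 h cc' t) E)
      = Cmult (Cplus (spread 0 h' cc t) (spread 0 h cc' t)) E). ring.
Qed.

Lemma qexp_0 cusp : has_qexp cusp (fun _ => RtoC 0).
Proof.
  exists 1%nat. split; [lia|]. exists (fun _ => RtoC 0). split; [easy|]. intros tau Ht.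
  apply (is_series_ext (fun _ : nat => RtoC 0)); [|apply Cis_series_0]. intros m. eqC. ring.
Qed.

Lemma qexp_Csum {A} cusp (l : list A) (F : A -> C -> C) : (forall a, In a l -> has_qexp cusp (F a)) ->
  has_qexp cusp (fun tau => Csum l (fun a => F a tau)).
Proof.
  induction l as [|a l IH]; intros H; [apply qexp_0|].
  apply (qexp_plus cusp (F a) (fun tau => Csum l (fun a => F a tau))).
  - apply H. now left.
  - apply IH. intros; apply H; now right.
Qed.

(** Writes an integral matrix as a unimodular one times an upper triangular one; [A] is the gcd of
    the first column and the Bezout coefficients supply the second column of the unimodular
    factor. *)
Lemma hermite p q u v : (0 < p * v - q * u)%Z -> exists A B D a b c d : Z,
  (0 < A /\ 0 < D /\ a * d - b * c = 1 /\ p = a * A /\ q = a * B + b * D /\ u = c * A /\ v = c * B + d * D)%Z.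
Proof.
  intros Hdet. set (g := Z.gcd p u).
  assert (Pg : (0 < g)%Z).
  { pose proof (Z.gcd_nonneg p u). assert (g <> 0)%Z; [|unfold g in *; lia].
    intros E. assert (p = 0)%Z by (now apply Z.gcd_eq_0_l in E). assert (u = 0)%Z by (now apply Z.gcd_eq_0_r in E). nia. }
  destruct (Z.gcd_divide_l p u) as [a Ea]. destruct (Z.gcd_divide_r p u) as [c Ec]. fold g in Ea, Ec.
  destruct (Z.gcd_bezout p u g eq_refl) as [x [y E]].
  assert (E1 : (x * a + y * c = 1)%Z) by (apply (Z.mul_reg_r _ _ g); [lia|]; rewrite <- E at 2; rewrite Ea, Ec at 1; lia).
  exists g, (x * q + y * v)%Z, (a * v - c * q)%Z, a, (- y)%Z, c, x.
  split; [easy|]. split; [rewrite Ea, Ec in Hdet; nia|]. split; [lia|]. split; [easy|].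
  split; [|split; [easy|]].
  - transitivity ((x * a + y * c) * q)%Z; [rewrite E1; ring|ring].
  - transitivity ((x * a + y * c) * v)%Z; [rewrite E1; ring|ring].
Qed.

(** * The Hecke-type sum is a modular form *)

Section HeckeForm.
Variables (N : nat) (r : nat -> Z) (l : Z) (cusp : bool).
Hypothesis HN : (0 < N)%nat.
Hypothesis Hl : in_Lf N r l.
Hypothesis Hf : is_mod_form N (k2 N r) (chi N r) cusp (eta_quot N r).

(** Move the triangular matrix to the right of the unimodular one by [hermite]: the term is then the
    expansion of [f] at another cusp, evaluated at [(A tau + B) / D], up to a constant. *)
Lemma hecke_term_qexp al be a b c d : In (al, be) (cosets N l) -> (a * d - b * c = 1)%Z ->
  has_qexp cusp (fun tau => Cmult (Cpowz (csqrt (den c d tau)) (- k2 N r))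
     (eta_quot N r (mob al be 0 (l / al) (mob a b c d tau)))).
Proof.
  intros Hi Hdet. pose proof (in_Lf_pos N r l Hl) as Pl. apply in_cosets in Hi; [|easy].
  destruct Hi as (_ & H1 & H2 & _ & _ & _). set (de := (l / al)%Z) in *. assert (Pde : (0 < de)%Z) by nia.
  destruct (hermite (al * a + be * c) (al * b + be * d) (de * c) (de * d)) as (A & B & D & a' & b' & c' & d' & PA & PD & Dt & E1 & E2 & E3 & E4).
  { replace ((al * a + be * c) * (de * d) - (al * b + be * d) * (de * c))%Z with (al * de * (a * d - b * c))%Z by ring. rewrite Hdet. nia. }
  destruct Hf as (_ & _ & Hq). specialize (Hq a' b' c' d' Dt).
  assert (Q : has_qexp cusp (slash (k2 N r) (eta_quot N r) a' b' c' d' (fun t => csqrt (Cplus (Cmult (RtoC (IZR c')) t) (RtoC (IZR d')))))).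
  { exact Hq. }
  apply (qexp_subst cusp _ A B D PA PD) in Q.
  apply (qexp_scal cusp (Cpowz (RtoC (sqrt (IZR de / IZR D))) (k2 N r))) in Q.
  eapply qexp_ext; [|exact Q]. intros tau Ht. cbv beta. unfold slash.
  assert (Um : upper (mob A B 0 D tau)) by (apply upper_mob; [nia|easy]).
  change (Cplus (Cmult (RtoC (IZR c')) (mob A B 0 D tau)) (RtoC (IZR d'))) with (den c' d' (mob A B 0 D tau)).
  assert (RD : 0 < IZR D) by now apply IZR_lt. assert (Rde : 0 < IZR de) by now apply IZR_lt.
  assert (D0 : RtoC (IZR D) <> RtoC 0) by (apply RtoC_neq_0; lra).
  (* Comparing bottom rows of the two factorisations; the ratio is a positive constant, so the
     principal roots match. *)
  replace (den c' d' (mob A B 0 D tau)) with (Cmult (RtoC (IZR de / IZR D)) (den c d tau)).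
  2:{ assert (G3 : Cmult (RtoC (IZR de)) (RtoC (IZR c)) = Cmult (RtoC (IZR c')) (RtoC (IZR A))) by (rewrite <- !RtoC_mult, <- !mult_IZR; now rewrite E3).
      assert (G4 : Cmult (RtoC (IZR de)) (RtoC (IZR d)) = Cplus (Cmult (RtoC (IZR c')) (RtoC (IZR B))) (Cmult (RtoC (IZR d')) (RtoC (IZR D))))
        by (rewrite <- !RtoC_mult, <- !mult_IZR, <- RtoC_plus, <- plus_IZR; now rewrite E4).
      unfold den, mob. rewrite Cmult_0_l, Cplus_0_l. unfold Rdiv. rewrite RtoC_mult, RtoC_inv by lra.
      transitivity (Cdiv (Cplus (Cmult (Cmult (RtoC (IZR de)) (RtoC (IZR c))) tau) (Cmult (RtoC (IZR de)) (RtoC (IZR d)))) (RtoC (IZR D))).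
      - field. easy.
      - rewrite G3, G4. field. easy. }
  assert (Pt : 0 < IZR de / IZR D) by now apply Rdiv_lt_0_compat.
  rewrite csqrt_scal by easy.
  assert (S0 : RtoC (sqrt (IZR de / IZR D)) <> RtoC 0) by (apply RtoC_neq_0, Rgt_not_eq, sqrt_lt_R0; easy).
  rewrite Cpowz_mult by (easy || (apply csqrt_neq_0, den_neq_0; [easy|nia])).
  replace (mob a' b' c' d' (mob A B 0 D tau)) with (mob al be 0 de (mob a b c d tau)).
  2:{ rewrite !mob_comp by (easy || nia). f_equal; try ring [E1 E2 E3 E4]; lia. }
  set (w := Cpowz (csqrt (den c d tau)) (- k2 N r)). set (ff := eta_quot _ _ _).
  pose proof (Cpowz_opp _ (k2 N r) S0) as Ko. set (t1 := Cpowz (RtoC _) (- k2 N r)) in *. set (t2 := Cpowz _ (k2 N r)) in *.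
  transitivity (Cmult (Cmult t1 t2) (Cmult w ff)); [ring|rewrite Ko; ring].
Qed.

(** Stated over [AbsRing_NormedModule], the structure in which [ex_derive_comp] expects the inner
    function. *)
Lemma ex_derive_affine (a b tau : C) :
  @ex_derive C_AbsRing (AbsRing_NormedModule C_AbsRing) (fun t : C => Cplus (Cmult t a) b) tau.
Proof.
  exists (plus (scal one a) zero).
  apply (is_derive_plus (K := C_AbsRing) (V := AbsRing_NormedModule C_AbsRing) (fun t => scal t a) (fun _ => b)).
  - apply (is_derive_scal_l (K := C_AbsRing) (V := AbsRing_NormedModule C_AbsRing) (fun t => t) tau one a).
    apply (is_derive_id (K := C_AbsRing)).
  - apply (is_derive_const (K := C_AbsRing) (V := AbsRing_NormedModule C_AbsRing)).
Qed.

Lemma hecke_holomorphic tau : upper tau -> @ex_derive C_AbsRing C_NormedModule (hecke N r l) tau.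
Proof.
  intros Ht. pose proof (in_Lf_pos N r l Hl) as Pl. destruct Hf as (Hd & _ & _). unfold hecke.
  assert (Hc : forall i, In i (cosets N l) -> let '(al, be) := i in (0 < al /\ 0 < l / al)%Z).
  { intros [al be] Hi. apply in_cosets in Hi; [|easy]. nia. }
  induction (cosets N l) as [|[al be] L IH].
  - exact (ex_derive_const (K := C_AbsRing) (V := C_NormedModule) (RtoC 0) tau).
  - apply (ex_derive_plus (K := C_AbsRing) (V := C_NormedModule)
      (fun t => Cmult (Cmult (weight N r l (al, be)) (RtoC (Rpower (IZR al) (wt N r)))) (eta_quot N r (mob al be 0 (l / al) t)))).
    + destruct (Hc _ (or_introl eq_refl)) as [P1 P2]. set (de := (l / al)%Z) in *.
      set (k := Cmult (weight N r l (al, be)) (RtoC (Rpower (IZR al) (wt N r)))).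
      assert (D0 : RtoC (IZR de) <> RtoC 0) by (apply RtoC_neq_0, eq_IZR_contrapositive; lia).
      assert (Em : forall t, mob al be 0 de t = Cplus (Cmult t (Cdiv (RtoC (IZR al)) (RtoC (IZR de)))) (Cdiv (RtoC (IZR be)) (RtoC (IZR de)))).
      { intros t. unfold mob. rewrite Cmult_0_l, Cplus_0_l. field. easy. }
      assert (X : @ex_derive C_AbsRing C_NormedModule (fun t => eta_quot N r (mob al be 0 de t)) tau).
      { apply (ex_derive_ext (K := C_AbsRing) (V := C_NormedModule)
          (fun t => eta_quot N r (Cplus (Cmult t (Cdiv (RtoC (IZR al)) (RtoC (IZR de)))) (Cdiv (RtoC (IZR be)) (RtoC (IZR de)))))).
        - intros t. now rewrite Em.
        - apply (ex_derive_comp (K := C_AbsRing) (V := C_NormedModule) (eta_quot N r)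
            (fun t => Cplus (Cmult t (Cdiv (RtoC (IZR al)) (RtoC (IZR de)))) (Cdiv (RtoC (IZR be)) (RtoC (IZR de))))).
          + rewrite <- Em. apply Hd, upper_mob; [nia|easy].
          + apply ex_derive_affine. }
      destruct X as [l' X]. exists (scal k l').
      eapply filterdiff_ext_lin; [apply (filterdiff_scal_r_fct (K := C_AbsRing) (V := C_NormedModule) k); [exact Cmult_comm|exact X]|].
      intros y. change (Cmult k (Cmult y l') = Cmult y (Cmult k l')). ring.
    + apply IH. intros; apply Hc; now right.
Qed.

Lemma hecke_mod_form : is_mod_form N (k2 N r) (chi N r) cusp (hecke N r l).
Proof.
  split; [exact hecke_holomorphic|]. split.
  - intros a b c d eps Hdet Hc He tau Ht.
    pose proof (hecke_invariant N r l cusp HN Hl Hf a b c d tau Hdet Hc Ht) as E.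
    destruct Hf as (_ & H & _). specialize (H a b c d eps Hdet Hc He tau Ht). unfold slash in *.
    pose proof (eta_quot_neq_0 N r tau Ht) as F0.
    (* [hecke] is [f] times an invariant function, so it inherits the law of [f] including [eps] and
       the character. *)
    replace (hecke N r l (mob a b c d tau)) with (Cdiv (Cmult (eta_quot N r (mob a b c d tau)) (hecke N r l tau)) (eta_quot N r tau)).
    + set (w := Cpowz _ _) in *. transitivity (Cdiv (Cmult (Cmult w (eta_quot N r (mob a b c d tau))) (hecke N r l tau)) (eta_quot N r tau)); [field; easy|].
      rewrite H. field. easy.
    + rewrite <- E. field. easy.
  - intros a b c d Hdet.
    assert (Q : has_qexp cusp (fun tau => Csum (cosets N l) (fun i =>
       Cmult (Cmult (weight N r l i) (RtoC (Rpower (IZR (fst i)) (wt N r)))) (Cmult (Cpowz (csqrt (den c d tau)) (- k2 N r))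
          (eta_quot N r (mob (fst i) (snd i) 0 (l / fst i) (mob a b c d tau))))))).
    { apply (qexp_Csum cusp (cosets N l) (fun i tau => Cmult (Cmult (weight N r l i) (RtoC (Rpower (IZR (fst i)) (wt N r)))) (Cmult (Cpowz (csqrt (den c d tau)) (- k2 N r))
          (eta_quot N r (mob (fst i) (snd i) 0 (l / fst i) (mob a b c d tau)))))).
      intros [al be] Hi. apply qexp_scal. now apply hecke_term_qexp. }
    assert (Q' : has_qexp cusp (slash (k2 N r) (hecke N r l) a b c d (fun t => csqrt (Cplus (Cmult (RtoC (IZR c)) t) (RtoC (IZR d)))))).
    { eapply qexp_ext; [|exact Q]. intros tau Ht. cbv beta. unfold slash, hecke. fold (den c d tau).
      rewrite <- Csum_scal. apply Csum_ext. intros i _. ring. }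
    exact Q'.
Qed.

End HeckeForm.

(** The flag [cusp] selects the space of dimension 1. It contains both [f] and [hecke], and [f],
    having no zeros, is a nonzero multiple of the generator. *)
Lemma hecke_eigen N r l : (0 < N)%nat -> in_Lf N r l -> weakly_admissible N r ->
  exists k : C, forall tau, upper tau -> hecke N r l tau = Cmult k (eta_quot N r tau).
Proof.
  intros HN Hl [Hf Hdim].
  assert (P : forall cusp, is_mod_form N (k2 N r) (chi N r) cusp (eta_quot N r) ->
    dim_eq1 (is_mod_form N (k2 N r) (chi N r) cusp) ->
    exists k : C, forall tau, upper tau -> hecke N r l tau = Cmult k (eta_quot N r tau)).
  { intros cusp H [g (_ & _ & Hg)].
    destruct (Hg _ H) as [k1 K1]. destruct (Hg _ (hecke_mod_form N r l cusp HN Hl H)) as [k2' K2].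
    assert (Ht : upper Ci) by (unfold upper, Ci; simpl; lra).
    assert (N1 : k1 <> RtoC 0).
    { intros E. apply (eta_quot_neq_0 N r Ci Ht). rewrite K1, E by easy. ring. }
    exists (Cdiv k2' k1). intros tau Hu. rewrite K1, K2 by easy. field. easy. }
  destruct Hdim as [Hd|(_ & Hd & Hs)]; [now apply (P false)|now apply (P true)].
Qed.

(** * Comparison of coefficients *)

(** Convergence at [1/2] bounds [b t] by [M 2^t]. For [z <= 1/4] the terms after the first then sum
    to at most [4 z M], so [b O] is smaller than any positive number as [z] tends to 0. *)
Lemma pseries_zero_head (b : nat -> R) : (forall z, 0 < z < 1 -> is_series (fun t => b t * z ^ t) 0) -> b O = 0.
Proof.
  intros H.
  assert (Hh := H (1 / 2) ltac:(lra)).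
  destruct (filterlim_bounded (K := R_AbsRing) (V := R_NormedModule) (fun t => b t * (1 / 2) ^ t)) as [M HM].
  { exists 0. apply ex_series_lim_0. now exists 0. }
  assert (BM : forall t, Rabs (b t) <= M * 2 ^ t).
  { intros t. specialize (HM t). change (Rabs (b t * (1 / 2) ^ t) <= M) in HM.
    rewrite Rabs_mult, (Rabs_pos_eq ((1 / 2) ^ t)) in HM by (apply pow_le; lra).
    assert (E : (1 / 2) ^ t * 2 ^ t = 1) by (rewrite <- Rpow_mult_distr; replace (1 / 2 * 2) with 1 by field; apply pow1).
    assert (P2 : 0 < 2 ^ t) by (apply pow_lt; lra).
    replace (Rabs (b t)) with (Rabs (b t) * (1 / 2) ^ t * 2 ^ t) by (rewrite Rmult_assoc, E; ring).
    apply Rmult_le_compat_r; lra. }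
  assert (M0 : 0 <= M) by (specialize (BM O); simpl in BM; pose proof (Rabs_pos (b O)); lra).
  assert (B : forall z, 0 < z <= 1 / 4 -> Rabs (b O) <= 4 * z * M).
  { intros z Hz. assert (S1 : is_series (fun t => b (S t) * z ^ S t) (- b O)).
    { apply (is_series_incr_1 (fun t => b t * z ^ t)).
      change (is_series (fun t => b t * z ^ t) (- b O + b O * 1)).
      replace (- b O + b O * 1) with 0 by ring. apply H. lra. }
    rewrite <- Rabs_Ropp.
    apply (series_abs_bound (fun t => b (S t) * z ^ S t) (fun t => 2 * z * M * (1 / 2) ^ t)); [easy| |].
    - intros t. rewrite Rabs_mult, (Rabs_pos_eq (z ^ S t)) by (apply pow_le; lra).
      apply (Rle_trans _ (M * 2 ^ S t * z ^ S t)); [apply Rmult_le_compat_r; [apply pow_le; lra|apply BM]|].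
      rewrite Rmult_assoc, <- Rpow_mult_distr. simpl.
      assert ((2 * z) ^ t <= (1 / 2) ^ t) by (apply pow_incr; lra).
      replace (2 * z * M * (1 / 2) ^ t) with (M * (2 * z * (1 / 2) ^ t)) by ring.
      apply Rmult_le_compat_l; [easy|]. apply Rmult_le_compat_l; lra.
    - replace (4 * z * M) with (2 * z * M * / (1 - 1 / 2)) by field.
      apply (is_series_scal_l (K := R_AbsRing) (V := R_NormedModule) (2 * z * M) (fun t => (1 / 2) ^ t)).
      apply is_series_geom. rewrite Rabs_pos_eq; lra. }
  destruct (Req_dec (b O) 0) as [|Nb]; [easy|]. exfalso.
  assert (Pb : 0 < Rabs (b O)) by now apply Rabs_pos_lt.
  set (z := Rmin (1 / 4) (Rabs (b O) / (8 * (M + 1)))).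
  assert (Pz : 0 < Rabs (b O) / (8 * (M + 1))) by (apply Rdiv_lt_0_compat; lra).
  assert (Hz : 0 < z <= 1 / 4) by (unfold z; split; [apply Rmin_glb_lt; lra|apply Rmin_l]).
  specialize (B z Hz). assert (Hz2 : z <= Rabs (b O) / (8 * (M + 1))) by apply Rmin_r.
  assert (4 * z * M <= 4 * z * (M + 1)) by (apply Rmult_le_compat_l; lra).
  assert (4 * z * (M + 1) <= 4 * (Rabs (b O) / (8 * (M + 1))) * (M + 1)) by (apply Rmult_le_compat_r; lra).
  replace (4 * (Rabs (b O) / (8 * (M + 1))) * (M + 1)) with (Rabs (b O) / 2) in H1 by (field; lra). lra.
Qed.

Lemma pseries_zero (a : nat -> R) : (forall z, 0 < z < 1 -> is_series (fun t => a t * z ^ t) 0) -> forall n, a n = 0.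
Proof.
  intros H n. enough (P : forall z, 0 < z < 1 -> is_series (fun t => a (n + t)%nat * z ^ t) 0).
  { apply pseries_zero_head in P. now rewrite Nat.add_0_r in P. }
  induction n as [|n IH]; [exact H|]. intros z Hz.
  pose proof (pseries_zero_head (fun t => a (n + t)%nat) IH) as E. cbv beta in E. rewrite Nat.add_0_r in E.
  assert (S1 : is_series (fun t => a (n + S t)%nat * z ^ S t) 0).
  { apply (is_series_incr_1 (fun t => a (n + t)%nat * z ^ t)).
    change (is_series (fun t => a (n + t)%nat * z ^ t) (0 + a (n + 0)%nat * 1)).
    replace (0 + a (n + 0)%nat * 1) with 0 by (rewrite Nat.add_0_r, E; ring). now apply IH. }
  apply (is_series_scal_r (/ z)) in S1. rewrite Rmult_0_l in S1.
  eapply is_series_ext; [|exact S1]. intros t. simpl. rewrite Nat.add_succ_r. field. lra.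
Qed.

Lemma Cpseries_zero (a : nat -> C) :
  (forall z : R, 0 < z < 1 -> is_series (fun t => Cmult (a t) (RtoC (z ^ t))) (RtoC 0)) -> forall n, a n = RtoC 0.
Proof.
  intros H n.
  assert (E1 : Re (a n) = 0).
  { apply (pseries_zero (fun t => Re (a t))). intros z Hz. destruct (proj1 (Cis_series_iff _ _) (H z Hz)) as [H1 _].
    eapply is_series_ext; [|exact H1]. intros t. unfold Re, Im. simpl. match goal with |- @eq _ ?x ?y => change (@eq R x y) end. ring. }
  assert (E2 : Im (a n) = 0).
  { apply (pseries_zero (fun t => Im (a t))). intros z Hz. destruct (proj1 (Cis_series_iff _ _) (H z Hz)) as [_ H1].
    eapply is_series_ext; [|exact H1]. intros t. unfold Re, Im. simpl. match goal with |- @eq _ ?x ?y => change (@eq R x y) end. ring. }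
  destruct (a n). simpl in *. subst. reflexivity.
Qed.

(** The point of the imaginary axis with [e(tau / (24 l)) = z], so that all fractional powers of q
    that occur become integral powers of [z]. *)
Definition tau_of (l : Z) (z : R) : C := (0, - (24 * IZR l * ln z) / (2 * PI)).

Lemma upper_tau_of l z : (0 < l)%Z -> 0 < z < 1 -> upper (tau_of l z).
Proof.
  intros Hl Hz. unfold upper, tau_of. simpl. apply IZR_lt in Hl.
  assert (L : ln z < 0) by (rewrite <- ln_1; apply ln_increasing; lra).
  apply Rdiv_lt_0_compat; [|pose proof PI_RGT_0; lra]. nra.
Qed.

(** The exponent [E] may be negative; [S] is the shift that makes it a natural number. *)
Lemma ec_tau_of l z (E S : Z) (m : nat) : (0 < l)%Z -> 0 < z < 1 -> (0 <= S)%Z -> (E + S = Z.of_nat m)%Z ->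
  Cmult (RtoC (z ^ Z.to_nat S)) (ec (Cmult (RtoC (IZR E / (24 * IZR l))) (tau_of l z))) = RtoC (z ^ m).
Proof.
  intros Hl Hz HS Hm. assert (Rl : IZR l <> 0) by (apply eq_IZR_contrapositive; lia). pose proof PI_RGT_0.
  assert (P : forall n, z ^ n = exp (INR n * ln z)) by (intros n; rewrite <- Rpower_pow by lra; reflexivity).
  replace (ec (Cmult (RtoC (IZR E / (24 * IZR l))) (tau_of l z))) with (RtoC (exp (IZR E * ln z))).
  - rewrite <- RtoC_mult, !P, <- exp_plus. f_equal. f_equal.
    rewrite !INR_IZR_INZ, Z2Nat.id, <- Hm, plus_IZR by easy. ring.
  - unfold ec, tau_of, cexp, Cmult, RtoC, Ci. simpl.
    match goal with |- _ = (exp ?u * cos ?v, exp ?u * sin ?v) => replace v with 0 by ring; replace u with (IZR E * ln z) by (field; lra) end.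
    rewrite cos_0, sin_0. f_equal; ring.
Qed.

Lemma spread_series_real l z (E : nat -> Z) (S : Z) (A B : nat) (u : nat -> C) (g : C) : (0 < l)%Z -> 0 < z < 1 -> (0 <= S)%Z ->
  (0 < B)%nat -> (forall n, E n + S = Z.of_nat (A + B * n))%Z ->
  is_series (fun n => Cmult (u n) (ec (Cmult (RtoC (IZR (E n) / (24 * IZR l))) (tau_of l z)))) g ->
  is_series (fun t => Cmult (spread A B u t) (RtoC (z ^ t))) (Cmult (RtoC (z ^ Z.to_nat S)) g).
Proof.
  intros Hl Hz HS HB HE H.
  pose proof (is_series_scal (RtoC (z ^ Z.to_nat S)) _ _ H) as H'.
  apply (is_series_spread A B) in H'; [|easy].
  eapply is_series_ext; [|exact H']. intros t. unfold spread.
  destruct (Nat.leb_spec A t) as [L|L]; [|simpl; eqC; ring].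
  destruct (Nat.eqb_spec ((t - A) mod B) 0) as [M|M]; [|simpl; eqC; ring]. cbn [andb].
  apply Nat.Div0.div_exact in M. set (n := ((t - A) / B)%nat) in *.
  match goal with |- _ = ?rhs => change (Cmult (RtoC (z ^ Z.to_nat S)) (Cmult (u n) (ec (Cmult (RtoC (IZR (E n) / (24 * IZR l))) (tau_of l z)))) = rhs) end.
  rewrite <- (ec_tau_of l z (E n) S t Hl Hz HS).
  - ring.
  - rewrite HE. f_equal. lia.
Qed.

Lemma Csum_series {A} (L : list A) (F : A -> nat -> C) (v : A -> C) : (forall i, In i L -> is_series (F i) (v i)) ->
  is_series (fun t => Csum L (fun i => F i t)) (Csum L v).
Proof.
  induction L as [|i L IH]; intros H; [apply Cis_series_0|].
  exact (is_series_plus _ _ _ _ (H i (or_introl eq_refl)) (IH (fun k Hk => H k (or_intror Hk)))).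
Qed.

Lemma cf_int N r (t : Q) (n : nat) : Q2R t = IZR (xN N r + 24 * Z.of_nat n) / 24 -> cf N r t = eta_coef N r n.
Proof.
  intros H. unfold cf.
  assert (E : (t - inject_Z (xN N r) / inject_Z 24 == inject_Z (Z.of_nat n))%Q).
  { apply eqR_Qeq. rewrite Q2R_minus, H, Q2R_div_Z, Q2R_inject, plus_IZR, mult_IZR by lia. field. }
  rewrite (Qred_complete _ _ E).
  replace (Qred (inject_Z (Z.of_nat n))) with (inject_Z (Z.of_nat n)).
  - simpl. destruct (Z.leb_spec 0 (Z.of_nat n)); [|lia]. now rewrite Nat2Z.id.
  - symmetry. apply Qcanon.Qred_identity. simpl. apply Z.gcd_1_r.
Qed.

Lemma cf_not N r (t : Q) : (forall n : nat, Q2R t <> IZR (xN N r + 24 * Z.of_nat n) / 24) -> cf N r t = 0%Z.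
Proof.
  intros H. unfold cf. set (u := Qred _). destruct (Z.eqb_spec (Zpos (Qden u)) 1) as [E1|]; [|reflexivity].
  destruct (Z.leb_spec 0 (Qnum u)) as [E2|]; [|reflexivity]. exfalso. apply (H (Z.to_nat (Qnum u))).
  assert (E : (u == t - inject_Z (xN N r) / inject_Z 24)%Q) by apply Qred_correct.
  assert (Eu : u = inject_Z (Qnum u)) by (destruct u as [nu du]; simpl in *; unfold inject_Z; f_equal; lia).
  apply Qeq_eqR in E. rewrite Eu, Q2R_inject, Q2R_minus, Q2R_div_Z in E by lia.
  rewrite Z2Nat.id, plus_IZR, mult_IZR, E by easy. simpl. field.
Qed.

Lemma cf_Qeq N r t t' : (t == t')%Q -> cf N r t = cf N r t'.
Proof. intros H. unfold cf. replace (Qred (t - inject_Z (xN N r) / inject_Z 24)) with (Qred (t' - inject_Z (xN N r) / inject_Z 24)); [reflexivity|].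
  apply Qred_complete. now rewrite H.
Qed.

Lemma lhs_Qeq N r l t t' : (t == t')%Q -> lhs N r l t = lhs N r l t'.
Proof.
  intros H. unfold lhs. f_equal. apply Csum_ext. intros a _.
  rewrite (cf_Qeq N r (inject_Z l * t / inject_Z (a * a)) (inject_Z l * t' / inject_Z (a * a))) by now rewrite H.
  f_equal. apply Csum_ext. intros b _. f_equal. f_equal. f_equal. apply Qeq_eqR. now rewrite H.
Qed.

(** At [n = x/24 + j] the exponential of [lhs] splits into the part contained in [weight] and
    [e(b (x + 24 j) / (24 a))], which comes from the translation by [be] inside [f]. *)
Lemma lhs_cosets N r l j : (0 < l)%Z ->
  lhs N r l (inject_Z (xN N r) / inject_Z 24 + inject_Z j)%Q =
  Cmult (RtoC (Rpower (IZR l) (- (wt N r / 2)))) (Csum (cosets N l) (fun i =>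
    Cmult (Cmult (weight N r l i) (RtoC (Rpower (IZR (fst i)) (wt N r))))
      (Cmult (RtoC (IZR (cf N r (inject_Z l * (inject_Z (xN N r) / inject_Z 24 + inject_Z j) / inject_Z (fst i * fst i)))))
        (e (IZR (snd i * (xN N r + 24 * j)) / (24 * IZR (fst i))))))).
Proof.
  intros Hl. unfold lhs. f_equal. unfold cosets. rewrite Csum_flat_map. fold (coset_a N l).
  apply Csum_ext. intros a Ha. rewrite Csum_map. fold (coset_b l a). rewrite <- Csum_scal.
  apply Csum_ext. intros b _. cbn [fst snd]. unfold weight.
  unfold coset_a in Ha. apply filter_In in Ha. destruct Ha as [Ha _]. destruct (in_divsZ l a Hl Ha) as [Pa Ea].
  set (d := (l / a)%Z) in *.
  assert (Ra : IZR a <> 0) by (apply eq_IZR_contrapositive; lia).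
  assert (Rl : IZR l <> 0) by (apply eq_IZR_contrapositive; lia).
  assert (Rd : IZR d <> 0) by (apply eq_IZR_contrapositive; nia).
  assert (Nl : ~ (inject_Z l == 0)%Q) by (intros E; unfold Qeq, inject_Z in E; simpl in E; lia).
  replace (e (Q2R (inject_Z (b * d) * ((inject_Z (xN N r) / inject_Z 24 + inject_Z j) / inject_Z l - inject_Z (xN N r) / inject_Z 24))))
    with (Cmult (e24 (- (b * d * xN N r))) (e (IZR (b * (xN N r + 24 * j)) / (24 * IZR a)))).
  - rewrite !RtoC_mult. ring.
  - unfold e24. rewrite <- e_plus. f_equal. rewrite Q2R_mult, Q2R_minus, Q2R_div, Q2R_plus, Q2R_div_Z, !Q2R_inject by (easy || lia).
    rewrite opp_IZR, !mult_IZR, plus_IZR, mult_IZR. replace (IZR l) with (IZR a * IZR d) by (rewrite <- mult_IZR; now rewrite Ea). field. split; assumption.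
Qed.

(** Multiplied by [z^S], both sides of the eigenvalue equation are power series in [z] on the whole
    interval from 0 to 1, so their coefficients agree; the wanted identity is the one at index
    [tz]. *)
Lemma hecke_coefficients N r l (k : C) : (0 < N)%nat -> in_Lf N r l ->
  (forall tau, upper tau -> hecke N r l tau = Cmult k (eta_quot N r tau)) ->
  forall j : Z, lhs N r l (inject_Z (xN N r) / inject_Z 24 + inject_Z j)%Q =
    Cmult (Cmult (RtoC (Rpower (IZR l) (- (wt N r / 2)))) k)
          (RtoC (IZR (cf N r (inject_Z (xN N r) / inject_Z 24 + inject_Z j)%Q))).
Proof.
  intros HN Hl Hk j. pose proof (in_Lf_pos N r l Hl) as Pl. rewrite lhs_cosets by easy.
  rewrite <- Cmult_assoc. f_equal. set (x := xN N r) in *.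
  (* Large enough that [x v + S] for [0 <= v <= l^2], and the index [tz] below, are nonnegative. *)
  set (S := ((Z.abs x + 24 * Z.abs j) * (l * l))%Z).
  assert (PS : (0 <= S)%Z) by (unfold S; nia).
  assert (Rl : IZR l <> 0) by (apply eq_IZR_contrapositive; lia).
  assert (Bd : forall v, (0 <= v <= l * l)%Z -> (0 <= x * v + S)%Z) by (intros v Hv; unfold S; nia).
  assert (Hal : forall i, In i (cosets N l) -> (0 < fst i <= l /\ fst i * (l / fst i) = l)%Z).
  { intros [al be] Hi. apply in_cosets in Hi; [|easy]. simpl. destruct Hi as (_ & H1 & H2 & _ & H4 & _). split; nia. }
  (* The term of [(al, be)] has exponents [(x + 24 n) al / (24 de) = (x + 24 n) al^2 / (24 l)], that
     is, indices [A i + B i * n] after the shift. *)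
  set (A := fun i : Z * Z => Z.to_nat (x * (fst i * fst i) + S)). set (B := fun i : Z * Z => Z.to_nat (24 * (fst i * fst i))).
  set (u := fun (i : Z * Z) n => Cmult (RtoC (IZR (eta_coef N r n))) (e (IZR (snd i * (x + 24 * Z.of_nat n)) / (24 * IZR (l / fst i))))).
  set (A0 := Z.to_nat (x * l + S)). set (B0 := Z.to_nat (24 * l)).
  set (u0 := fun n => RtoC (IZR (eta_coef N r n))).
  set (K := fun i : Z * Z => Cmult (weight N r l i) (RtoC (Rpower (IZR (fst i)) (wt N r)))).
  assert (Z0 : forall t, Cminus (Csum (cosets N l) (fun i => Cmult (K i) (spread (A i) (B i) (u i) t))) (Cmult k (spread A0 B0 u0 t)) = RtoC 0).
  { apply Cpseries_zero. intros z Hz. pose proof (upper_tau_of l z Pl Hz) as Ut. set (tau := tau_of l z) in *.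
    assert (S1 : forall i, In i (cosets N l) -> is_series (fun t => Cmult (spread (A i) (B i) (u i) t) (RtoC (z ^ t)))
       (Cmult (RtoC (z ^ Z.to_nat S)) (eta_quot N r (mob (fst i) (snd i) 0 (l / fst i) tau)))).
    { intros i Hi. destruct (Hal i Hi) as [P1 P2]. set (al := fst i) in *. set (be := snd i). set (de := (l / al)%Z) in *.
      assert (Pde : (0 < de)%Z) by nia.
      apply (spread_series_real l z (fun n => (x + 24 * Z.of_nat n) * (al * al))%Z S); try easy.
      - unfold B. fold al. nia.
      - intros n. unfold A, B. fold al. pose proof (Bd (al * al)%Z ltac:(nia)). rewrite Nat2Z.inj_add, Nat2Z.inj_mul, !Z2Nat.id by nia. ring.
      - eapply is_series_ext; [|apply eta_quot_series; apply upper_mob; [nia|exact Ut]].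
        intros n. unfold u. fold al be x. change (l / al)%Z with de. eqC. rewrite <- Cmult_assoc. f_equal.
        rewrite <- ec_R, <- ec_plus. f_equal.
        assert (Rde : IZR de <> 0) by (apply eq_IZR_contrapositive; lia). assert (Rla : IZR al <> 0) by (apply eq_IZR_contrapositive; lia).
        pose proof (RtoC_neq_0 _ Rde) as C1. pose proof (RtoC_neq_0 _ Rla) as C2.
        assert (C24 : RtoC 24 <> RtoC 0) by (apply RtoC_neq_0; lra).
        fold tau. unfold mob. rewrite Cmult_0_l, Cplus_0_l. rewrite <- P2, !mult_IZR.
        set (X := IZR (x + 24 * Z.of_nat n)). unfold Rdiv. rewrite !RtoC_mult, !RtoC_inv, !RtoC_mult by (repeat apply Rmult_integral_contrapositive_currified; lra).
        field. repeat split; assumption. }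
    assert (S2 : is_series (fun t => Cmult (spread A0 B0 u0 t) (RtoC (z ^ t))) (Cmult (RtoC (z ^ Z.to_nat S)) (eta_quot N r tau))).
    { apply (spread_series_real l z (fun n => (x + 24 * Z.of_nat n) * l)%Z S); try easy.
      - unfold B0. nia.
      - intros n. unfold A0, B0. pose proof (Bd l ltac:(nia)). rewrite Nat2Z.inj_add, Nat2Z.inj_mul, !Z2Nat.id by nia. ring.
      - eapply is_series_ext; [|apply eta_quot_series; exact Ut]. intros n. unfold u0. fold x tau. f_equal. f_equal. f_equal. f_equal.
        rewrite mult_IZR. field. exact Rl. }
    assert (S3 : is_series (fun t => Csum (cosets N l) (fun i => Cmult (K i) (Cmult (spread (A i) (B i) (u i) t) (RtoC (z ^ t)))))
       (Csum (cosets N l) (fun i => Cmult (K i) (Cmult (RtoC (z ^ Z.to_nat S)) (eta_quot N r (mob (fst i) (snd i) 0 (l / fst i) tau)))))).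
    { apply (Csum_series (cosets N l) (fun i t => Cmult (K i) (Cmult (spread (A i) (B i) (u i) t) (RtoC (z ^ t))))).
      intros i Hi. exact (is_series_scal (K i) _ _ (S1 i Hi)). }
    pose proof (is_series_minus _ _ _ _ S3 (is_series_scal k _ _ S2)) as S4.
    match type of S4 with is_series _ ?v => replace v with (RtoC 0) in S4 end.
    - eapply is_series_ext; [|exact S4]. intros t.
      match goal with |- _ = ?rhs => change (Cplus (Csum (cosets N l) (fun i => Cmult (K i) (Cmult (spread (A i) (B i) (u i) t) (RtoC (z ^ t)))))
        (Copp (Cmult k (Cmult (spread A0 B0 u0 t) (RtoC (z ^ t))))) = rhs) end.
      rewrite (Csum_ext _ _ (fun i => Cmult (RtoC (z ^ t)) (Cmult (K i) (spread (A i) (B i) (u i) t)))) by (intros; ring).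
      rewrite Csum_scal. ring.
    - match goal with |- _ = ?rhs => change (RtoC 0 = Cplus (Csum (cosets N l) (fun i => Cmult (K i) (Cmult (RtoC (z ^ Z.to_nat S)) (eta_quot N r (mob (fst i) (snd i) 0 (l / fst i) tau)))))
        (Copp (Cmult k (Cmult (RtoC (z ^ Z.to_nat S)) (eta_quot N r tau))))) end.
      rewrite (Csum_ext _ _ (fun i => Cmult (RtoC (z ^ Z.to_nat S)) (Cmult (K i) (eta_quot N r (mob (fst i) (snd i) 0 (l / fst i) tau))))) by (intros; ring).
      rewrite Csum_scal. fold (hecke N r l tau). change (Csum (cosets N l) _) with (hecke N r l tau). rewrite Hk by easy. ring. }
  (* The index of [q^(x/24 + j)] on this grid. *)
  set (tz := ((x + 24 * j) * l + S)%Z). assert (Ptz : (0 <= tz)%Z) by (unfold tz, S; nia).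
  specialize (Z0 (Z.to_nat tz)).
  assert (EQ : Csum (cosets N l) (fun i => Cmult (K i) (spread (A i) (B i) (u i) (Z.to_nat tz))) = Cmult k (spread A0 B0 u0 (Z.to_nat tz))).
  { set (a := Csum _ _) in *. set (b := Cmult k _) in *. replace a with (Cplus (Cminus a b) b) by ring. rewrite Z0. ring. }
  transitivity (Cmult k (spread A0 B0 u0 (Z.to_nat tz))).
  - rewrite <- EQ. apply Csum_ext. intros i Hi. destruct (Hal i Hi) as [P1 P2]. fold (K i). f_equal.
    assert (Ra : IZR (fst i) <> 0) by (apply eq_IZR_contrapositive; lia).
    assert (Ea : IZR l = IZR (fst i) * IZR (l / fst i)) by (rewrite <- mult_IZR; now rewrite P2).
    assert (Rd : IZR (l / fst i) <> 0) by (intros E; rewrite E, Rmult_0_r in Ea; easy).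
    pose proof (Bd (fst i * fst i)%Z ltac:(nia)) as PA.
    assert (QQ : Q2R (inject_Z l * (inject_Z x / inject_Z 24 + inject_Z j) / inject_Z (fst i * fst i)) = IZR ((x + 24 * j) * l) / (24 * IZR (fst i * fst i))).
    { rewrite Q2R_div, Q2R_mult, Q2R_plus, Q2R_div_Z, !Q2R_inject by (try lia; intros E; unfold Qeq, inject_Z in E; simpl in E; nia).
      rewrite !mult_IZR, plus_IZR, mult_IZR. field. easy. }
    assert (Raa : IZR (fst i * fst i) <> 0) by (apply eq_IZR_contrapositive; nia).
    (* [tz] is hit by the [n]-th term exactly when [l t / al^2] is the [n]-th exponent of [f];
       otherwise both [spread] and [cf] give 0. *)
    assert (Iff : forall n : nat, Q2R (inject_Z l * (inject_Z x / inject_Z 24 + inject_Z j) / inject_Z (fst i * fst i)) = IZR (x + 24 * Z.of_nat n) / 24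
        <-> ((x + 24 * j) * l = (x + 24 * Z.of_nat n) * (fst i * fst i))%Z).
    { intros n. rewrite QQ. split; intros E.
      - apply eq_IZR. rewrite (mult_IZR (x + 24 * Z.of_nat n)).
        transitivity (IZR ((x + 24 * j) * l) / (24 * IZR (fst i * fst i)) * (24 * IZR (fst i * fst i))); [field; easy|].
        rewrite E. field.
      - rewrite E, (mult_IZR (x + 24 * Z.of_nat n)). field. easy. }
    unfold spread. destruct (Nat.leb_spec (A i) (Z.to_nat tz)) as [L|L]; [destruct (Nat.eqb_spec ((Z.to_nat tz - A i) mod B i) 0) as [M|M]|]; cbn [andb].
    + apply Nat.Div0.div_exact in M. set (n := ((Z.to_nat tz - A i) / B i)%nat) in *.
      assert (Et : ((x + 24 * j) * l = (x + 24 * Z.of_nat n) * (fst i * fst i))%Z).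
      { assert (E : Z.to_nat tz = (A i + B i * n)%nat) by lia. apply (f_equal Z.of_nat) in E.
        unfold A, B in E. rewrite Nat2Z.inj_add, Nat2Z.inj_mul, !Z2Nat.id in E by (easy || nia). unfold tz in E. lia. }
      rewrite (cf_int N r _ n) by now apply Iff. unfold u. f_equal. f_equal.
      assert (Er : IZR (x + 24 * j) * IZR (l / fst i) = IZR (x + 24 * Z.of_nat n) * IZR (fst i)).
      { rewrite <- !mult_IZR. f_equal. apply (Z.mul_reg_l _ _ (fst i)); [lia|].
        replace (fst i * ((x + 24 * j) * (l / fst i)))%Z with ((x + 24 * j) * (fst i * (l / fst i)))%Z by ring. rewrite P2, Et. ring. }
      rewrite !mult_IZR. apply (Rmult_eq_reg_r (24 * IZR (fst i) * IZR (l / fst i))); [|repeat apply Rmult_integral_contrapositive_currified; lra].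
      transitivity (IZR (snd i) * (IZR (x + 24 * j) * IZR (l / fst i))); [field; easy|]. rewrite Er. field. easy.
    + rewrite cf_not; [rewrite Cmult_0_l; reflexivity|]. intros n E. apply Iff in E. apply M.
      assert (Et : Z.to_nat tz = (A i + n * B i)%nat).
      { apply Nat2Z.inj. unfold A, B. rewrite Nat2Z.inj_add, Nat2Z.inj_mul, !Z2Nat.id by (easy || nia). unfold tz. lia. }
      rewrite Et. replace (A i + n * B i - A i)%nat with (n * B i)%nat by lia. apply Nat.Div0.mod_mul.
    + rewrite cf_not; [rewrite Cmult_0_l; reflexivity|]. intros n E. apply Iff in E.
      assert (Et : Z.to_nat tz = (A i + n * B i)%nat).
      { apply Nat2Z.inj. unfold A, B. rewrite Nat2Z.inj_add, Nat2Z.inj_mul, !Z2Nat.id by (easy || nia). unfold tz. lia. }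
      lia.
  - f_equal. assert (QQ : Q2R (inject_Z x / inject_Z 24 + inject_Z j) = IZR (x + 24 * j) / 24).
    { rewrite Q2R_plus, Q2R_div_Z, Q2R_inject, plus_IZR, mult_IZR by lia. field. }
    pose proof (Bd l ltac:(nia)) as PA.
    unfold spread. destruct (Nat.leb_spec A0 (Z.to_nat tz)) as [L|L].
    + assert (Pj : (0 <= j)%Z).
      { unfold A0, tz in L. assert (x * l + S <= (x + 24 * j) * l + S)%Z by lia. nia. }
      assert (Et : (Z.to_nat tz - A0 = B0 * Z.to_nat j)%nat).
      { apply Nat2Z.inj. rewrite Nat2Z.inj_sub, Nat2Z.inj_mul by easy. unfold A0, B0. rewrite !Z2Nat.id by (easy || nia). unfold tz. ring. }
      assert (PB0 : B0 <> O) by (unfold B0; nia).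
      rewrite Et. rewrite (Nat.mul_comm B0), Nat.Div0.mod_mul, Nat.div_mul by easy. cbn [Nat.eqb andb].
      unfold u0. rewrite (cf_int N r _ (Z.to_nat j)); [reflexivity|]. rewrite Z2Nat.id by easy. exact QQ.
    + cbn [andb]. rewrite cf_not; [reflexivity|]. intros n E. rewrite QQ in E. fold x in E.
      assert (Ej : (j = Z.of_nat n)%Z).
      { assert (E' : IZR (x + 24 * j) = IZR (x + 24 * Z.of_nat n)) by lra. apply eq_IZR in E'. lia. }
      unfold A0, tz in L. subst j. nia.
Qed.

Theorem theorem9p19 :
  forall (N : nat) (r : nat -> Z),
    (0 < N)%nat ->
    (* r is supported on the divisors of N ... *)
    (forall n : nat, r n <> 0%Z -> (0 < n)%nat /\ Nat.divide n N) ->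
    (* ... and N = lcm{ n : r_n <> 0 } is the level *)
    (forall M : nat, (forall n : nat, r n <> 0%Z -> Nat.divide n M) -> Nat.divide N M) ->
    weakly_admissible N r ->
    forall l : Z, in_Lf N r l ->
      let x0 : Q := (inject_Z (xN N r) / inject_Z 24)%Q in
      (exists! c : C, forall j : Z,
          lhs N r l (x0 + inject_Z j)%Q = Cmult c (RtoC (IZR (cf N r (x0 + inject_Z j)%Q))))
      /\
      (forall j : Z,
          lhs N r l (x0 + inject_Z j)%Q
          = Cmult (lhs N r l x0) (RtoC (IZR (cf N r (x0 + inject_Z j)%Q)))).
Proof.
  intros N r HN _ _ Hw l Hl x0.
  destruct (hecke_eigen N r l HN Hl Hw) as [k Hk].
  pose proof (hecke_coefficients N r l k HN Hl Hk) as E. fold x0 in E.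
  set (c := Cmult (RtoC (Rpower (IZR l) (- (wt N r / 2)))) k) in E.
  (* The leading coefficient is 1, so the identity at [j = 0] determines the constant: this gives
     both uniqueness and its value. *)
  assert (C0 : cf N r (x0 + inject_Z 0) = 1%Z).
  { rewrite (cf_int N r _ 0); [apply eta_coef_0|].
    unfold x0. rewrite Q2R_plus, Q2R_div_Z, Q2R_inject by lia. rewrite Z.add_0_r. field. }
  assert (L0 : lhs N r l x0 = c).
  { rewrite (lhs_Qeq N r l x0 (x0 + inject_Z 0)).
    - rewrite E, C0. ring.
    - change (inject_Z 0) with 0%Q. now rewrite Qplus_0_r. }
  split.
  - exists c. split; [exact E|]. intros c' E'. specialize (E' 0%Z). rewrite E, C0, !Cmult_1_r in E'. exact E'.
  - intros j. rewrite L0. apply E.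
Qed.
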